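(* Let $\psi\colon\mathbb R^+\to\mathbb R^+$ be a continuous nondecreasing function vanishing only at $0$. The norm of the matrix Riesz projection on $\mathrm S^\psi(\mathrm S^\psi)$ coincides with its norm on $\mathrm S^\psi$, and the norm of the matrix Hilbert transform on $\mathrm S^\psi(\mathrm S^\psi)$ coincides with its norm on $\mathrm S^\psi$. Moreover: (i) if $p=2^k$ with $k\ge1$ an integer, then the norm of the matrix Hilbert transform on $\mathrm S^p$ is $\cot(\pi/2p)$; (ii) the norm of the matrix Riesz projection on $\mathrm S^4$ is $\sqrt2$.
   Context: For a sequence $\varphi=(\varphi_k)_{k\in\mathbb Z}$, the associated Toeplitz Schur multiplier acts on matrices by $(x_{r,c})_{(r,c)\in\mathbb Z\times\mathbb Z}\mapsto(\varphi_{r-c}x_{r,c})_{(r,c)\in\mathbb Z\times\mathbb Z}$. The matrix Riesz projection is the Schur multiplier for $\varphi$ the indicator function of the nonnegative integers. The matrix Hilbert transform is the Schur multiplier for $\varphi=\operatorname{sgn}$ the sign function, with the convention $\operatorname{sgn}(0)=1$. $\mathrm S^\psi$ is the space of compact operators $x$ on $\ell^2_{\mathbb Z}$ with $\operatorname{tr}\psi(|x|/a)<\infty$ for some $a>0$, with $\|x\|_{\mathrm S^\psi}=\inf\{a>0:\operatorname{tr}\psi(|x|/a)\le1\}$ if $\psi$ is convex and $\|x\|_{\mathrm S^\psi}=\inf\{a>0:\operatorname{tr}\psi(|x|/a)\le a\}$ otherwise (an F-norm). $\mathrm S^\psi(\mathrm S^\psi)$ is defined in the same way with compact operators on $\ell^2\otimes\ell^2_{\mathbb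 Z}$ and the trace $\operatorname{tr}\otimes\operatorname{tr}$; its elements are seen as matrices indexed by $\mathbb Z\times\mathbb Z$ whose entries are operators on $\ell^2$, and Schur multipliers act on these entries by scalar multiplication. $\mathrm S^p$ is $\mathrm S^\psi$ for $\psi(t)=t^p$. The norm of a Schur multiplier $T$ is the least $C\in[0,\infty]$ such that $\|Tx\|\le C\|x\|$ for all finitely supported matrices $x$. *)

(* Defs.v *)
From HB Require Import structures.
From mathcomp Require Import all_boot all_order all_algebra.
From mathcomp Require Import complex.
From mathcomp Require Import all_classical all_reals all_analysis.

Set Implicit Arguments.
Unset Strict Implicit.
Unset Printing Implicit Defensive.
Import Order.TTheory GRing.Theory Num.Theory.
Import numFieldNormedType.Exports.
Local Open Scope classical_set_scope.
Local Open Scope ring_scope.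

(* Unconditional sum of an absolutely summable family of complex numbers,
   taken separately on the positive and negative parts of the real and
   imaginary parts. The value for other families is irrelevant: for bounded
   matrices and square-summable vectors only absolutely summable families are
   summed below. *)
Definition rsum (R : realType) (I : choiceType) (f : I -> R) : R :=
  fine (\esum_(i in [set: I]) (Num.max (f i) 0)%:E
        - \esum_(i in [set: I]) (Num.max (- f i) 0)%:E)%E.

Definition csum (R : realType) (I : choiceType) (f : I -> R[i]) : R[i] :=
  Complex (rsum (fun i => complex.Re (f i))) (rsum (fun i => complex.Im (f i))).

(* The Hilbert space l^2(I): square norm in [0, +oo] and inner product, which
   is linear in the first argument. *)
Definition sqnorm (R : realType) (I : choiceType) (v : I -> R[i]) : \bar R :=
  (\esum_(i in [set: I]) (complex.Re (v i) ^+ 2 + complex.Im (v i) ^+ 2)%:E)%E.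

Definition ell2 (R : realType) (I : choiceType) : set (I -> R[i]) :=
  [set v | (sqnorm v < +oo)%E].

Definition inner (R : realType) (I : choiceType) (v w : I -> R[i]) : R[i] :=
  csum (fun i => v i * conjc (w i)).

(* Operators on l^2(I) are identified with their matrices in the canonical
   basis: the coefficient x i j is <x e_j, e_i>. *)
Definition opmx (R : realType) (I : choiceType) := I -> I -> R[i].

Definition app (R : realType) (I : choiceType) (x : opmx R I) (v : I -> R[i]) :
  I -> R[i] := fun i => csum (fun j => x i j * v j).

Definition opmul (R : realType) (I : choiceType) (x y : opmx R I) : opmx R I :=
  fun i j => csum (fun k => x i k * y k j).

Definition adj (R : realType) (I : choiceType) (x : opmx R I) : opmx R I :=
  fun i j => conjc (x j i).

Definition bounded_op (R : realType) (I : choiceType) (x : opmx R I) : Prop :=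
  exists C : R, forall v, ell2 v -> (sqnorm (app x v) <= C%:E * sqnorm v)%E.

Definition compact_op (R : realType) (I : choiceType) (x : opmx R I) : Prop :=
  bounded_op x /\
  forall v : nat -> I -> R[i], (forall n, (sqnorm (v n) <= 1)%E) ->
    exists s : nat -> nat, {homo s : m n / (m < n)%N} /\
    exists2 w, ell2 w &
      (fun n => sqnorm (fun i => app x (v (s n)) i - w i)) @ \oo --> (0 : \bar R).

(* In the order of R[i], 0 <= z means that z is real and nonnegative. *)
Definition positive_op (R : realType) (I : choiceType) (x : opmx R I) : Prop :=
  bounded_op x /\ forall v, ell2 v -> 0 <= inner (app x v) v.

(* |x|, the positive square root of x^* x. *)
Definition absop (R : realType) (I : choiceType) (x : opmx R I) : opmx R I :=
  xget (fun _ _ => 0)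
    [set y | positive_op y /\ opmul y y = opmul (adj x) x].

(* Functional calculus f(y) for a compact positive operator y: as the
   eigenvectors of y span a dense subspace, f(y) is the unique bounded operator
   acting on each eigenspace ker (y - l) as multiplication by f l. *)
Definition funcalc (R : realType) (I : choiceType) (f : R -> R)
    (y : opmx R I) : opmx R I :=
  xget (fun _ _ => 0)
    [set z | bounded_op z /\
      forall (l : R) (v : I -> R[i]), 0 <= l -> ell2 v ->
        app y v = (fun i => (real_complex R l) * v i) ->
        app z v = (fun i => (real_complex R (f l)) * v i)].

(* Trace of a positive operator. On l^2(N x Z) = l^2 (x) l^2_Z this is
   tr (x) tr. *)
Definition trace (R : realType) (I : choiceType) (x : opmx R I) : \bar R :=
  (\esum_(i in [set: I]) (complex.Re (x i i))%:E)%E.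

(* tr psi(|x|/a) *)
Definition trpsi (R : realType) (I : choiceType) (psi : R -> R) (x : opmx R I)
    (a : R) : \bar R :=
  trace (funcalc psi (fun i j => absop x i j / real_complex R a)).

Definition schatten (R : realType) (I : choiceType) (psi : R -> R) :
    set (opmx R I) :=
  [set x | compact_op x /\ exists2 a : R, 0 < a & (trpsi psi x a < +oo)%E].

(* Functions on the half-line are given by total functions R -> R, of which
   only the values on [0, +oo[ matter. *)
Definition schatten_norm (R : realType) (I : choiceType) (psi : R -> R)
    (x : opmx R I) : \bar R :=
  if `[< convex_function (`[0, +oo[%classic : set R) psi >]
  then ereal_inf [set a%:E | a in [set a : R | 0 < a /\ (trpsi psi x a <= 1)%E]]
  else ereal_inf
    [set a%:E | a in [set a : R | 0 < a /\ (trpsi psi x a <= a%:E)%E]].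

(* Block matrices: an operator x on l^2(I) together with pos : I -> int is seen
   as the Z x Z matrix of blocks x_{r,c} = (x i j)_{pos i = r, pos j = c}. For
   pos = id on I = int these blocks are the scalar coefficients of x; for
   pos = snd on I = nat * int they are operators on l^2(nat). *)
Definition finitely_supported (R : realType) (I : choiceType) (pos : I -> int)
    (x : opmx R I) : Prop :=
  finite_set [set rc : int * int | exists i j,
    [/\ pos i = rc.1, pos j = rc.2 & x i j != 0]].

Definition toeplitz_schur (R : realType) (I : choiceType) (pos : I -> int)
    (phi : int -> R[i]) (x : opmx R I) : opmx R I :=
  fun i j => phi (pos i - pos j) * x i j.

(* The infimum of the admissible constants is attained. *)
Definition schur_norm (R : realType) (I : choiceType) (pos : I -> int)
    (psi : R -> R) (phi : int -> R[i]) : \bar R :=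
  ereal_inf [set C : \bar R | (0 <= C)%E /\
    forall x : opmx R I, finitely_supported pos x -> schatten psi x ->
      (schatten_norm psi (toeplitz_schur pos phi x)
        <= C * schatten_norm psi x)%E].

(* Norms of the Toeplitz Schur multiplier phi on S^psi and on S^psi(S^psi). *)
Definition norm_S (R : realType) (psi : R -> R) (phi : int -> R[i]) : \bar R :=
  schur_norm (fun r : int => r) psi phi.

Definition norm_SS (R : realType) (psi : R -> R) (phi : int -> R[i]) : \bar R :=
  schur_norm (fun ir : nat * int => ir.2) psi phi.

Definition riesz (R : realType) (k : int) : R[i] := if 0 <= k then 1 else 0.

Definition hilbert (R : realType) (k : int) : R[i] := if 0 <= k then 1 else -1.

Definition cot (R : realType) (t : R) : R := cos t / sin t.

(* Main.v *)
Require Import Defs.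
From HB Require Import structures.
From mathcomp Require Import all_boot all_order all_algebra.
From mathcomp Require Import complex.
From mathcomp Require Import all_classical all_reals all_analysis.
From mathcomp Require Import ring lra zify.
Set Implicit Arguments.
Unset Strict Implicit.
Unset Printing Implicit Defensive.
Import Order.TTheory GRing.Theory Num.Theory.
Import numFieldNormedType.Exports.
Local Open Scope classical_set_scope.
Local Open Scope ring_scope.

(** Throughout, y' denotes the adjoint of y (hc y for a finite matrix), and |y|_p
    the norm of y in S^p.

    Scalar and block multipliers. The symbols of both multipliers depend only
    on the sign of r - c, so that the multipliers see the relative order of the
    rows and columns of a matrix, not their indices. Cut a block matrix down to
    n + 1 rows and columns in every block and list all of them along Z, block
    after block, the columns of a block before its rows: this is a scalar
    matrix on which the scalar multiplier acts as the block multiplier did.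
    Selecting rows and columns does not increase singular values
    (svd_compare), hence tr psi(|x|/a), and the norm of x is recovered from its
    truncations by lower semicontinuity (norm_lsc). This is norm_SS_eq. It
    rests on the Schmidt decomposition (ex_svd), by which tr psi(|x|/a) is the
    sum of psi(s_k/a) over the singular values of x (trpsiE).

    Reduction to finite matrices. For psi(t) = t^p and p = 2^(k+1), the norm of
    a finite matrix X is the p-th root of tr (X'X)^(p/2) (ns_pow, trpsi_emb),
    and Schur norms are suprema over finite matrices (norm_S_matrix).

    Upper bounds. Let H be the Hilbert transform and P the Riesz projection.
    Cotlar's identity (HX)(HX)' = XX' - H((HX)X' - X(HX)') and Hoelder's
    inequality bound the norm c' of H on S^2p in terms of its norm c on S^p by
    the positive root of c'^2 = 1 + 2 c c'. This is the recursion satisfied by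
    cot(pi/2p), and c = 1 on S^2 (htrans_double, htrans_upper). The bound
    sqrt 2 for P on S^4 is a sum of squares (rproj_four).

    Lower bound for H. The matrix A = (1 - S)^(-1/p), where S is the nilpotent
    shift, is lower triangular with unit diagonal. Its numerical range lies in
    the sector of half-angle pi/2p (shroot_cone), so that A = u + iv with
    -tan(pi/2p) u <= v <= tan(pi/2p) u and therefore |v|_p <= tan(pi/2p) |u|_p
    (ns_mono). On the other hand H(iv) = u - 1, and for large sizes the norm of
    1 is negligible compared with that of A, because the coefficients of
    (1 - z)^(-1/2) are not square summable (sq_unbounded, lower_family).

    Lower bound for P on S^4. For p = 4, let t = tan(pi/8). As
    tr A^4 = |1|_4^4 is small compared with |A|_4^4, v^2 is close to t^2 u^2 in
    S^2 (near_extremal). Put r = 1/sqrt 2. The matrix x = A - r A' satisfies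
    xx' = AA'/2 + (2 + t)(v^2 - t^2 u^2), so that |x|_4 is close to
    |A|_4/sqrt 2, whereas P x = A - r is close to A (test_modulus,
    rproj_lower). *)

(** * Absolutely summable families *)

Section RealSums.
Context (R : realType) (I : choiceType).
Implicit Types f g h : I -> R.

Definition absummable f := (\esum_(i in [set: I]) (`|f i|)%:E < +oo)%E.

Lemma absummable_le f g : (forall i, `|f i| <= `|g i|) ->
  absummable g -> absummable f.
Proof.
move=> fg; apply: le_lt_trans; apply: le_esum => i _.
by rewrite lee_fin.
Qed.

Lemma absummableD f g : absummable f -> absummable g ->
  absummable (fun i => f i + g i).
Proof.
move=> sf sg; apply: le_lt_trans (lte_add_pinfty sf sg).
rewrite -esumD //; try by move=> *; rewrite lee_fin.
by apply: le_esum => i _; rewrite -EFinD lee_fin ler_normD.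
Qed.

Lemma absummableZ (a : R) f : absummable f -> absummable (fun i => a * f i).
Proof.
move=> sf.
suff H (n : nat) : absummable (fun i => n%:R * f i).
  apply: (absummable_le _ (H (Num.truncn `|a|).+1)) => i.
  rewrite !normrM ler_wpM2r // normr_nat ltW //.
  by rewrite truncnS_gt.
elim: n => [|n IH].
  apply: (absummable_le _ sf) => i; by rewrite mul0r normr0.
apply: (absummable_le _ (absummableD IH sf)) => i.
by rewrite -natr1 mulrDl mul1r.
Qed.

Lemma absummableN f : absummable f -> absummable (fun i => - f i).
Proof. by apply: absummable_le => i; rewrite normrN. Qed.

Lemma absummable_fin f : absummable f -> (forall i, 0 <= f i) ->
  (\esum_(i in [set: I]) (f i)%:E)%E \is a fin_num.
Proof.
move=> sf f0; rewrite ge0_fin_numE; last by apply: esum_ge0 => i _; rewrite lee_fin.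
rewrite (_ : (\esum_(i in _) _)%E = (\esum_(i in [set: I]) `|f i|%:E)%E) //.
by apply: eq_esum => i _; rewrite ger0_norm.
Qed.

Lemma rsumB f g : absummable f -> absummable g ->
  (forall i, 0 <= f i) -> (forall i, 0 <= g i) ->
  rsum (fun i => f i - g i)
  = fine (\esum_(i in [set: I]) (f i)%:E)%E
    - fine (\esum_(i in [set: I]) (g i)%:E)%E.
Proof.
move=> sf sg f0 g0; rewrite -fineB ?absummable_fin //.
rewrite -(@esumB R I setT (EFin \o f) (EFin \o g)) //=; last first.
- by move=> i _; rewrite lee_fin.
- by move=> i _; rewrite lee_fin.
by rewrite /rsum; congr (fine (_ - _)%E); apply: eq_esum => i _;
  rewrite ?funeposE ?funenegE /= -?EFinB -?EFinN -EFin_max.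
Qed.

Lemma absummable_pos f : absummable f -> absummable (fun i => Num.max (f i) 0).
Proof.
apply: absummable_le => i; rewrite ger0_norm ?le_max ?lexx ?orbT //.
by rewrite ge_max normr_ge0 andbT ler_norm.
Qed.

Lemma max_decomp (x : R) : x = Num.max x 0 - Num.max (- x) 0.
Proof.
have [x0|/ltW x0] := leP 0 x.
  by rewrite max_r ?subr0 // oppr_le0.
by rewrite max_l ?sub0r ?opprK // oppr_ge0.
Qed.

(** Positive and negative parts are not additive; both sides are reduced to
    differences of sums of nonnegative families, where rsumB applies. *)
Lemma rsumD f g : absummable f -> absummable g ->
  rsum (fun i => f i + g i) = rsum f + rsum g.
Proof.
move=> sf sg.
have pf := absummable_pos sf; have pg := absummable_pos sg.
have nf := absummable_pos (absummableN sf).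
have ng := absummable_pos (absummableN sg).
have m0 (x : R) : 0 <= Num.max x 0 by rewrite le_max lexx orbT.
have -> : (fun i => f i + g i) =
   (fun i => (Num.max (f i) 0 + Num.max (g i) 0)
           - (Num.max (- f i) 0 + Num.max (- g i) 0)).
  by apply/funext => i; rewrite {1}(max_decomp (f i)) {1}(max_decomp (g i)); ring.
have -> : rsum f = rsum (fun i => Num.max (f i) 0 - Num.max (- f i) 0).
  by congr rsum; apply/funext => i; rewrite -max_decomp.
have -> : rsum g = rsum (fun i => Num.max (g i) 0 - Num.max (- g i) 0).
  by congr rsum; apply/funext => i; rewrite -max_decomp.
rewrite !rsumB //; try exact: absummableD; try by move=> i; rewrite addr_ge0.
under [X in fine X - _]eq_esum do rewrite EFinD.
under [X in _ - fine X]eq_esum do rewrite EFinD.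
rewrite !esumD; try by move=> i _; rewrite lee_fin.
rewrite !fineD ?absummable_fin //. ring.
Qed.

Lemma rsumN f : rsum (fun i => - f i) = - rsum f.
Proof.
rewrite /rsum -fineN.
have -> : (fun i => (Num.max (- - f i) 0)%:E) = (fun i => (Num.max (f i) 0)%:E).
  by apply/funext => i; rewrite opprK.
set a := esum _ _; set b := esum _ _.
have : (0 <= a)%E by apply: esum_ge0 => i _; rewrite lee_fin le_max lexx orbT.
have : (0 <= b)%E by apply: esum_ge0 => i _; rewrite lee_fin le_max lexx orbT.
by move: a b => [a| |] [b| |] //= _ _; rewrite opprB.
Qed.

Lemma rsum_ge0E f : absummable f -> (forall i, 0 <= f i) ->
  rsum f = fine (\esum_(i in [set: I]) (f i)%:E)%E.
Proof.
move=> sf f0.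
have s0 : absummable (fun=> 0 : R).
  by apply: (absummable_le _ sf) => i; rewrite normr0.
have := rsumB sf s0 f0 (fun=> lexx _).
rewrite (_ : (fun i => f i - 0) = f); last by apply/funext => i; rewrite subr0.
by move=> ->; rewrite [X in _ - fine X]esum1 // subr0.
Qed.

Lemma esumZ (a : R) f : 0 <= a -> (forall i, 0 <= f i) ->
  (\esum_(i in [set: I]) (a * f i)%:E = a%:E * \esum_(i in [set: I]) (f i)%:E)%E.
Proof.
move=> a0 f0; have [->|an0] := eqVneq a 0.
  by rewrite mul0e; apply: esum1 => i _; rewrite mul0r.
have ap : 0 < a by rewrite lt_neqAle eq_sym an0.
have H (b : R) (g : I -> R) : 0 < b -> (forall i, 0 <= g i) ->
  (\esum_(i in [set: I]) (b * g i)%:E <= b%:E * \esum_(i in [set: I]) (g i)%:E)%E.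
  move=> b0 g0; apply: ge_ereal_sup => _ [F [finF _] <-].
  rewrite (eq_fsbigr (fun i => b%:E * (g i)%:E)%E); last by move=> i _; rewrite EFinM.
  rewrite -ge0_mule_fsumr; last by move=> i; rewrite lee_fin.
  apply: lee_wpmul2l; first by rewrite lee_fin ltW.
  by apply: ereal_sup_ubound; exists F.
apply/eqP; rewrite eq_le H //=.
have /(_ a^-1 (fun i => a * f i)) := H.
rewrite invr_gt0 ap => /(_ isT) /(_ (fun i => mulr_ge0 a0 (f0 i))) /=.
rewrite (_ : (\esum_(i in [set: I]) (a^-1 * (a * f i))%:E)%E =
   (\esum_(i in [set: I]) (f i)%:E)%E); last first.
  by apply: eq_esum => i _; rewrite mulKf.
move=> {}H; rewrite -(@lee_pmul2l _ a^-1%:E) //; last by rewrite lte_fin invr_gt0.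
by rewrite muleA -EFinM mulVf // mul1e.
Qed.

Lemma rsumZ (a : R) f : absummable f -> rsum (fun i => a * f i) = a * rsum f.
Proof.
move=> sf.
wlog a0 : a / 0 <= a.
  move=> H; have [a0|/ltW a0] := leP 0 a; first exact: H.
  have Ha : rsum (fun i => - a * f i) = - a * rsum f by apply: H; rewrite oppr_ge0.
  apply: oppr_inj; rewrite -mulNr -Ha -rsumN.
  by congr rsum; apply/funext => i; rewrite mulNr.
have m0 (x : R) : 0 <= Num.max x 0 by rewrite le_max lexx orbT.
have pf := absummable_pos sf.
have nf := absummable_pos (absummableN sf).
have E : rsum f = rsum (fun i => Num.max (f i) 0 - Num.max (- f i) 0).
  by congr rsum; apply/funext => i; rewrite -max_decomp.
rewrite E rsumB // (_ : (fun i => a * f i) =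
  (fun i => a * Num.max (f i) 0 - a * Num.max (- f i) 0)); last first.
  by apply/funext => i; rewrite {1}(max_decomp (f i)) mulrBr.
rewrite rsumB //; try exact: absummableZ; try by move=> i; rewrite mulr_ge0.
by rewrite !esumZ // !fineM ?absummable_fin // mulrBr.
Qed.

Lemma rsum0 : rsum (fun _ : I => 0 : R) = 0.
Proof. by rewrite /rsum oppr0 maxxx !esum1 ?sube0. Qed.

Lemma absummable1 (j : I) (a : R) : absummable (fun i => if i == j then a else 0).
Proof.
rewrite /absummable (_ : esum _ _ = `|a|%:E) ?ltry //.
rewrite -(@esum_set1 R I j (fun=> `|a|%:E)) //.
rewrite [RHS]esum_mkcond; apply: eq_esum => i _ /=.
case: (eqVneq i j) => [->|ij]; first by rewrite mem_set.
by rewrite memNset ?normr0 //= => /eqP; rewrite (negPf ij).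
Qed.

Lemma rsum1 (j : I) (a : R) : rsum (fun i => if i == j then a else 0) = a.
Proof.
wlog a0 : a / 0 <= a.
  move=> H; have [a0|/ltW a0] := leP 0 a; first exact: H.
  rewrite -[RHS]opprK -[in RHS](H (- a)) ?oppr_ge0 // -rsumN; congr rsum.
  by apply/funext => i; case: ifP => _; rewrite ?opprK ?oppr0.
rewrite rsum_ge0E //; [|exact: absummable1|by move=> i; case: ifP].
rewrite -[RHS]/(fine a%:E); congr fine.
rewrite -(@esum_set1 R I j (fun=> a%:E)) ?lee_fin //.
rewrite [RHS]esum_mkcond; apply: eq_esum => i _ /=.
case: (eqVneq i j) => [->|ij]; first by rewrite mem_set.
by rewrite memNset //= => /eqP; rewrite (negPf ij).
Qed.

End RealSums.

Section ComplexSums.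
Context (R : realType) (I : choiceType).
Implicit Types f g h : I -> R[i].

Definition csummable f :=
  absummable (fun i => complex.Re (f i)) /\ absummable (fun i => complex.Im (f i)).

Lemma csummableD f g : csummable f -> csummable g ->
  csummable (fun i => f i + g i).
Proof.
move=> [rf jf] [rg jg]; split.
  by apply: absummable_le (absummableD rf rg) => i; rewrite raddfD.
by apply: absummable_le (absummableD jf jg) => i; rewrite raddfD.
Qed.

Lemma Re_mulc (a b : R[i]) : complex.Re (a * b)
  = complex.Re a * complex.Re b - complex.Im a * complex.Im b.
Proof. by case: a b => ? ? [? ?]. Qed.

Lemma Im_mulc (a b : R[i]) : complex.Im (a * b)
  = complex.Re a * complex.Im b + complex.Im a * complex.Re b.
Proof. by case: a b => ? ? [? ?]. Qed.

Lemma complexP (a b : R[i]) : complex.Re a = complex.Re b ->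
  complex.Im a = complex.Im b -> a = b.
Proof. by case: a b => ? ? [? ?] /= -> ->. Qed.

Lemma csumD f g : csummable f -> csummable g ->
  csum (fun i => f i + g i) = csum f + csum g.
Proof.
move=> [rf jf] [rg jg]; apply: complexP; rewrite /= ?raddfD /=.
  by rewrite -rsumD //; congr rsum; apply/funext => i; rewrite raddfD.
by rewrite -rsumD //; congr rsum; apply/funext => i; rewrite raddfD.
Qed.

Lemma csumZ a f : csummable f -> csum (fun i => a * f i) = a * csum f.
Proof.
move=> [rf jf]; apply: complexP.
  rewrite Re_mulc /= (_ : (fun i => complex.Re (a * f i)) = (fun i =>
    complex.Re a * complex.Re (f i) + - (complex.Im a * complex.Im (f i)))).
    rewrite rsumD ?rsumN ?rsumZ //; first exact: absummableZ.
    by apply: absummableN; exact: absummableZ.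
  by apply/funext => i; rewrite Re_mulc.
rewrite Im_mulc /= (_ : (fun i => complex.Im (a * f i)) = (fun i =>
  complex.Re a * complex.Im (f i) + complex.Im a * complex.Re (f i))).
  by rewrite rsumD ?rsumZ //; exact: absummableZ.
by apply/funext => i; rewrite Im_mulc.
Qed.

Lemma csumJ f : csum (fun i => conjc (f i)) = conjc (csum f).
Proof.
apply: complexP => /=; rewrite -?rsumN; congr rsum; apply/funext => i;
 by case: (f i).
Qed.

Lemma csum0 : csum (fun _ : I => 0 : R[i]) = 0.
Proof. by apply: complexP; rewrite /= rsum0. Qed.

Lemma csum1 (j : I) (a : R[i]) : csum (fun i => if i == j then a else 0) = a.
Proof.
by apply: complexP => /=; rewrite -[RHS](rsum1 j); congr rsum;
  apply/funext => i; case: ifP.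
Qed.

Lemma csummable1 (j : I) (a : R[i]) : csummable (fun i => if i == j then a else 0).
Proof.
split; [have := absummable1 j (complex.Re a)|have := absummable1 j (complex.Im a)];
  by apply: absummable_le => i; case: ifP => _; rewrite ?raddf0.
Qed.

Lemma csummable_seq (s : seq I) f : {in predC (mem s), f =1 fun=> 0} ->
  csummable f.
Proof.
elim: s f => [|j s IH] f f0.
  rewrite (_ : f = fun=> 0); last by apply/funext => i; rewrite f0.
  by split; rewrite /absummable esum1 // => i _; rewrite normr0.
have -> : f = (fun i => (if i == j then f j else 0) + (if i == j then 0 else f i)).
  by apply/funext => i; case: eqP => [->|_]; rewrite ?addr0 ?add0r.
apply: csummableD; first exact: csummable1.
apply: IH => i; rewrite inE /= => si; case: eqP => // /eqP ij.
by apply: f0; rewrite !inE negb_or ij si.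
Qed.

Lemma csum_seq (s : seq I) f : uniq s -> {in predC (mem s), f =1 fun=> 0} ->
  csum f = \sum_(i <- s) f i.
Proof.
elim: s f => [|j s IH] f /=.
  move=> _ f0; rewrite big_nil (_ : f = fun=> 0) ?csum0 //.
  by apply/funext => i; rewrite f0.
move=> /andP[js us] f0.
have {1}-> : f = (fun i => (if i == j then f j else 0) + (if i == j then 0 else f i)).
  by apply/funext => i; case: eqP => [->|_]; rewrite ?addr0 ?add0r.
have f0' : {in predC (mem s), (fun i => if i == j then 0 else f i) =1 fun=> 0}.
  move=> i; rewrite inE /= => si; case: eqP => // /eqP ij.
  by apply: f0; rewrite !inE negb_or ij si.
rewrite csumD; [|exact: csummable1|exact: csummable_seq f0'].
rewrite csum1 big_cons (IH _ us f0'); congr (_ + _); apply: eq_big_seq => i si.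
by case: eqP => // ij; move: js; rewrite -ij si.
Qed.

End ComplexSums.

(** * The Hilbert space of square-summable families *)

Section SquareAbs.
Context (R : realType).
Implicit Types z w : R[i].

Definition sqabs z : R := complex.Re z ^+ 2 + complex.Im z ^+ 2.

Lemma sqabs_ge0 z : 0 <= sqabs z.
Proof. by rewrite addr_ge0 ?sqr_ge0. Qed.

Lemma sqabsM z w : sqabs (z * w) = sqabs z * sqabs w.
Proof. by case: z w => a b [c d]; rewrite /sqabs /=; ring. Qed.

Lemma sqabsJ z : sqabs (conjc z) = sqabs z.
Proof. by case: z => a b; rewrite /sqabs /= sqrrN. Qed.

Lemma sqabs0 : sqabs 0 = 0.
Proof. by rewrite /sqabs /= expr0n /= addr0. Qed.

Lemma sqabs_eq0 z : sqabs z = 0 -> z = 0.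
Proof.
move=> /eqP; rewrite paddr_eq0 ?sqr_ge0 // !sqrf_eq0 => /andP[/eqP a /eqP b].
exact: complexP.
Qed.

Lemma sqabsD_le z w : sqabs (z + w) <= 2 * (sqabs z + sqabs w).
Proof.
case: z w => a b [c d]; rewrite /sqabs /= -subr_ge0.
rewrite (_ : _ - _ = (a - c) ^+ 2 + (b - d) ^+ 2); last by ring.
by rewrite addr_ge0 ?sqr_ge0.
Qed.

Lemma sqabs_conj z : z * conjc z = (sqabs z)%:C%C.
Proof. by case: z => a b; apply: complexP => /=; rewrite /sqabs /=; ring. Qed.

Lemma sqabs_real (a : R) : sqabs a%:C%C = a ^+ 2.
Proof. by rewrite /sqabs /= expr0n addr0. Qed.

End SquareAbs.

Section EllTwo.
Context (R : realType) (I : choiceType).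
Implicit Types v w : I -> R[i].

Lemma ell2E v : ell2 v <-> absummable (fun i => sqabs (v i)).
Proof.
rewrite /ell2 /= /sqnorm /absummable.
suff -> : (\esum_(i in setT) (`|sqabs (v i)|)%:E
   = \esum_(i in setT) (complex.Re (v i) ^+ 2 + complex.Im (v i) ^+ 2)%:E)%E by [].
by apply: eq_esum => i _; rewrite ger0_norm ?sqabs_ge0.
Qed.

Lemma ell2_0 : ell2 (0 : I -> R[i]).
Proof.
rewrite /ell2 /= /sqnorm esum1 ?ltry // => i _.
by rewrite /= expr0n /= addr0.
Qed.

Lemma ell2D v w : ell2 v -> ell2 w -> ell2 (v + w).
Proof.
move=> /ell2E sv /ell2E sw; apply/ell2E.
have := absummableZ 2 (absummableD sv sw).
apply: absummable_le => i.
rewrite ger0_norm ?sqabs_ge0 // ger0_norm; first exact: sqabsD_le.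
by rewrite mulr_ge0 // addr_ge0 ?sqabs_ge0.
Qed.

Lemma ell2Z a v : ell2 v -> ell2 (a *: v).
Proof.
move=> /ell2E sv; apply/ell2E.
have := absummableZ (sqabs a) sv.
apply: absummable_le => i.
by rewrite -sqabsM.
Qed.

(** From 2 |xy| <= x^2 + y^2 on real and imaginary parts. *)
Lemma csummable_inner v w : ell2 v -> ell2 w ->
  csummable (fun i => v i * conjc (w i)).
Proof.
move=> /ell2E sv /ell2E sw.
have s := absummableD sv sw.
have H (a b c d : R) : `|a * c + b * d| <= a ^+ 2 + b ^+ 2 + (c ^+ 2 + d ^+ 2).
  rewrite ler_norml.
  have := sqr_ge0 (a - c); have := sqr_ge0 (a + c).
  have := sqr_ge0 (b - d); have := sqr_ge0 (b + d); nra.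
split; apply: absummable_le s => i; rewrite ?Re_mulc ?Im_mulc;
  (rewrite [leRHS]ger0_norm; last by apply: addr_ge0; exact: sqabs_ge0);
  rewrite /sqabs; case: (v i) (w i) => a b [c d] /=.
  by rewrite mulrN opprK.
by rewrite [c ^+ 2 + _]addrC -(sqrrN d).
Qed.

Definition l2pred : {pred I -> R[i]} := [pred v | `[< ell2 v >]].

Fact l2pred_submod : submod_closed l2pred.
Proof.
split; first by apply/asboolP; exact: ell2_0.
move=> a v w /asboolP sv /asboolP sw; apply/asboolP.
by apply: ell2D => //; exact: ell2Z.
Qed.

HB.instance Definition _ := GRing.isSubmodClosed.Build _ _ l2pred l2pred_submod.

(** Square-summable families, bundled so that they inherit the module structure
    of functions. *)
Record l2 := L2 { l2fun :> I -> R[i]; _ : l2fun \in l2pred }.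
HB.instance Definition _ := [isSub for l2fun].
HB.instance Definition _ := [Choice of l2 by <:].
HB.instance Definition _ := [SubChoice_isSubLmodule of l2 by <:].

End EllTwo.
Arguments l2 : clear implicits.

Section InnerProduct.
Context (R : realType) (I : choiceType).
Implicit Types (v w u : l2 R I) (a : R[i]).

Lemma l2P v w : (forall i, v i = w i) -> v = w.
Proof. by move=> vw; apply: val_inj; apply/funext. Qed.

Lemma l2_ell2 v : ell2 v.
Proof. by case: v => f /= /asboolP. Qed.

Lemma l2_addE v w i : (v + w) i = v i + w i. Proof. by []. Qed.
Lemma l2_scaleE a v i : (a *: v) i = a * v i. Proof. by []. Qed.
Lemma l2_oppE v i : (- v) i = - v i. Proof. by []. Qed.

Lemma l2_sumE (T : Type) (s : seq T) (P : pred T) (F : T -> l2 R I) i :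
  (\sum_(k <- s | P k) F k) i = \sum_(k <- s | P k) F k i.
Proof. by elim/big_rec2: _ => // k y1 y2 _ <-. Qed.

Definition ip v w : R[i] := inner v w.
Definition nsq v : R := fine (sqnorm v).

Lemma sqnormE v : sqnorm v = (nsq v)%:E.
Proof.
rewrite /nsq fineK // ge0_fin_numE; first exact: l2_ell2.
by apply: esum_ge0 => i _; rewrite lee_fin addr_ge0 ?sqr_ge0.
Qed.

Lemma ipDl u v w : ip (u + v) w = ip u w + ip v w.
Proof.
rewrite /ip /inner -csumD; try by apply: csummable_inner; exact: l2_ell2.
by congr csum; apply/funext => i; rewrite l2_addE mulrDl.
Qed.

Lemma ipZl a v w : ip (a *: v) w = a * ip v w.
Proof.
rewrite /ip /inner -csumZ; last by apply: csummable_inner; exact: l2_ell2.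
by congr csum; apply/funext => i; rewrite l2_scaleE mulrA.
Qed.

Lemma ipC v w : ip w v = conjc (ip v w).
Proof.
rewrite /ip /inner -csumJ; congr csum; apply/funext => i.
by rewrite rmorphM /= conjcK mulrC.
Qed.

Lemma ipDr u v w : ip u (v + w) = ip u v + ip u w.
Proof. by rewrite ipC ipDl raddfD (ipC v u) (ipC w u). Qed.

Lemma ipZr a v w : ip v (a *: w) = conjc a * ip v w.
Proof. by rewrite ipC ipZl rmorphM (ipC w v). Qed.

Lemma ip0l v : ip 0 v = 0. Proof. by rewrite -(scale0r 0) ipZl mul0r. Qed.
Lemma ip0r v : ip v 0 = 0. Proof. by rewrite ipC ip0l conjc0. Qed.
Lemma ipNl v w : ip (- v) w = - ip v w.
Proof. by rewrite -scaleN1r ipZl mulN1r. Qed.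
Lemma ipNr v w : ip v (- w) = - ip v w.
Proof. by rewrite ipC ipNl raddfN (ipC w v). Qed.
Lemma ipBl u v w : ip (u - v) w = ip u w - ip v w.
Proof. by rewrite ipDl ipNl. Qed.

Lemma ip_suml (T : Type) (s : seq T) (P : pred T) (F : T -> l2 R I) v :
  ip (\sum_(k <- s | P k) F k) v = \sum_(k <- s | P k) ip (F k) v.
Proof.
elim/big_rec2: _ => [|k y1 y2 _ <-]; first exact: ip0l.
by rewrite ipDl.
Qed.

Lemma ip_sumr (T : Type) (s : seq T) (P : pred T) (F : T -> l2 R I) v :
  ip v (\sum_(k <- s | P k) F k) = \sum_(k <- s | P k) ip v (F k).
Proof.
elim/big_rec2: _ => [|k y1 y2 _ <-]; first exact: ip0r.
by rewrite ipDr.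
Qed.

Lemma ipvv v : ip v v = (nsq v)%:C%C.
Proof.
have /ell2E sv := l2_ell2 v.
apply: complexP => /=; last first.
  rewrite (_ : (fun i => _) = fun=> 0) ?rsum0 //; apply/funext => i.
  by rewrite sqabs_conj.
rewrite (_ : (fun i => _) = fun i => sqabs (v i)); last first.
  by apply/funext => i; rewrite sqabs_conj.
by rewrite rsum_ge0E // => i; exact: sqabs_ge0.
Qed.

Lemma nsq_ge0 v : 0 <= nsq v.
Proof.
by apply: fine_ge0; apply: esum_ge0 => i _; rewrite lee_fin addr_ge0 ?sqr_ge0.
Qed.

Lemma sqabs_le_nsq v i : sqabs (v i) <= nsq v.
Proof.
rewrite -lee_fin -sqnormE /sqnorm.
apply: ereal_sup_ubound; exists [set i]; first by split.
by rewrite fsbig_set1.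
Qed.

Lemma nsq0 : nsq 0 = 0.
Proof. by apply: complexI; rewrite -ipvv ip0l. Qed.

Lemma nsq_eq0 v : nsq v = 0 -> v = 0.
Proof.
move=> v0; apply: l2P => i; apply: sqabs_eq0; apply/eqP.
by rewrite eq_le sqabs_ge0 -v0 sqabs_le_nsq.
Qed.

Lemma nsqZ a v : nsq (a *: v) = sqabs a * nsq v.
Proof.
apply: complexI; rewrite -ipvv ipZl ipZr ipvv mulrA sqabs_conj.
by rewrite -rmorphM.
Qed.

Lemma nsqN v : nsq (- v) = nsq v.
Proof. by apply: complexI; rewrite -!ipvv ipNl ipNr opprK. Qed.

Lemma nsqD v w : nsq (v + w) = nsq v + nsq w + 2 * complex.Re (ip v w).
Proof.
have := ipvv (v + w); rewrite ipDl !ipDr !ipvv (ipC v w).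
by move=> /(congr1 (@complex.Re R)) /= <-; case: (ip v w) => a b /=; ring.
Qed.

Lemma nsqB v w : nsq (v - w) = nsq v + nsq w - 2 * complex.Re (ip v w).
Proof. by rewrite nsqD nsqN ipNr raddfN mulrN. Qed.

Lemma nsqBC v w : nsq (v - w) = nsq (w - v).
Proof. by rewrite -opprB nsqN. Qed.

Lemma nsqD_orth v w : ip v w = 0 -> nsq (v + w) = nsq v + nsq w.
Proof. by move=> vw; rewrite nsqD vw mulr0 addr0. Qed.

Lemma nsqD_le v w : nsq (v + w) <= 2 * (nsq v + nsq w).
Proof.
have := nsq_ge0 (v - w); rewrite nsqB nsqD; lra.
Qed.

Lemma cauchy_schwarz v w : sqabs (ip v w) <= nsq v * nsq w.
Proof.
have [w0|wn0] := eqVneq (nsq w) 0.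
  by rewrite (nsq_eq0 w0) ip0r sqabs0 nsq0 mulr0.
have wp : 0 < nsq w by rewrite lt_neqAle eq_sym wn0 nsq_ge0.
have := nsq_ge0 ((nsq w)%:C%C *: v - ip v w *: w).
rewrite nsqB !nsqZ sqabs_real ipZl ipZr (mulrC (conjc _)) sqabs_conj.
rewrite -rmorphM /= => H.
have {H}: 0 <= nsq w * (nsq w * nsq v - sqabs (ip v w)) by nra.
by rewrite pmulr_rge0 // subr_ge0 mulrC.
Qed.

Definition nm v : R := Num.sqrt (nsq v).

Lemma nm_ge0 v : 0 <= nm v. Proof. exact: sqrtr_ge0. Qed.

Lemma nmK v : nm v ^+ 2 = nsq v. Proof. by rewrite sqr_sqrtr ?nsq_ge0. Qed.

Lemma nm0 : nm 0 = 0. Proof. by rewrite /nm nsq0 sqrtr0. Qed.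

Lemma nmBC v w : nm (v - w) = nm (w - v). Proof. by rewrite /nm nsqBC. Qed.

Lemma nmZ a v : nm (a *: v) = Num.sqrt (sqabs a) * nm v.
Proof. by rewrite /nm nsqZ sqrtrM ?sqabs_ge0. Qed.

Lemma nm_le v c : 0 <= c -> (nm v <= c) = (nsq v <= c ^+ 2).
Proof. by move=> c0; rewrite -nmK ler_pXn2r // nnegrE ?nm_ge0. Qed.

Lemma Re_le_sqabs a (c : R) : 0 <= c -> sqabs a <= c ^+ 2 -> `|complex.Re a| <= c.
Proof.
move=> c0 H; rewrite -(@ler_pXn2r _ 2) ?nnegrE // real_normK ?num_real //.
by apply: le_trans H; rewrite lerDl sqr_ge0.
Qed.

Lemma Re_ip_le v w : `|complex.Re (ip v w)| <= nm v * nm w.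
Proof.
apply: Re_le_sqabs; first by rewrite mulr_ge0 ?nm_ge0.
by rewrite exprMn !nmK cauchy_schwarz.
Qed.

Lemma nmD v w : nm (v + w) <= nm v + nm w.
Proof.
rewrite nm_le ?addr_ge0 ?nm_ge0 // nsqD -!nmK.
have := Re_ip_le v w; rewrite ler_norml => /andP[_ H].
rewrite sqrrD -addrA (addrC (nm w ^+ 2)) addrA lerD2r lerD2l.
by rewrite -[X in _ <= X]mulr_natl ler_wpM2l.
Qed.

End InnerProduct.

(** * Orthonormal systems and completeness *)

Section Basis.
Context (R : realType) (I : choiceType).
Implicit Types (v w u : l2 R I) (a : R[i]).

Definition deltaf (i : I) : I -> R[i] := fun j => if j == i then 1 else 0.

Fact deltaf_l2 i : deltaf i \in @l2pred R I.
Proof.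
apply/asboolP/ell2E; have := @absummable1 R I i 1.
by apply: absummable_le => j; rewrite /deltaf; case: ifP; rewrite ?sqabs0 //
  /sqabs /= expr1n expr0n addr0.
Qed.

Definition delta i : l2 R I := L2 (deltaf_l2 i).

Lemma deltaE i j : delta i j = if j == i then 1 else 0. Proof. by []. Qed.

Lemma ip_delta v i : ip v (delta i) = v i.
Proof.
rewrite /ip /inner -[RHS](csum1 i); congr csum; apply/funext => j.
by rewrite deltaE; case: eqP => [->|_]; rewrite ?conjc1 ?mulr1 ?conjc0 ?mulr0.
Qed.

(** Zero vectors are allowed: the singular vectors of an operator of finite rank
    are then still indexed by all natural numbers. *)
Definition osys (T : eqType) (J : choiceType) (e : T -> l2 R J) :=
  (forall i j, i != j -> ip (e i) (e j) = 0) /\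
  (forall i, nsq (e i) = 1 \/ e i = 0).

Lemma osys_delta : osys delta.
Proof.
split=> [i j ij|i]; first by rewrite ip_delta deltaE eq_sym (negPf ij).
by left; apply: complexI; rewrite -ipvv ip_delta deltaE eqxx.
Qed.

Section Bessel.
Variables (T : eqType) (e : T -> l2 R I).
Hypothesis oe : osys e.

Lemma ip_osys_self v i : sqabs (ip v (e i)) * nsq (e i) = sqabs (ip v (e i)).
Proof. by case: (oe.2 i) => ->; rewrite ?mulr1 // ip0r sqabs0 mul0r. Qed.

Lemma ip_psum (c : T -> R[i]) s k : k \notin s ->
  ip (\sum_(j <- s) c j *: e j) (e k) = 0.
Proof.
move=> ks; rewrite ip_suml big_seq big1 // => j js.
by rewrite ipZl oe.1 ?mulr0 //; apply: contraNneq ks => <-.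
Qed.

Lemma ip_psum_in (c : T -> R[i]) s k : uniq s -> k \in s ->
  ip (\sum_(j <- s) c j *: e j) (e k) = c k * (nsq (e k))%:C%C.
Proof.
move=> us ks; rewrite ip_suml (bigD1_seq k) //= ipZl ipvv big1 ?addr0 // => j jk.
by rewrite ipZl oe.1 ?mulr0.
Qed.

Lemma nsq_psum (c : T -> R[i]) s : uniq s ->
  nsq (\sum_(k <- s) c k *: e k) = \sum_(k <- s) sqabs (c k) * nsq (e k).
Proof.
elim: s => [|k s IH] /=; first by rewrite !big_nil nsq0.
move=> /andP[ks us]; rewrite !big_cons addrC nsqD_orth ?IH ?nsqZ 1?addrC //.
by rewrite ipZr ip_psum ?mulr0.
Qed.

Lemma bessel_eq v s : uniq s ->
  nsq (v - \sum_(k <- s) ip v (e k) *: e k)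
  = nsq v - \sum_(k <- s) sqabs (ip v (e k)).
Proof.
elim: s => [|k s IH] /=; first by rewrite !big_nil !subr0.
move=> /andP[ks us]; rewrite !big_cons opprD addrCA addrC nsqB IH // nsqZ.
rewrite ip_osys_self ipZr ipBl ip_psum // subr0 (mulrC (conjc _)) sqabs_conj /=.
ring.
Qed.

Lemma bessel v s : uniq s -> \sum_(k <- s) sqabs (ip v (e k)) <= nsq v.
Proof. by move=> us; rewrite -subr_ge0 -bessel_eq // nsq_ge0. Qed.

End Bessel.

Definition trunc (s : seq I) v := \sum_(i <- s) v i *: delta i.

Lemma nsq_trunc s v : uniq s -> nsq (v - trunc s v)
  = nsq v - \sum_(i <- s) sqabs (v i).
Proof.
move=> us; rewrite /trunc.
under eq_bigr do rewrite -ip_delta.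
rewrite (bessel_eq osys_delta) //; congr (_ - _).
by apply: eq_bigr => i _; rewrite ip_delta.
Qed.

(** Sums of nonnegative families are suprema over finite sets. Enumerating
    these by duplicate-free sequences gives access to the theory of iterated sums. *)
Lemma esum_seq_le (f : I -> R) (M : \bar R) : (forall i, 0 <= f i) ->
  (forall s : seq I, uniq s -> ((\sum_(i <- s) f i)%:E <= M)%E) ->
  (\esum_(i in [set: I]) (f i)%:E <= M)%E.
Proof.
move=> f0 H; apply: ge_ereal_sup => _ [F [finF _] <-].
rewrite fsbig_finite //= sumEFin; apply: H; exact: finmap.fset_uniq.
Qed.

Lemma esum_seq_ge (f : I -> R) (s : seq I) : uniq s -> (forall i, 0 <= f i) ->
  ((\sum_(i <- s) f i)%:E <= \esum_(i in [set: I]) (f i)%:E)%E.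
Proof.
move=> us f0.
have -> : ((\sum_(i <- s) f i)%:E = \esum_(i in [set` s]) (f i)%:E)%E.
  rewrite esum_fset; [|exact: finite_seq|by move=> i _; rewrite lee_fin].
  by rewrite -fsbig_seq // sumEFin.
by apply: ge_ereal_sup => _ [F [finF Fs] <-]; apply: ereal_sup_ubound; exists F.
Qed.

Lemma l2_approx v (eps : R) : 0 < eps ->
  exists s : seq I, uniq s /\ nsq (v - trunc s v) < eps.
Proof.
move=> e0; apply: contrapT => H.
suff : ((nsq v)%:E <= (nsq v - eps)%:E)%E by rewrite lee_fin; lra.
rewrite -{1}sqnormE; apply: esum_seq_le => [i|s us].
  exact: sqabs_ge0.
rewrite lee_fin leNgt; apply/negP => Hs; apply: H; exists s; split => //.
by rewrite nsq_trunc // -/(sqabs _); rewrite /sqabs; lra.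
Qed.

Definition l2lim (u : nat -> l2 R I) w :=
  forall eps : R, 0 < eps -> exists N, forall n, (N <= n)%N -> nsq (u n - w) <= eps.

(** The limit is taken coordinatewise. Fatou's lemma on finite subsums shows that
    it is square summable and that it is a limit in norm. *)
Lemma l2_complete (u : nat -> l2 R I) :
  (forall eps : R, 0 < eps -> exists N, forall m n, (N <= m)%N -> (N <= n)%N ->
    nsq (u m - u n) <= eps) ->
  exists w, l2lim u w.
Proof.
move=> cu.
have cauchyR (x : nat -> R) : (forall eps : R, 0 < eps -> exists N, forall m n,
    (N <= m)%N -> (N <= n)%N -> `|x m - x n| <= eps) -> cvg (x @ \oo).
  move=> H; apply: cauchy_cvg; apply: cauchy_exP => eps e0.
  have [N HN] := H (eps / 2) (divr_gt0 e0 (ltr0n _ 2)).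
  exists (x N); exists N => // n /= Nn.
  by apply: le_lt_trans (HN N n (leqnn _) Nn) _; lra.
have cc i (eps : R) : 0 < eps -> exists N, forall m n, (N <= m)%N -> (N <= n)%N ->
    sqabs (u m i - u n i) <= eps ^+ 2.
  move=> e0; have [N HN] := cu (eps ^+ 2) (exprn_gt0 _ e0).
  by exists N => m n Nm Nn; apply: le_trans (HN m n Nm Nn);
    rewrite -l2_oppE -l2_addE; exact: sqabs_le_nsq.
have cre i : cvg ((fun n => complex.Re (u n i)) @ \oo).
  apply: cauchyR => eps e0; have [N HN] := cc i eps e0; exists N => m n Nm Nn.
  by rewrite -raddfB; apply: Re_le_sqabs; rewrite ?HN // ltW.
have cim i : cvg ((fun n => complex.Im (u n i)) @ \oo).
  apply: cauchyR => eps e0; have [N HN] := cc i eps e0; exists N => m n Nm Nn.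
  rewrite -raddfB -(@ler_pXn2r _ 2) ?nnegrE ?(ltW e0) // real_normK ?num_real //.
  by apply: le_trans (HN m n Nm Nn); rewrite lerDr sqr_ge0.
pose w i : R[i] := Complex (lim ((fun n => complex.Re (u n i)) @ \oo))
                           (lim ((fun n => complex.Im (u n i)) @ \oo)).
have fatou n (eps : R) N : (forall m, (N <= m)%N -> nsq (u m - u n) <= eps) ->
    (sqnorm (fun i => (w i - u n i)%R) <= eps%:E)%E.
  move=> H; apply: esum_seq_le => [i|s us]; first exact: sqabs_ge0.
  rewrite lee_fin.
  have C : (fun m => \sum_(i <- s) sqabs (u m i - u n i)) @ \oo -->
      \sum_(i <- s) sqabs (w i - u n i).
    apply: cvg_big => [|i _]; first by move=> x; exact: add_continuous.
    rewrite /sqabs !raddfB /=.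
    under eq_cvg do rewrite !raddfB /=.
    apply: cvgD; rewrite expr2; under eq_cvg do rewrite expr2.
      by apply: cvgM; apply: cvgB; (exact: cre || exact: cvg_cst).
    by apply: cvgM; apply: cvgB; (exact: cim || exact: cvg_cst).
  rewrite -(cvg_lim _ C) //; apply: limr_le; first by apply/cvg_ex; eexists; exact: C.
  exists N => // m /= Nm.
  apply: le_trans (H m Nm); rewrite -lee_fin -sqnormE.
  apply: esum_seq_ge => // i; exact: sqabs_ge0.
have [N1 HN1] := cu 1 ltr01.
have w2 : w \in @l2pred R I.
  have w2' : ell2 (fun i => w i - u N1 i).
    rewrite /ell2 /=; apply: le_lt_trans (fatou N1 1 N1 _) (ltry _) => m Nm.
    exact: HN1.
  apply/asboolP; have := ell2D w2' (l2_ell2 (u N1)).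
  rewrite (_ : _ + _ = w) //; apply/funext => i.
  by rewrite -[LHS]/(w i - u N1 i + u N1 i) subrK.
exists (L2 w2) => eps e0; have [N HN] := cu eps e0; exists N => n Nn.
rewrite -lee_fin nsqBC -sqnormE.
by apply: (fatou n eps N) => m Nm; exact: HN.
Qed.

Lemma l2lim_unique (u : nat -> l2 R I) v w : l2lim u v -> l2lim u w -> v = w.
Proof.
move=> uv uw; apply/eqP; rewrite -subr_eq0; apply/eqP/nsq_eq0/eqP.
rewrite eq_le nsq_ge0 andbT; apply/ler_addgt0Pr => eps e0; rewrite add0r.
have e4 : 0 < eps / 4 by rewrite divr_gt0.
have [N HN] := uv _ e4; have [M HM] := uw _ e4.
have := HN (maxn N M) (leq_maxl _ _); have := HM (maxn N M) (leq_maxr _ _).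
have := nsqD_le (v - u (maxn N M)) (u (maxn N M) - w).
by rewrite addrA subrK (nsqBC v); lra.
Qed.

(** The squared norm of a block of the series is the difference of two terms of a
    bounded nondecreasing sequence. *)
Lemma riesz_fischer (e : nat -> l2 R I) (c : nat -> R[i]) (M : R) : osys e ->
  (forall n, \sum_(0 <= k < n) sqabs (c k) * nsq (e k) <= M) ->
  exists w, l2lim (fun n => \sum_(0 <= k < n) c k *: e k) w.
Proof.
move=> oe HM; apply: l2_complete => eps e0.
pose x n := \sum_(0 <= k < n) sqabs (c k) * nsq (e k).
have ndx : {homo x : m n / (m <= n)%N >-> m <= n}.
  move=> m n mn; rewrite /x (big_cat_nat _ mn) //= lerDl sumr_ge0 // => i _.
  by rewrite mulr_ge0 ?sqabs_ge0 ?nsq_ge0.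
have cx : cvg (x @ \oo).
  by apply: nondecreasing_is_cvgn => //; exists M => _ [n _ <-]; exact: HM.
have /cvgrPdist_le /(_ (eps / 2)) := cx.
rewrite divr_gt0 // => /(_ isT) [N _ HN]; exists N => m n.
wlog mn : m n / (n <= m)%N.
  move=> H Nm Nn; have [nm|/ltnW mn] := leqP n m; first exact: H.
  by rewrite nsqBC; exact: H.
move=> Nm Nn; rewrite (big_cat_nat _ mn) //= addrAC subrr add0r.
rewrite (nsq_psum oe) ?iota_uniq //.
have -> : \sum_(n <= k < m) sqabs (c k) * nsq (e k) = x m - x n.
  have -> : x m = x n + \sum_(n <= k < m) sqabs (c k) * nsq (e k).
    by rewrite /x -big_cat_nat.
  by rewrite addrAC subrr add0r.
have := HN m Nm; have := HN n Nn; rewrite !ler_norml /= => /andP[h1 h2] /andP[h3 h4].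
lra.
Qed.

End Basis.
Arguments delta {R I}.

(** * Bounded operators and their adjoints *)

Section Operators.
Context (R : realType).
Implicit Types (I J K : choiceType).

Definition bop I J (L : l2 R I -> l2 R J) :=
  linear L /\ exists C : R, 0 <= C /\ forall v, nsq (L v) <= C * nsq v.

Section BopTheory.
Context (I J : choiceType) (L : l2 R I -> l2 R J).
Hypothesis bL : bop L.

Lemma bopD v w : L (v + w) = L v + L w.
Proof. by have := bL.1 1 v w; rewrite !scale1r. Qed.

Lemma bop0 : L 0 = 0.
Proof. by apply: (addIr (L 0)); rewrite -bopD !add0r. Qed.

Lemma bopZ a v : L (a *: v) = a *: L v.
Proof. by have := bL.1 a v 0; rewrite bop0 !addr0. Qed.

Lemma bopN v : L (- v) = - L v.
Proof. by rewrite -scaleN1r bopZ scaleN1r. Qed.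

Lemma bopB v w : L (v - w) = L v - L w.
Proof. by rewrite bopD bopN. Qed.

Lemma bop_sum (T : Type) (s : seq T) (P : pred T) (F : T -> l2 R I) :
  L (\sum_(k <- s | P k) F k) = \sum_(k <- s | P k) L (F k).
Proof.
elim/big_rec2: _ => [|k y1 y2 _ <-]; first exact: bop0.
by rewrite bopD.
Qed.

Lemma bop_lim u w : l2lim u w -> l2lim (L \o u) (L w).
Proof.
move=> uw eps e0; have [C [C0 HC]] := bL.2.
have [N HN] := uw (eps / (C + 1)) (divr_gt0 e0 (ltr_wpDl C0 ltr01)).
exists N => n Nn; rewrite /= -bopB; apply: le_trans (HC _) _.
apply: (@le_trans _ _ ((C + 1) * nsq (u n - w))).
  by rewrite ler_wpM2r ?nsq_ge0 // lerDl.
by rewrite mulrC -ler_pdivlMr ?ltr_wpDl // HN.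
Qed.

End BopTheory.

Lemma bop_comp I J K (L : l2 R I -> l2 R J) (M : l2 R J -> l2 R K) :
  bop L -> bop M -> bop (M \o L).
Proof.
move=> bL bM; split; first by move=> a v w; rewrite /= bL.1 bM.1.
have [C [C0 HC]] := bL.2; have [D [D0 HD]] := bM.2.
exists (D * C); split; first exact: mulr_ge0.
by move=> v; apply: le_trans (HD _) _; rewrite -mulrA ler_wpM2l.
Qed.

Lemma bop_lincomb I J a (L M : l2 R I -> l2 R J) :
  bop L -> bop M -> bop (fun v => a *: L v + M v).
Proof.
move=> bL bM; split.
  move=> b v w; rewrite bL.1 bM.1 !scalerDr !scalerA mulrC.
  by rewrite -!addrA; congr (_ + _); rewrite addrCA.
have [C [C0 HC]] := bL.2; have [D [D0 HD]] := bM.2.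
exists (2 * (sqabs a * C + D)); split.
  by rewrite mulr_ge0 // addr_ge0 ?mulr_ge0 ?sqabs_ge0.
move=> v; apply: le_trans (nsqD_le _ _) _; rewrite nsqZ -mulrA.
apply: ler_wpM2l => //; rewrite [leRHS]mulrDl; apply: lerD => //.
by rewrite -mulrA ler_wpM2l ?sqabs_ge0.
Qed.

(** The canonical basis spans a dense subspace. *)
Lemma linear_fun0 I (f : l2 R I -> R[i]) C : 0 <= C -> scalar f ->
  (forall v, sqabs (f v) <= C * nsq v) -> (forall i, f (delta i) = 0) ->
  forall v, f v = 0.
Proof.
move=> C0 lf bf f0 v; apply: sqabs_eq0; apply/eqP.
have f00 : f 0 = 0.
  by have := lf 1 0 0; rewrite scaler0 addr0 mul1r => /eqP; rewrite -subr_eq subrr => /eqP.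
have fD a w : f (a + w) = f a + f w by have := lf 1 a w; rewrite scale1r mul1r.
have fZ a w : f (a *: w) = a * f w by have := lf a w 0; rewrite f00 !addr0.
have ft s : f (trunc s v) = 0.
  rewrite /trunc; elim: s => [|i s IH]; first by rewrite big_nil.
  by rewrite big_cons fD IH fZ f0 mulr0 addr0.
rewrite eq_le sqabs_ge0 andbT; apply/ler_addgt0Pr => eps e0; rewrite add0r.
have [s [_ Hs]] := l2_approx v (divr_gt0 e0 (ltr_wpDl C0 ltr01)).
have -> : f v = f (v - trunc s v) by rewrite fD -scaleN1r fZ ft mulr0 addr0.
apply: le_trans (bf _) _.
apply: (@le_trans _ _ ((C + 1) * nsq (v - trunc s v))).
  by rewrite ler_wpM2r ?nsq_ge0 // lerDl.
by rewrite mulrC -ler_pdivlMr ?ltr_wpDl // ltW.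
Qed.

(** The coordinates of the adjoint in the canonical basis; they are square
    summable when L is bounded (adjopE). *)
Definition adjop I J (L : l2 R I -> l2 R J) (w : l2 R J) : l2 R I :=
  insubd 0 (fun i => ip w (L (delta i))).

Section Adjoint.
Context (I J : choiceType) (L : l2 R I -> l2 R J).
Hypothesis bL : bop L.

Let adj_bound C w s : 0 <= C -> (forall v, nsq (L v) <= C * nsq v) -> uniq s ->
  \sum_(i <- s) sqabs (ip w (L (delta i))) <= C * nsq w.
Proof.
move=> C0 HC us; set S := \sum_(i <- s) _.
have S0 : 0 <= S by apply: sumr_ge0 => i _; exact: sqabs_ge0.
pose v := \sum_(i <- s) ip w (L (delta i)) *: delta i : l2 R I.
have nv : nsq v = S.
  rewrite /v (nsq_psum (@osys_delta R I)) //; apply: eq_bigr => i _.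
  by case: ((@osys_delta R I).2 i) => -> //; rewrite ?mulr1 // bop0 // ip0r sqabs0 mul0r.
have wv : ip w (L v) = S%:C%C.
  rewrite /v bop_sum // ip_sumr /S rmorph_sum /=; apply: eq_bigr => i _.
  by rewrite bopZ // ipZr mulrC sqabs_conj.
have := cauchy_schwarz w (L v); rewrite wv sqabs_real => H.
have [->|Sn0] := eqVneq S 0; first by rewrite mulr_ge0 ?nsq_ge0.
have Sp : 0 < S by rewrite lt_neqAle eq_sym Sn0.
rewrite -(ler_pM2r Sp) -expr2; apply: le_trans H _.
by rewrite (mulrC C) -mulrA ler_wpM2l ?nsq_ge0 // -nv.
Qed.

Lemma adjopE w i : adjop L w i = ip w (L (delta i)).
Proof.
rewrite /adjop -[LHS]/((val (insubd 0 _)) i) insubdK //.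
apply/asboolP; have [C [C0 HC]] := bL.2.
rewrite /ell2 /=; apply: le_lt_trans (ltry (C * nsq w)).
by apply: esum_seq_le => [j|s us]; [exact: sqabs_ge0|rewrite lee_fin; exact: adj_bound].
Qed.

Lemma bop_adj : bop (adjop L).
Proof.
split; first by move=> a v w; apply: l2P => i; rewrite l2_addE l2_scaleE !adjopE ipDl ipZl.
have [C [C0 HC]] := bL.2; exists C; split=> // w.
rewrite -lee_fin -sqnormE; apply: esum_seq_le => [j|s us]; first exact: sqabs_ge0.
rewrite lee_fin.
rewrite (_ : \sum_(i <- s) _ = \sum_(i <- s) sqabs (ip w (L (delta i)))); first exact: adj_bound.
by apply: eq_bigr => i _; rewrite -/(sqabs _) adjopE.
Qed.

Lemma adjP v w : ip (L v) w = ip v (adjop L w).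
Proof.
apply/eqP; rewrite -subr_eq0; apply/eqP.
have [C [C0 HC]] := bL.2.
apply: (@linear_fun0 I (fun v => ip (L v) w - ip v (adjop L w))
  (2 * (C * nsq w + nsq (adjop L w)))).
- by rewrite mulr_ge0 // addr_ge0 ?mulr_ge0 ?nsq_ge0.
- by move=> a v1 w1; rewrite bL.1 !ipDl !ipZl; ring.
- move=> u; apply: le_trans (sqabsD_le _ _) _; rewrite -mulrA ler_wpM2l // mulrDl.
  apply: lerD.
    apply: le_trans (cauchy_schwarz _ _) _; rewrite mulrAC ler_wpM2r ?nsq_ge0 //.
  by rewrite -ipNl mulrC; apply: le_trans (cauchy_schwarz _ _) _; rewrite nsqN.
- move=> i; rewrite [ip (delta i) _]ipC ip_delta adjopE -ipC subrr //.
Qed.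

Lemma adjP' v w : ip w (L v) = ip (adjop L w) v.
Proof. by rewrite ipC adjP -ipC. Qed.

End Adjoint.

(** * Matrices of bounded operators *)

Definition mxof I (L : l2 R I -> l2 R I) : opmx R I := fun i j => L (delta j) i.

(** The link between matrices and operators: it is compatible with adjoints and
    products, and bounded matrices are those that represent an operator. *)
Definition represents I (x : opmx R I) (L : l2 R I -> l2 R I) :=
  bop L /\ forall v : l2 R I, app x v = L v.

Lemma app_delta I (x : opmx R I) j i : app x (delta j) i = x i j.
Proof.
rewrite /app -[RHS](csum1 j); congr csum; apply/funext => k.
by rewrite deltaE; case: eqP => [->|_]; rewrite ?mulr1 ?mulr0.
Qed.

Lemma represents_mxof I (L : l2 R I -> l2 R I) : bop L -> represents (mxof L) L.
Proof.
move=> bL; split=> // v; apply/funext => i.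
rewrite -ip_delta adjP // /app /ip /inner; congr csum; apply/funext => j.
by rewrite adjopE // -ipC ip_delta mulrC.
Qed.

Lemma represents_eq I (x : opmx R I) L : represents x L -> x = mxof L.
Proof.
by move=> [_ xL]; apply/funext => i; apply/funext => j; rewrite /mxof -xL app_delta.
Qed.

Lemma represents_inj I (x y : opmx R I) L : represents x L -> represents y L -> x = y.
Proof. by move=> /represents_eq -> /represents_eq ->. Qed.

Lemma represents_uniq I (x : opmx R I) L M : represents x L -> represents x M -> L = M.
Proof.
move=> [_ xL] [_ xM]; apply/funext => v; apply: l2P => i.
by rewrite -xL -xM.
Qed.

Lemma ell2_l2 I (v : I -> R[i]) : ell2 v -> exists w : l2 R I, l2fun w = v.
Proof.
move=> ev; have P : v \in @l2pred R I by apply/asboolP.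
by exists (L2 P).
Qed.

Lemma represents_bounded I (x : opmx R I) L : represents x L -> bounded_op x.
Proof.
move=> [bL xL]; have [C [C0 HC]] := bL.2; exists C => v /ell2_l2[w <-].
by rewrite xL !sqnormE -EFinM lee_fin.
Qed.

Lemma sqabs_le_sqnorm I (f : I -> R[i]) i : ((sqabs (f i))%:E <= sqnorm f)%E.
Proof.
apply: ereal_sup_ubound; exists [set i]; first by split.
by rewrite fsbig_set1.
Qed.

(** The rows of a bounded matrix are square summable, as one sees by applying the
    matrix to truncations of conjugate rows. It acts by inner products with them. *)
Lemma bounded_represents I (x : opmx R I) : bounded_op x ->
  exists L, represents x L.
Proof.
move=> [C0 HC0]; pose C := `|C0|.
have Cge : 0 <= C by exact: normr_ge0.
have HC v : ell2 v -> (sqnorm (app x v) <= C%:E * sqnorm v)%E.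
  move=> ev; apply: le_trans (HC0 _ ev) _; apply: lee_wpmul2r.
    by apply: esum_ge0 => i _; rewrite lee_fin sqabs_ge0.
  by rewrite lee_fin ler_norm.
have row_l2 i : (fun j => conjc (x i j)) \in @l2pred R I.
  apply/asboolP; rewrite /ell2 /=; apply: le_lt_trans (ltry C).
  apply: esum_seq_le => [j|s us]; first exact: sqabs_ge0.
  rewrite lee_fin; set S := \sum_(j <- s) _.
  have S0 : 0 <= S by apply: sumr_ge0 => j _; exact: sqabs_ge0.
  pose v := \sum_(j <- s) conjc (x i j) *: delta j : l2 R I.
  have vE k : v k = if k \in s then conjc (x i k) else 0.
    rewrite /v l2_sumE; case: ifP => ks.
      rewrite (bigD1_seq k) // big1 => [|j jk].
        by rewrite l2_scaleE deltaE eqxx mulr1 /= addr0.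
      by rewrite l2_scaleE deltaE eq_sym (negPf jk) mulr0.
    rewrite big_seq big1 // => j js; rewrite l2_scaleE deltaE; case: eqP => [kj|]; rewrite ?mulr0 //.
    by rewrite kj js in ks.
  have nv : nsq v = S.
    rewrite /v (nsq_psum (@osys_delta R I)) //; apply: eq_bigr => j _.
    rewrite (_ : nsq (delta j) = 1) ?mulr1 //.
    by apply: complexI; rewrite -ipvv ip_delta deltaE eqxx.
  have xv : app x v i = S%:C%C.
    rewrite /app (@csum_seq _ _ s) //; last first.
      by move=> k; rewrite inE /= => /negPf ks; rewrite vE ks mulr0.
    rewrite /S rmorph_sum; apply: eq_big_seq => j js.
    by rewrite vE js sqabs_conj -(sqabsJ (x i j)).
  have := le_trans (sqabs_le_sqnorm (app x v) i) (HC _ (l2_ell2 v)).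
  rewrite xv sqabs_real sqnormE -EFinM lee_fin nv => H.
  have [->//|Sn0] := eqVneq S 0.
  have Sp : 0 < S by rewrite lt_neqAle eq_sym Sn0.
  by rewrite -(ler_pM2r Sp) -expr2.
pose row i : l2 R I := L2 (row_l2 i).
have appE (v : l2 R I) i : app x v i = ip v (row i).
  rewrite /app /ip /inner; congr csum; apply/funext => j.
  by rewrite /= conjcK mulrC.
have app_l2 (v : l2 R I) : app x v \in @l2pred R I.
  apply/asboolP; rewrite /ell2 /=; apply: le_lt_trans (HC _ (l2_ell2 v)) _.
  by rewrite sqnormE -EFinM ltry.
exists (fun v => L2 (app_l2 v)); split=> //; split.
  have E u i : L2 (app_l2 u) i = ip u (row i) by exact: appE.
  by move=> a v w; apply: l2P => i; rewrite l2_addE l2_scaleE !E ipDl ipZl.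
exists C; split=> // v; rewrite -lee_fin -sqnormE; apply: le_trans (HC _ (l2_ell2 v)) _.
by rewrite sqnormE -EFinM.
Qed.

Lemma represents_adj I (x : opmx R I) L : represents x L ->
  represents (Defs.adj x) (adjop L).
Proof.
move=> rx; rewrite (_ : Defs.adj x = mxof (adjop L)).
  by apply: represents_mxof; apply: bop_adj; case: rx.
apply/funext => i; apply/funext => j; rewrite /Defs.adj /mxof adjopE; last by case: rx.
by rewrite (represents_eq rx) ipC ip_delta.
Qed.

Lemma represents_mul I (x y : opmx R I) L M : represents x L -> represents y M ->
  represents (opmul x y) (L \o M).
Proof.
move=> rx ry.
rewrite (_ : opmul x y = mxof (L \o M)).
  by apply: represents_mxof; apply: bop_comp; [case: ry|case: rx].
apply/funext => i; apply/funext => j; rewrite /opmul /mxof /= -rx.2 /app.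
by congr csum; apply/funext => k; rewrite -ry.2 app_delta.
Qed.

End Operators.

(** * Compact operators and their Schmidt decomposition *)

Section Limits.
Context (R : realType) (I J : choiceType).

Lemma l2lim_ip (u : nat -> l2 R I) w v : l2lim u w -> (forall n, ip (u n) v = 0) ->
  ip w v = 0.
Proof.
move=> uw u0; apply: sqabs_eq0; apply/eqP; rewrite eq_le sqabs_ge0 andbT.
apply/ler_addgt0Pr => eps e0; rewrite add0r.
have [N HN] := uw (eps / (nsq v + 1)) (divr_gt0 e0 (ltr_wpDl (nsq_ge0 v) ltr01)).
have -> : ip w v = - ip (u N - w) v by rewrite ipBl u0 sub0r opprK.
rewrite -ipNl; apply: le_trans (cauchy_schwarz _ _) _; rewrite nsqN.
apply: (@le_trans _ _ (eps / (nsq v + 1) * (nsq v + 1))).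
  by apply: ler_pM; rewrite ?nsq_ge0 //; [exact: HN|rewrite lerDl].
by rewrite divfK // gt_eqF // ltr_wpDl ?nsq_ge0.
Qed.

Lemma l2limD (u u' : nat -> l2 R I) w w' : l2lim u w -> l2lim u' w' ->
  l2lim (fun n => u n + u' n) (w + w').
Proof.
move=> uw uw' eps e0; have e4 : 0 < eps / 4 by rewrite divr_gt0.
have [N HN] := uw _ e4; have [N' HN'] := uw' _ e4.
exists (maxn N N') => n; rewrite geq_max => /andP[/HN h /HN' h'].
rewrite opprD addrACA; have := nsqD_le (u n - w) (u' n - w'); lra.
Qed.

Lemma l2limZ a (u : nat -> l2 R I) w : l2lim u w -> l2lim (fun n => a *: u n) (a *: w).
Proof.
move=> uw eps e0.
have [N HN] := uw (eps / (sqabs a + 1)) (divr_gt0 e0 (ltr_wpDl (sqabs_ge0 a) ltr01)).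
exists N => n /HN h; rewrite -scalerBr nsqZ.
apply: (@le_trans _ _ ((sqabs a + 1) * (eps / (sqabs a + 1)))).
  by apply: ler_pM; rewrite ?sqabs_ge0 ?nsq_ge0 //; rewrite lerDl.
by rewrite mulrC divfK // gt_eqF // ltr_wpDl ?sqabs_ge0.
Qed.

Lemma l2lim_sub (u : nat -> l2 R I) w s : {homo s : m n / (m < n)%N} ->
  l2lim u w -> l2lim (u \o s) w.
Proof.
move=> hs uw eps e0; have [N HN] := uw _ e0; exists N => n Nn /=; apply: HN.
apply: leq_trans Nn _; elim: n => // n IH.
by apply: leq_ltn_trans IH _; apply: hs.
Qed.

Lemma l2lim_cst (w : l2 R I) : l2lim (fun=> w) w.
Proof. by move=> eps e0; exists 0%N => n _; rewrite subrr nsq0 ltW. Qed.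

Lemma l2lim_eq (u u' : nat -> l2 R I) w : u =1 u' -> l2lim u w -> l2lim u' w.
Proof.
move=> uu' uw eps e0; have [N HN] := uw _ e0; exists N => n Nn.
by rewrite -uu'; exact: HN.
Qed.

Lemma l2lim_nsq (u : nat -> l2 R I) w : l2lim u w ->
  (fun n => nsq (u n)) @ \oo --> nsq w.
Proof.
move=> uw; apply/cvgrPdist_le => eps e0.
pose M := 2 * nm w + 1; have Mp : 0 < M.
  by rewrite /M ltr_wpDl // mulr_ge0 ?nm_ge0.
pose d := Num.min 1 (eps / M); have dp : 0 < d.
  by rewrite /d lt_min ltr01 divr_gt0.
have [N HN] := uw (d ^+ 2) (exprn_gt0 _ dp).
exists N => // n /= /HN; rewrite -nm_le ?(ltW dp) // => H.
have h1 : nm (u n) <= nm w + d.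
  by rewrite -(subrK w (u n)); apply: le_trans (nmD _ _) _; rewrite addrC lerD2l.
have h2 : nm w <= nm (u n) + d.
  by rewrite -(subrK (u n) w); apply: le_trans (nmD _ _) _; rewrite nmBC addrC lerD2l.
have dM : d * M <= eps by rewrite -ler_pdivlMr // /d ge_min lexx orbT.
have d1 : d <= 1 by rewrite /d ge_min lexx.
rewrite -!nmK; have w0 := nm_ge0 w; have u0 := nm_ge0 (u n).
rewrite ler_norml; apply/andP; split; rewrite /M in dM; nra.
Qed.

End Limits.

Section SVD.
Context (R : realType) (I : choiceType).

Definition cop (J : choiceType) (X : l2 R I -> l2 R J) :=
  bop X /\ forall v : nat -> l2 R I, (forall n, nsq (v n) <= 1) ->
    exists s : nat -> nat, {homo s : m n / (m < n)%N} /\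
      exists w, l2lim (X \o v \o s) w.

Variables (J : choiceType) (X : l2 R I -> l2 R J).
Hypothesis cX : cop X.
Let bX : bop X := cX.1.
Let A := adjop X \o X.
Let bA : bop A := bop_comp bX (bop_adj bX).

Lemma ipA v w : ip (A v) w = ip (X v) (X w).
Proof. by rewrite /A /= -adjP'. Qed.

Lemma ipA' v w : ip v (A w) = ip (X v) (X w).
Proof. by rewrite /A /= -adjP. Qed.

Definition orth_to (E : seq (l2 R I)) v := forall e, e \in E -> ip v e = 0.

Definition eigseq (E : seq (l2 R I)) :=
  forall e, e \in E -> exists t : R, A e = t%:C%C *: e.

(** The supremum of |Xv|^2 on the unit ball of the orthogonal complement of
    finitely many eigenvectors is attained: if |X v_n|^2 tends to it and X v_n
    tends to w, then A v_n tends to X'w while A v_n - lam v_n tends to 0, so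
    that v_n converges strongly. *)
Lemma top_eigenvector E : eigseq E -> exists (e : l2 R I) (lam : R),
  [/\ 0 <= lam, orth_to E e, A e = lam%:C%C *: e,
      forall v, orth_to E v -> nsq (X v) <= lam * nsq v &
      (lam = 0 /\ e = 0) \/ (0 < lam /\ nsq e = 1)].
Proof.
move=> eE.
pose V : set R := [set nsq (X v) | v in [set v | orth_to E v /\ nsq v <= 1]].
have [C [C0 HC]] := bX.2.
have V0 : V (nsq (X 0)).
  by exists 0; split; [move=> e _; rewrite ip0l|rewrite nsq0].
have supV : has_sup V.
  split; first by exists (nsq (X 0)).
  exists C => _ [v [_ v1] <-]; apply: le_trans (HC v) _.
  by rewrite -[leRHS]mulr1 ler_wpM2l.
pose lam := sup V.
have lam0 : 0 <= lam.
  by apply: ub_le_sup; [exact: supV.2|move: V0; rewrite bop0 // nsq0].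
have Hlam v : orth_to E v -> nsq (X v) <= lam * nsq v.
  move=> ov; have [v0|vn0] := eqVneq (nsq v) 0.
    by rewrite (nsq_eq0 v0) bop0 // !nsq0 mulr0.
  have vp : 0 < nsq v by rewrite lt_neqAle eq_sym vn0 nsq_ge0.
  pose c := (Num.sqrt (nsq v))^-1.
  have c2 : c ^+ 2 = (nsq v)^-1 by rewrite /c exprVn sqr_sqrtr ?ltW.
  have : nsq (X (c%:C%C *: v)) <= lam.
    apply: ub_le_sup; first exact: supV.2.
    exists (c%:C%C *: v) => //; split; first by move=> e eE'; rewrite ipZl ov ?mulr0.
    by rewrite nsqZ sqabs_real c2 mulVf.
  by rewrite bopZ // nsqZ sqabs_real c2 mulrC ler_pdivrMr.
have [l0|ln0] := eqVneq lam 0.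
  exists 0, 0; split => //; last by left.
  - by move=> e _; rewrite ip0l.
  - by rewrite bop0 // scale0r.
  - by move=> v /Hlam; rewrite l0.
have lp : 0 < lam by rewrite lt_neqAle eq_sym ln0.
have orthA v : orth_to E v -> orth_to E (A v).
  move=> ov e eE'; have [t te] := eE e eE'.
  by rewrite ipA -ipA' te ipZr ov ?mulr0.
have nA v : orth_to E v -> nsq v <= 1 -> nsq (A v) <= lam ^+ 2.
  move=> ov v1; have h1 := Hlam v ov; have h2 := Hlam _ (orthA v ov).
  have : nsq (A v) = complex.Re (ip (X v) (X (A v))) by rewrite -ipA ipvv.
  have := cauchy_schwarz (X v) (X (A v)).
  have := Re_ip_le (X v) (X (A v)); rewrite ler_norml => /andP[_ h3] _ h4.
  have h5 : nsq (A v) ^+ 2 <= nsq (X v) * nsq (X (A v)).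
    rewrite -!nmK -exprMn ler_pXn2r ?nnegrE ?exprn_ge0 ?mulr_ge0 ?nm_ge0 //.
    by rewrite nmK h4.
  have [a0|an0] := eqVneq (nsq (A v)) 0; first by rewrite a0 exprn_ge0.
  have ap : 0 < nsq (A v) by rewrite lt_neqAle eq_sym an0 nsq_ge0.
  have h6 : nsq (X v) * nsq (X (A v)) <= lam * (lam * nsq (A v)).
    apply: ler_pM; rewrite ?nsq_ge0 //; apply: le_trans h1 _.
    by rewrite -[leRHS]mulr1 ler_wpM2l.
  rewrite -(ler_pM2r ap) -expr2; apply: le_trans h5 _; apply: le_trans h6 _.
  by rewrite mulrA.
have ex_v n : exists v, [/\ orth_to E v, nsq v <= 1 & lam - n.+1%:R^-1 < nsq (X v)].
  have ip0 : 0 < n.+1%:R^-1 :> R by rewrite invr_gt0 ltr0Sn.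
  by have [_ [v [ov v1] <-] H] := sup_adherent ip0 supV; exists v.
have /choice[v Hv] := ex_v.
have [s [hs [w Hw]]] := cX.2 v (fun n => let: And3 _ h _ := Hv n in h).
have AXw : l2lim (A \o v \o s) (adjop X w) := bop_lim (bop_adj bX) Hw.
have dlim : l2lim (fun n => A (v (s n)) - lam%:C%C *: v (s n)) 0.
  have : l2lim (fun n => A (v n) - lam%:C%C *: v n) 0.
    move=> eps e0.
    pose N := (Num.truncn (2 * lam / eps)).+1.
    exists N => n Nn; rewrite subr0 nsqB nsqZ sqabs_real ipZr ipA ipvv.
    rewrite conjc_real -rmorphM [complex.Re _]/=.
    have [ov v1 vl] := Hv n; have := nA _ ov v1.
    have : lam ^+ 2 * nsq (v n) <= lam ^+ 2 by rewrite -[leRHS]mulr1 ler_wpM2l ?exprn_ge0.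
    have : 2 * lam * n.+1%:R^-1 <= eps.
      rewrite ler_pdivrMr ?ltr0Sn // [leRHS]mulrC -ler_pdivrMr //.
      have := truncnS_gt (2 * lam / eps); rewrite -/N => h.
      apply: le_trans (ltW h) _; rewrite ler_nat; exact: leqW.
    have : 2 * lam * (lam - n.+1%:R^-1) <= 2 * lam * nsq (X (v n)).
      by rewrite ler_wpM2l ?mulr_ge0 // ltW.
    move: (n.+1%:R^-1) => iv; nra.
  exact: (l2lim_sub hs).
pose u := lam^-1%:C%C *: adjop X w.
have ulim : l2lim (v \o s) u.
  have := l2limZ lam^-1%:C%C (l2limD AXw (l2limZ (-1) dlim)).
  rewrite scaler0 addr0; apply: l2lim_eq => n /=.
  rewrite scaleN1r opprB addrC subrK scalerA -rmorphM /= mulVf // scale1r //.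
have ou : orth_to E u.
  by move=> e eE'; apply: (l2lim_ip ulim) => n /=; have [ov _ _] := Hv (s n); exact: ov.
have Au : A u = lam%:C%C *: u.
  rewrite /u scalerA -rmorphM /= mulfV // scale1r.
  by apply: l2lim_unique AXw; exact: bop_lim.
have Xu : nsq (X u) = lam.
  have c1 := l2lim_nsq (bop_lim bX ulim).
  apply/eqP; rewrite eq_le; apply/andP; split.
    rewrite -(cvg_lim _ c1) //; apply: limr_le; first by apply/cvg_ex; eexists; exact: c1.
    apply: nearW => n /=; have [ov v1 _] := Hv (s n).
    by apply: le_trans (Hlam _ ov) _; rewrite -[leRHS]mulr1 ler_wpM2l.
  apply/ler_addgt0Pr => eps e0; rewrite -lerBlDr.
  rewrite -(cvg_lim _ c1) //; apply: limr_ge; first by apply/cvg_ex; eexists; exact: c1.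
  exists (Num.truncn eps^-1).+1 => // n /= Nn; have [_ _ h] := Hv (s n).
  apply: le_trans (ltW h); rewrite lerD2l lerN2.
  rewrite invf_ple ?posrE ?ltr0Sn //.
  apply: le_trans (ltW (truncnS_gt _)) _; rewrite ler_nat.
  apply: leqW; apply: leq_trans Nn _; elim: n {h} => // n IH.
  by apply: leq_ltn_trans IH _; apply: hs.
exists u, lam; split => //; right; split=> //.
have : (nsq (X u))%:C%C = (lam * nsq u)%:C%C :> R[i].
  by rewrite -ipvv -ipA Au ipZl ipvv rmorphM.
move=> /complexI; rewrite Xu => h; apply: (mulfI ln0).
by rewrite -h mulr1.
Qed.

End SVD.

Section Schmidt.
Context (R : realType) (I : choiceType).

(** Singular values s_n, in decreasing order, with right singular vectors e_n.
    Beyond the rank of X both are zero. *)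
Record svd (J : choiceType) (X : l2 R I -> l2 R J) (e : nat -> l2 R I)
    (s : nat -> R) : Prop := Svd {
  svd_osys : osys e;
  svd_ge0 : forall n, 0 <= s n;
  svd_eq0 : forall n, s n = 0 -> e n = 0;
  svd_eig : forall n, adjop X (X (e n)) = (s n ^+ 2)%:C%C *: e n;
  svd_max : forall n v, (forall k, (k < n)%N -> ip v (e k) = 0) ->
    nsq (X v) <= s n ^+ 2 * nsq v;
  svd_dec : forall n, s n.+1 <= s n;
  svd_eq0' : forall n, e n = 0 -> s n = 0;
  svd_lim : forall eps : R, 0 < eps -> exists n, s n <= eps }.

(** Eigenvectors of X'X are chosen one after the other, each of them optimal in
    the orthogonal complement of its predecessors. The X e_n are orthogonal, so
    that a positive lower bound on their norms would contradict compactness. *)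
Lemma ex_svd (J : choiceType) (X : l2 R I -> l2 R J) : cop X ->
  exists e s, svd X e s.
Proof.
move=> cX; have bX := cX.1.
have H E : exists p : l2 R I * R, eigseq X E ->
    [/\ 0 <= p.2, orth_to E p.1, adjop X (X p.1) = p.2%:C%C *: p.1,
      forall v, orth_to E v -> nsq (X v) <= p.2 * nsq v &
      (p.2 = 0 /\ p.1 = 0) \/ (0 < p.2 /\ nsq p.1 = 1)].
  have [eE|neE] := pselect (eigseq X E); last by exists (0, 0).
  by have [e [lam Hl]] := top_eigenvector cX eE; exists (e, lam).
have /choice[f Hf] := H.
pose S := fix S n := if n is m.+1 then rcons (S m) (f (S m)).1 else [::].
have gS n : eigseq X (S n).
  elim: n => [|n IH] e //=; rewrite mem_rcons inE => /orP[/eqP ->|]; last exact: IH.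
  by exists (f (S n)).2; have [_ _ h _ _] := Hf _ IH.
pose e n := (f (S n)).1; pose lam n := (f (S n)).2.
have SE n v : orth_to (S n) v <-> (forall k, (k < n)%N -> ip v (e k) = 0).
  elim: n => [|n IH]; first by split=> // _ k.
  split=> [h k|h w].
    rewrite ltnS leq_eqVlt => /orP[/eqP ->|kn].
      by apply: h; rewrite /= mem_rcons mem_head.
    by apply: (IH.1 _ k kn) => w wS; apply: h; rewrite /= mem_rcons inE wS orbT.
  rewrite /= mem_rcons inE => /orP[/eqP ->|wS]; first exact: h.
  by apply: (IH.2 _ w wS) => k kn; apply: h; exact: ltnW.
have l0 n : 0 <= lam n by have [] := Hf _ (gS n).
have el n : (lam n = 0 /\ e n = 0) \/ (0 < lam n /\ nsq (e n) = 1).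
  by have [] := Hf _ (gS n).
have ee n : adjop X (X (e n)) = (lam n)%:C%C *: e n by have [] := Hf _ (gS n).
have mx n v : (forall k, (k < n)%N -> ip v (e k) = 0) -> nsq (X v) <= lam n * nsq v.
  by move=> /SE h; have [_ _ _ m _] := Hf _ (gS n); exact: m.
have eo n k : (k < n)%N -> ip (e n) (e k) = 0.
  by move=> kn; have [_ o _ _ _] := Hf _ (gS n); apply: (SE n _).1 kn.
have oe : osys e.
  split=> [i j|n]; last by case: (el n) => [[_ ->]|[_ ->]]; [right|left].
  rewrite neq_ltn => /orP[ij|ji]; last exact: eo.
  by rewrite ipC eo // conjc0.
have nX n : nsq (X (e n)) = lam n * nsq (e n).
  apply: complexI.
  by rewrite -ipvv (adjP bX) ee ipZr conjc_real ipvv -rmorphM.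
have dec n : lam n.+1 <= lam n.
  have [[-> _]//|[_ n1]] := el n.+1.
  have := nX n.+1; rewrite n1 mulr1 => <-; have := mx n (e n.+1).
  by rewrite n1 mulr1; apply => k kn; apply: eo; exact: leqW.
have decm m n : (m <= n)%N -> lam n <= lam m.
  move=> /subnK <-; elim: (n - m)%N => // d IH.
  by rewrite addSn; exact: le_trans (dec _) IH.
have lim eps : 0 < eps -> exists n, lam n <= eps.
  move=> e0; apply: contrapT => H0.
  have lge n : eps < lam n by rewrite ltNge; apply/negP => h; apply: H0; exists n.
  have n1 n : nsq (e n) = 1.
    by case: (el n) => [[l _]|[_ ->]] //; move: (lge n); rewrite l ltNge (ltW e0).
  have [s [hs [w Hw]]] := cX.2 e (fun n => eq_ind_r (fun x => x <= 1) (lexx 1) (n1 n)).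
  have [N HN] := Hw (eps / 4) (divr_gt0 e0 (ltr0n _ 4)).
  have h1 := HN N (leqnn _); have h2 := HN N.+1 (leqnSn _).
  have := nsqD_le (X (e (s N)) - w) (w - X (e (s N.+1))).
  rewrite addrA subrK (nsqB (X (e (s N))) (X (e (s N.+1)))) !nX !n1 !mulr1 (nsqBC w).
  rewrite (_ : ip (X (e (s N))) (X (e (s N.+1))) = 0); last first.
    rewrite (adjP bX) ee ipZr (oe.1 (s N)) ?mulr0 // ltn_eqF //; exact: hs.
  rewrite mulr0 subr0; move: h1 h2 (lge (s N)) (lge (s N.+1)) e0 => /=.
  move: (nsq _) (nsq _) (lam _) (lam _) => x y a b; clear; lra.
exists e, (fun n => Num.sqrt (lam n)); apply: Svd => [//|n|n|n|n v|n|n|eps e0] /=.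
- exact: sqrtr_ge0.
- move=> /eqP; rewrite sqrtr_eq0 => ln.
  by case: (el n) => [[_ ->]|[lp _]] //; move: ln; rewrite leNgt lp.
- by rewrite sqr_sqrtr.
- by rewrite sqr_sqrtr //; exact: mx.
- exact: ler_wsqrtr.
- by move=> en; case: (el n) => [[-> _]|[_]]; rewrite ?sqrtr0 // en nsq0 => /eqP;
    rewrite eq_sym oner_eq0.
- have [n Hn] := lim (eps ^+ 2) (exprn_gt0 _ e0); exists n.
  rewrite -[leRHS]ger0_norm ?(ltW e0) // -sqrtr_sqr; exact: ler_wsqrtr Hn.
Qed.

Section Decomposition.
Variables (J : choiceType) (X : l2 R I -> l2 R J) (e : nat -> l2 R I) (s : nat -> R).
Hypotheses (bX : bop X) (Xes : svd X e s).
Let oe : osys e := svd_osys Xes.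

Lemma svd_decm m n : (m <= n)%N -> s n <= s m.
Proof.
move=> /subnK <-; elim: (n - m)%N => // d IH.
by rewrite addSn; exact: le_trans (svd_dec Xes _) IH.
Qed.

Lemma svd_ker v : (forall k, ip v (e k) = 0) -> X v = 0.
Proof.
move=> v0; apply: nsq_eq0; apply/eqP; rewrite eq_le nsq_ge0 andbT.
apply/ler_addgt0Pr => eps e0; rewrite add0r.
have np : 0 < nsq v + 1 by rewrite ltr_wpDl ?nsq_ge0.
have ep : 0 < Num.sqrt (eps / (nsq v + 1)) by rewrite sqrtr_gt0 divr_gt0.
have [n Hn] := svd_lim Xes ep.
apply: le_trans (svd_max Xes (fun k (_ : (k < n)%N) => v0 k)) _.
have : s n ^+ 2 <= eps / (nsq v + 1).
  rewrite -[leRHS]sqr_sqrtr ?divr_ge0 ?(ltW e0) ?(ltW np) //.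
  by rewrite ler_pXn2r ?nnegrE ?sqrtr_ge0 ?(svd_ge0 Xes).
rewrite ler_pdivlMr // => h; apply: le_trans h; rewrite ler_wpM2l ?exprn_ge0 ?(svd_ge0 Xes) //.
by rewrite lerDl.
Qed.

Lemma ker_orth v k : X v = 0 -> ip v (e k) = 0.
Proof.
move=> Xv; have [s0|sn0] := eqVneq (s k) 0; first by rewrite (svd_eq0 Xes s0) ip0r.
have : ip v (adjop X (X (e k))) = 0 by rewrite -adjP // Xv ip0l.
rewrite (svd_eig Xes) ipZr conjc_real => /eqP; rewrite mulf_eq0 => /orP[|/eqP //].
by rewrite (inj_eq (@complexI R)) expf_eq0 (negPf sn0).
Qed.

Definition fourier (c : nat -> R[i]) n := \sum_(0 <= k < n) c k *: e k.

Lemma fourier_cvg (f : nat -> R) B v : (forall k, `|f k| <= B) ->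
  exists w, l2lim (fourier (fun k => (f k)%:C%C * ip v (e k))) w.
Proof.
move=> fB; apply: (@riesz_fischer R I e _ (B ^+ 2 * nsq v) oe) => n.
apply: (@le_trans _ _ (\sum_(0 <= k < n) B ^+ 2 * sqabs (ip v (e k)))).
  apply: ler_sum => k _; rewrite sqabsM sqabs_real -mulrA ip_osys_self //.
  rewrite ler_wpM2r ?sqabs_ge0 // -real_normK ?num_real //.
  by rewrite ler_pXn2r ?nnegrE // (le_trans _ (fB k)).
rewrite -mulr_sumr ler_wpM2l ?sqr_ge0 //; apply: bessel => //; exact: iota_uniq.
Qed.

(** The operator f(n) on e_n that vanishes on the orthogonal complement of all e_n. *)
Definition diagop (f : nat -> R) (v : l2 R I) : l2 R I :=
  xget 0 [set w | l2lim (fourier (fun k => (f k)%:C%C * ip v (e k))) w].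

Lemma diagopP (f : nat -> R) B v : (forall k, `|f k| <= B) ->
  l2lim (fourier (fun k => (f k)%:C%C * ip v (e k))) (diagop f v).
Proof.
move=> fB; have [w Hw] := fourier_cvg v fB.
by rewrite /diagop; case: xgetP => [y -> //|/(_ w)].
Qed.

(** The projection of v on the closed span of the e_k leaves a remainder on which
    the bound by s_n holds for all n, so that X vanishes there. *)
Lemma svd_decomp v : exists p r, [/\ v = p + r, X r = 0,
  (forall k, ip r (e k) = 0) & l2lim (fourier (fun k => ip v (e k))) p].
Proof.
have f1 (k : nat) : `|1 : R| <= 1 by rewrite normr1.
have [p] := fourier_cvg v f1.
rewrite (_ : (fun k => _) = (fun k => ip v (e k))); last first.
  by apply/funext => k; rewrite mul1r.
move=> Hp; exists p, (v - p).
have orth k : ip (v - p) (e k) = 0.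
  have L : l2lim (fun n => v - fourier (fun k => ip v (e k)) (n + k.+1)) (v - p).
    have sh : l2lim (fun n => fourier (fun k => ip v (e k)) (n + k.+1)) p.
      by apply: (l2lim_sub (s := fun n => (n + k.+1)%N) _ Hp) => m n; rewrite ltn_add2r.
    have := l2limD (l2lim_cst v) (l2limZ (-1) sh).
    by rewrite scaleN1r; apply: l2lim_eq => n; rewrite scaleN1r.
  apply: (l2lim_ip L) => n; rewrite ipBl /fourier (ip_psum_in oe) ?iota_uniq //.
    have [->|->] := oe.2 k; last by rewrite ip0r mul0r subrr.
    by rewrite mulr1 subrr.
  by rewrite mem_index_iota /= ltn_addl.
by split => //; [rewrite addrC subrK|exact: svd_ker].
Qed.

(** By svd_decomp and continuity. *)
Lemma svd_det (K : choiceType) (L M : l2 R I -> l2 R K) : bop L -> bop M ->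
  (forall k, L (e k) = M (e k)) -> (forall r, X r = 0 -> L r = M r) -> L = M.
Proof.
move=> bL bM LM ker; apply/funext => v.
have [p [r [-> Xr _ Hp]]] := svd_decomp v.
rewrite !bopD // (ker _ Xr); congr (_ + _).
apply: l2lim_unique (bop_lim bL Hp) _.
apply: l2lim_eq (bop_lim bM Hp) => n /=.
rewrite /fourier !bop_sum //; apply: eq_bigr => k _.
by rewrite !bopZ // LM.
Qed.

Section DiagonalOperator.
Variables (f : nat -> R) (B : R).
Hypothesis fB : forall k, `|f k| <= B.

Lemma bop_diagop : bop (diagop f).
Proof.
have B0 : 0 <= B by apply: le_trans (fB 0).
split.
  move=> a v w; apply: l2lim_unique (diagopP _ fB) _.
  apply: l2lim_eq (l2limD (l2limZ a (diagopP v fB)) (diagopP w fB)) => n.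
  rewrite /fourier scaler_sumr -big_split /=; apply: eq_bigr => k _.
  by rewrite scalerA -scalerDl ipDl ipZl; congr (_ *: _); ring.
exists (B ^+ 2); split; first exact: sqr_ge0.
move=> v; have c1 := l2lim_nsq (diagopP v fB).
rewrite -(cvg_lim _ c1) //; apply: limr_le; first by apply/cvg_ex; eexists; exact: c1.
apply: nearW => n /=; rewrite /fourier (nsq_psum oe) ?iota_uniq //.
apply: (@le_trans _ _ (\sum_(0 <= k < n) B ^+ 2 * sqabs (ip v (e k)))).
  apply: ler_sum => k _; rewrite sqabsM sqabs_real -mulrA ip_osys_self //.
  rewrite ler_wpM2r ?sqabs_ge0 // -real_normK ?num_real //.
  by rewrite ler_pXn2r ?nnegrE.
rewrite -mulr_sumr ler_wpM2l ?sqr_ge0 //; apply: bessel => //; exact: iota_uniq.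
Qed.

Lemma diagop_eig k : diagop f (e k) = (f k)%:C%C *: e k.
Proof.
apply: l2lim_unique (diagopP _ fB) _ => eps e0; exists k.+1 => n kn.
rewrite (_ : fourier _ n = (f k)%:C%C *: e k) ?subrr ?nsq0 ?ltW //.
rewrite /fourier (bigD1_seq k) ?iota_uniq ?mem_index_iota //= big1 ?addr0.
  have [ek|->] := oe.2 k; last by rewrite !scaler0.
  by rewrite ipvv ek mulr1.
by move=> j jk; rewrite oe.1 1?eq_sym // mulr0 scale0r.
Qed.

Lemma diagop_ker v : (forall k, ip v (e k) = 0) -> diagop f v = 0.
Proof.
move=> v0; apply: l2lim_unique (diagopP _ fB) _ => eps e0; exists 0%N => n _.
rewrite subr0 /fourier big1 ?nsq0 ?ltW // => k _.
by rewrite v0 mulr0 scale0r.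
Qed.

Lemma ip_diagop v : (fun n => \sum_(0 <= k < n) f k * sqabs (ip v (e k))) @ \oo -->
    complex.Re (ip (diagop f v) v) /\ complex.Im (ip (diagop f v) v) = 0.
Proof.
have E n : ip (fourier (fun k => (f k)%:C%C * ip v (e k)) n) v =
    (\sum_(0 <= k < n) f k * sqabs (ip v (e k)))%:C%C.
  rewrite /fourier ip_suml rmorph_sum; apply: eq_bigr => k _.
  by rewrite ipZl -mulrA (ipC v (e k)) sqabs_conj -rmorphM.
have lim (eps : R) : 0 < eps -> exists N, forall n, (N <= n)%N ->
    sqabs (ip (diagop f v) v - (\sum_(0 <= k < n) f k * sqabs (ip v (e k)))%:C%C) <= eps.
  move=> e0; have np : 0 < nsq v + 1 by rewrite ltr_wpDl ?nsq_ge0.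
  have [N HN] := diagopP v fB (divr_gt0 e0 np).
  exists N => n /HN {}HN; rewrite -E -ipBl.
  apply: le_trans (cauchy_schwarz _ _) _.
  apply: (@le_trans _ _ (eps / (nsq v + 1) * (nsq v + 1))).
    by apply: ler_pM; rewrite ?nsq_ge0 //; [rewrite nsqBC|rewrite lerDl].
  by rewrite divfK // gt_eqF.
split.
  apply/cvgrPdist_le => eps e0; have [N HN] := lim _ (exprn_gt0 2 e0).
  exists N => // n /= /HN H; have := Re_le_sqabs (ltW e0) H.
  by rewrite raddfB.
apply/eqP; rewrite -sqrf_eq0 eq_le sqr_ge0 andbT.
apply/ler_addgt0Pr => eps e0; rewrite add0r.
have [N HN] := lim eps e0; apply: le_trans (HN N (leqnn _)).
rewrite /sqabs; set a := \sum_(0 <= k < N) _.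
have -> (z : R[i]) : complex.Im (z - a%:C%C) = complex.Im z by rewrite raddfB /= subr0.
by rewrite lerDr sqr_ge0.
Qed.

End DiagonalOperator.
End Decomposition.
End Schmidt.

(** * The modulus and its functional calculus *)

Section Trace.
Context (R : realType) (I : choiceType).

Lemma esum_exchange_le (T1 T2 : choiceType) (a : T1 -> T2 -> \bar R) :
  (forall i j, 0 <= a i j)%E ->
  (\esum_(i in [set: T1]) \esum_(j in [set: T2]) a i j <=
   \esum_(j in [set: T2]) \esum_(i in [set: T1]) a i j)%E.
Proof.
move=> a0; apply: ge_ereal_sup => _ [F [finF _] <-].
rewrite fsbig_finite //= -esum_sum; last by move=> *; exact: a0.
apply: le_esum => j _; rewrite -fsbig_finite //.
by apply: ereal_sup_ubound; exists F.
Qed.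

Lemma esum_exchange (T1 T2 : choiceType) (a : T1 -> T2 -> \bar R) :
  (forall i j, 0 <= a i j)%E ->
  (\esum_(i in [set: T1]) \esum_(j in [set: T2]) a i j =
   \esum_(j in [set: T2]) \esum_(i in [set: T1]) a i j)%E.
Proof.
by move=> a0; apply/eqP; rewrite eq_le; apply/andP; split; apply: esum_exchange_le.
Qed.

Lemma esum_nat_cvg (f : nat -> R) l : (forall n, 0 <= f n) ->
  (fun n => \sum_(0 <= k < n) f k) @ \oo --> l ->
  (\esum_(k in [set: nat]) (f k)%:E)%E = l%:E.
Proof.
move=> f0 fl; rewrite -nneseries_esumT; last by move=> n; rewrite lee_fin.
apply/cvg_lim => //; apply: cvg_EFin.
  by apply: nearW => n; rewrite sumEFin.
rewrite (_ : fine \o _ = (fun n => \sum_(0 <= k < n) f k)) //.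
by apply/funext => n /=; rewrite sumEFin.
Qed.

Section SchmidtTrace.
Variables (J : choiceType) (X : l2 R I -> l2 R J) (e : nat -> l2 R I) (s : nat -> R).
Hypotheses (bX : bop X) (Xes : svd X e s).

(** Both sides are double sums of f_k |e_k(i)|^2, over k and i. *)
Lemma trace_diagop (f : nat -> R) B : (forall k, `|f k| <= B) ->
  (forall k, 0 <= f k) -> (forall k, e k = 0 -> f k = 0) ->
  trace (mxof (diagop e f)) = (\esum_(k in [set: nat]) (f k)%:E)%E.
Proof.
move=> fB f0 fe0.
have E i : ((complex.Re (mxof (diagop e f) i i))%:E =
    \esum_(k in [set: nat]) (f k * sqabs (e k i))%:E)%E.
  have [c _] := ip_diagop Xes fB (delta i).
  rewrite /mxof -ip_delta; apply/esym/esum_nat_cvg.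
    by move=> k; rewrite mulr_ge0 ?sqabs_ge0.
  rewrite (_ : (fun n => _) = (fun n => \sum_(0 <= k < n) f k * sqabs (ip (delta i) (e k)))) //.
  apply/funext => n; apply: eq_bigr => k _.
  by rewrite ipC ip_delta sqabsJ.
rewrite /trace; under eq_esum do rewrite E.
rewrite esum_exchange; last by move=> i k; rewrite lee_fin mulr_ge0 ?sqabs_ge0.
apply: eq_esum => k _; rewrite esumZ //; last by move=> i; exact: sqabs_ge0.
rewrite -/(sqnorm (e k)) sqnormE -EFinM.
by case: ((svd_osys Xes).2 k) => [->|ek]; rewrite ?mulr1 // fe0 // mul0r.
Qed.

Lemma svd_abs_le k : `|s k| <= s 0%N.
Proof. by rewrite ger0_norm ?(svd_ge0 Xes) // (svd_decm Xes). Qed.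

(** This is |X|: it is positive and its square is X'X. *)
Definition modulus := diagop e s.

Lemma bop_modulus : bop modulus.
Proof. exact: (bop_diagop Xes svd_abs_le). Qed.

Lemma modulus_eig k : modulus (e k) = (s k)%:C%C *: e k.
Proof. exact: (diagop_eig Xes svd_abs_le). Qed.

Lemma modulus_ker r : X r = 0 -> modulus r = 0.
Proof.
move=> Xr; apply: (diagop_ker Xes svd_abs_le) => k; exact: (ker_orth bX Xes).
Qed.

Lemma modulus_sqr : modulus \o modulus = adjop X \o X.
Proof.
have bA := bop_comp bX (bop_adj bX); have bm := bop_modulus.
apply: (svd_det Xes (bop_comp bm bm) bA) => [k|r Xr] /=.
  rewrite {2}/modulus (diagop_eig Xes svd_abs_le) bopZ //.
  by rewrite /modulus (diagop_eig Xes svd_abs_le) scalerA -rmorphM (svd_eig Xes) -expr2.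
by rewrite (modulus_ker Xr) bop0 // Xr bop0 //; exact: bop_adj.
Qed.

End SchmidtTrace.
End Trace.

Section Modulus.
Context (R : realType) (I : choiceType) (x : opmx R I) (X : l2 R I -> l2 R I)
  (e : nat -> l2 R I) (s : nat -> R).
Hypotheses (rx : represents x X) (Xes : svd X e s).
Let bX : bop X := rx.1.

Lemma inner_app (y : opmx R I) Y (v : l2 R I) : represents y Y ->
  inner (app y v) v = ip (Y v) v.
Proof. by move=> [_ ry]; rewrite ry. Qed.

Lemma modulus_positive : positive_op (mxof (modulus e s)).
Proof.
have rm := represents_mxof (bop_modulus Xes).
split; first exact: represents_bounded rm.
move=> _ /ell2_l2[v <-]; rewrite (inner_app _ rm).
have [c c0] := ip_diagop Xes (svd_abs_le Xes) v.
rewrite lecE /modulus c0 eqxx andTb -(cvg_lim _ c) //.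
apply: limr_ge; first by apply/cvg_ex; eexists; exact: c.
apply: nearW => n; apply: sumr_ge0 => k _.
by rewrite mulr_ge0 ?sqabs_ge0 ?(svd_ge0 Xes).
Qed.

(** If [y] is positive and [y^2 v = l^2 v] with [l > 0], then [w = y v - l v]
    satisfies [y w = - l w], which forces [w = 0]. *)
Lemma positive_sqrt_eig (y : opmx R I) Y (l : R) v : represents y Y ->
  positive_op y -> 0 < l -> Y (Y v) = (l ^+ 2)%:C%C *: v -> Y v = l%:C%C *: v.
Proof.
move=> ry [_ py] l0 YYv; have bY := ry.1.
apply/eqP; rewrite -subr_eq0; apply/eqP; set w := _ - _.
have Yw : Y w = - (l%:C%C *: w).
  by rewrite /w bopB // bopZ // YYv scalerBr scalerA -rmorphM -expr2 opprB.
have := py w (l2_ell2 w); rewrite (inner_app _ ry) Yw ipNl ipZl ipvv -rmorphM.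
rewrite -rmorphN lecE /= => /andP[_]; rewrite oppr_ge0 => h.
apply: nsq_eq0; apply/eqP; rewrite eq_le nsq_ge0 andbT.
by rewrite -(pmulr_rle0 _ l0).
Qed.

(** Polarization of the real form <Yv, v>, at v + w and v + iw. *)
Lemma positive_selfadj (y : opmx R I) Y : represents y Y -> positive_op y ->
  forall v w, ip (Y v) w = ip v (Y w).
Proof.
move=> ry [_ py] v w; have bY := ry.1.
have re u : ip (Y u) u = conjc (ip (Y u) u).
  have := py u (l2_ell2 u); rewrite (inner_app _ ry) => /ger0_Im.
  by case: (ip _ _) => a b /= ->; rewrite oppr0.
have E c : ip (Y (v + c *: w)) (v + c *: w) = ip (Y v) v + conjc c * ip (Y v) w
    + (c * ip (Y w) v + c * (conjc c * ip (Y w) w)).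
  by rewrite bopD // bopZ // ipDl !ipDr ipZr !ipZl ipZr.
rewrite [RHS]ipC; have := re (v + 1 *: w); have := re (v + 'i%C *: w); rewrite !E.
have := re v; have := re w.
case: (ip (Y v) v) (ip (Y w) w) (ip (Y v) w) (ip (Y w) v) => a1 a2 [b1 b2] [c1 c2] [d1 d2].
by move=> [h1] [h2] [h3] [h4]; apply: complexP => /=; lra.
Qed.

(** A positive square root y of X'X has the same eigenvectors e_k by
    positive_sqrt_eig, and it vanishes on the kernel of X since
    |yr|^2 = <X'Xr, r>. *)
Lemma absopE : absop x = mxof (modulus e s).
Proof.
have bm := bop_modulus Xes; have rm := represents_mxof bm.
have ra := represents_adj rx.
apply: xget_unique.
  split; first exact: modulus_positive.
  apply: (represents_inj (represents_mul rm rm)).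
  rewrite (modulus_sqr bX Xes); exact: represents_mul.
move=> y [py yy]; have [Y ry] := bounded_represents py.1; have bY := ry.1.
have YY : Y \o Y = adjop X \o X.
  apply: represents_uniq (represents_mul ry ry) _; rewrite yy; exact: represents_mul.
rewrite (represents_eq ry); congr mxof.
apply: (svd_det Xes bY bm) => [k|r Xr].
  rewrite (modulus_eig Xes).
  have [s0|sn0] := eqVneq (s k) 0; first by rewrite (svd_eq0 Xes s0) bop0 // scaler0.
  apply: (positive_sqrt_eig ry py); first by rewrite lt_neqAle eq_sym sn0 (svd_ge0 Xes).
  by rewrite -(svd_eig Xes) -[LHS]/((Y \o Y) (e k)) YY.
rewrite (modulus_ker bX Xes Xr); apply: nsq_eq0; apply: complexI.
rewrite -ipvv (positive_selfadj ry py) -[Y (Y r)]/((Y \o Y) r) YY /= Xr.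
by rewrite bop0 ?ip0r //; exact: bop_adj.
Qed.

Definition gauge (psi : R -> R) := [/\ psi 0 = 0, forall t, 0 <= t -> 0 <= psi t &
  forall t u, 0 <= t -> t <= u -> psi t <= psi u].

Section Functional.
Variables (psi : R -> R) (a : R).
Hypotheses (gpsi : gauge psi) (a0 : 0 < a).

Lemma psi_abs_le k : `|psi (s k / a)| <= psi (s 0%N / a).
Proof.
have [_ p0 pm] := gpsi; have sk := svd_ge0 Xes k.
have h : 0 <= s k / a by rewrite divr_ge0 // ltW.
rewrite ger0_norm ?p0 //; apply: pm => //.
by rewrite ler_wpM2r ?invr_ge0 ?(ltW a0) // (svd_decm Xes).
Qed.

Lemma represents_div (y : opmx R I) Y : represents y Y ->
  represents (fun i j => y i j / real_complex R a) (fun v => a^-1%:C%C *: Y v).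
Proof.
move=> ry; have bY := ry.1.
have b0 : bop (fun _ : l2 R I => 0 : l2 R I).
  split; first by move=> c v w; rewrite -[RHS]/(c *: (0 : l2 R I) + 0) scaler0 addr0.
  by exists 0; split => // v; rewrite nsq0 mul0r.
have b : bop (fun v => a^-1%:C%C *: Y v).
  by have := bop_lincomb a^-1%:C%C bY b0;
     rewrite (_ : (fun v => _ + _) = (fun v => a^-1%:C%C *: Y v)) //;
     apply/funext => v; rewrite addr0.
rewrite (_ : (fun i j => _) = mxof (fun v => a^-1%:C%C *: Y v)); first exact: represents_mxof.
apply/funext => i; apply/funext => j; rewrite /mxof l2_scaleE mulrC.
by rewrite (represents_eq ry) fmorphV.
Qed.

(** The operator psi(|x|/a) is the only bounded one that acts as it should on
    the eigenspaces of |x|/a. *)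
Lemma funcalc_unique (z : opmx R I) : bounded_op z ->
  (forall (l : R) (v : l2 R I), 0 <= l -> modulus e s v = (l * a)%:C%C *: v ->
     app z v = (fun i => (psi l)%:C%C * v i)) ->
  z = mxof (diagop e (fun k => psi (s k / a))).
Proof.
move=> bz Hz; have [Z rz] := bounded_represents bz; have bZ := rz.1.
rewrite (represents_eq rz); congr mxof.
have [p0 p1 p2] := gpsi.
have Zv l v : 0 <= l -> modulus e s v = (l * a)%:C%C *: v -> Z v = (psi l)%:C%C *: v.
  by move=> l0 mv; apply: l2P => i; rewrite -rz.2 (Hz l).
apply: (svd_det Xes bZ (bop_diagop Xes psi_abs_le)) => [k|r Xr].
  rewrite (diagop_eig Xes psi_abs_le); apply: Zv; first by rewrite divr_ge0 ?(svd_ge0 Xes) // ltW.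
  by rewrite (modulus_eig Xes) divfK // gt_eqF.
rewrite (diagop_ker Xes psi_abs_le); last by move=> k; exact: (ker_orth bX Xes).
rewrite (Zv 0) //; first by rewrite p0 scale0r.
by rewrite (modulus_ker bX Xes Xr) mul0r scale0r.
Qed.

(** An eigenvector of |X| for the eigenvalue la is orthogonal to the e_k with
    s_k <> la. If it has a component in the kernel of X then l = 0, and psi 0 = 0. *)
Lemma diagop_psi_eig (l : R) (v : l2 R I) : 0 <= l ->
  modulus e s v = (l * a)%:C%C *: v ->
  diagop e (fun k => psi (s k / a)) v = (psi l)%:C%C *: v.
Proof.
move=> l0 mv; have [p0 p1 p2] := gpsi.
have bm := bop_modulus Xes; have bZ := bop_diagop Xes psi_abs_le.
have sk k : s k != l * a -> ip v (e k) = 0.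
  move=> skl; have : ip (modulus e s v) (e k) = (s k)%:C%C * ip v (e k).
    rewrite (positive_selfadj (represents_mxof bm) modulus_positive).
    by rewrite (modulus_eig Xes) ipZr conjc_real.
  rewrite mv ipZl => /eqP; rewrite eq_sym -subr_eq0 -mulrBl mulf_eq0 -rmorphB.
  by rewrite (inj_eq (@complexI R)) subr_eq0 (negPf skl) => /eqP.
have [p [r [vE Xr re Hp]]] := svd_decomp Xes v.
have Zp : diagop e (fun k => psi (s k / a)) p = (psi l)%:C%C *: p.
  apply: l2lim_unique (bop_lim bZ Hp) _.
  apply: l2lim_eq (l2limZ (psi l)%:C%C Hp) => n /=.
  rewrite /fourier (bop_sum bZ) scaler_sumr; apply: eq_bigr => k _.
  rewrite (bopZ bZ) (diagop_eig Xes psi_abs_le) !scalerA.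
  have [->|skl] := eqVneq (s k) (l * a); last by rewrite sk // mulr0 mul0r.
  by rewrite mulfK ?gt_eqF // mulrC.
have mp : modulus e s p = (l * a)%:C%C *: p.
  apply: l2lim_unique (bop_lim bm Hp) _.
  apply: l2lim_eq (l2limZ (l * a)%:C%C Hp) => n /=.
  rewrite /fourier (bop_sum bm) scaler_sumr; apply: eq_bigr => k _.
  rewrite (bopZ bm) (modulus_eig Xes) !scalerA.
  have [->|skl] := eqVneq (s k) (l * a); last by rewrite sk // mulr0 mul0r.
  by rewrite mulrC.
have : (l * a)%:C%C *: r = 0.
  move: mv; rewrite vE bopD // mp (modulus_ker bX Xes Xr) addr0 scalerDr.
  by move=> /esym/eqP; rewrite -[X in _ == X]addr0 (inj_eq (addrI _)) => /eqP.
move=> /eqP; rewrite scaler_eq0 (inj_eq (@complexI R)) mulf_eq0 (gt_eqF a0) orbF.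
rewrite vE bopD // Zp (diagop_ker Xes psi_abs_le re) addr0.
move=> /orP[/eqP ->|/eqP ->]; first by rewrite p0 !scale0r.
by rewrite addr0.
Qed.

Lemma trpsi_eqf : funcalc psi (fun i j => absop x i j / real_complex R a)
  = mxof (diagop e (fun k => psi (s k / a))).
Proof.
have bZ := bop_diagop Xes psi_abs_le; have rZ := represents_mxof bZ.
rewrite absopE; have rm := represents_div (represents_mxof (bop_modulus Xes)).
have eigE l (v : l2 R I) : app (fun i j => mxof (modulus e s) i j / real_complex R a) v
    = (fun i => real_complex R l * v i) <-> modulus e s v = (l * a)%:C%C *: v.
  have an0 : a%:C%C != 0 :> R[i] by rewrite (inj_eq (@complexI R)) gt_eqF.
  rewrite rm.2; split=> [h|->].
    apply: l2P => i; have /(congr1 (fun f => f i)) := h.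
    rewrite l2_scaleE fmorphV => h1.
    by apply: (mulfI (invr_neq0 an0)); rewrite h1 l2_scaleE rmorphM /=; field.
  apply/funext => i; rewrite !l2_scaleE fmorphV rmorphM /=; field => //.
apply: xget_unique.
  split; first exact: represents_bounded rZ.
  move=> l _ l0 /ell2_l2[v <-] /eigE mv.
  by rewrite rZ.2 (diagop_psi_eig l0 mv).
move=> z [bz Hz]; apply: funcalc_unique => // l v l0 mv.
by apply: Hz => //; [exact: l2_ell2|apply/eigE].
Qed.

Lemma trpsiE : trpsi psi x a = (\esum_(k in [set: nat]) (psi (s k / a))%:E)%E.
Proof.
have [p0 p1 p2] := gpsi.
rewrite /trpsi trpsi_eqf (trace_diagop Xes psi_abs_le) //.
  by move=> k; apply: p1; rewrite divr_ge0 ?(svd_ge0 Xes) // ltW.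
by move=> k /(svd_eq0' Xes) ->; rewrite mul0r.
Qed.

(** The operator psi(|x|/a) is identified by its action on eigenvectors; it need
    not be expressed in terms of the Schmidt decomposition. *)
Lemma trpsi_trace (z : opmx R I) : bounded_op z ->
  (forall (l : R) (v : l2 R I), 0 <= l -> modulus e s v = (l * a)%:C%C *: v ->
     app z v = (fun i => (psi l)%:C%C * v i)) ->
  trpsi psi x a = trace z.
Proof. by move=> bz Hz; rewrite /trpsi trpsi_eqf -(funcalc_unique bz Hz). Qed.

End Functional.
End Modulus.

(** * Singular values under contractions and reindexing *)

Section Compact.
Context (R : realType) (I : choiceType).

Lemma compact_opP (x : opmx R I) X : represents x X -> compact_op x <-> cop X.
Proof.
move=> rx; split=> [[_ cx]|[bX cX]].
  split; first exact: rx.1.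
  move=> v v1.
  have v1' n : (sqnorm (v n) <= 1)%E by rewrite sqnormE lee_fin.
  have [s [hs [_ /ell2_l2[w <-] Hw]]] := cx (fun n => v n : I -> R[i]) v1'.
  exists s; split=> //; exists w => eps e0.
  have E : (fun n => sqnorm (fun i => app x (v (s n)) i - w i))
      = EFin \o (fun n => nsq (X (v (s n)) - w)).
    by apply/funext => n /=; rewrite -sqnormE rx.2.
  move: Hw; rewrite E => /fine_cvgP[_ /cvgrPdist_le /(_ eps e0)[N _ HN]].
  exists N => n /HN /=; rewrite sub0r normrN; apply: le_trans; exact: ler_norm.
split; first exact: represents_bounded rx.
move=> v v1.
have /choice[v' Hv'] : forall n, exists v' : l2 R I, l2fun v' = v n.
  by move=> n; apply: ell2_l2; apply: le_lt_trans (v1 n) (ltry _).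
have v1' n : nsq (v' n) <= 1 by rewrite -lee_fin -sqnormE Hv'.
have [s [hs [w Hw]]] := cX v' v1'.
exists s; split=> //; exists w; first exact: l2_ell2.
have E : (fun n => sqnorm (fun i => app x (v (s n)) i - w i))
      = EFin \o (fun n => nsq (X (v' (s n)) - w)).
  by apply/funext => n /=; rewrite -sqnormE -Hv' rx.2.
rewrite E; apply: cvg_EFin; first by apply: nearW.
apply/cvgrPdist_le => eps e0; have [N HN] := Hw _ e0.
exists N => // n /HN /= h; rewrite sub0r normrN ger0_norm //; exact: nsq_ge0.
Qed.

Lemma compact_represents (x : opmx R I) : compact_op x ->
  exists X, represents x X /\ cop X.
Proof.
move=> cx; have [X rx] := bounded_represents cx.1.
by exists X; split=> //; apply/(compact_opP rx).
Qed.

End Compact.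

Section CompactClosure.
Context (R : realType).

Lemma homo_comp (s t : nat -> nat) : {homo s : m n / (m < n)%N} ->
  {homo t : m n / (m < n)%N} -> {homo s \o t : m n / (m < n)%N}.
Proof. by move=> hs ht m n mn; apply/hs/ht. Qed.

Lemma cop_lincomb (I J : choiceType) a (X Y : l2 R I -> l2 R J) : cop X -> cop Y ->
  cop (fun v => a *: X v + Y v).
Proof.
move=> cX cY; split; first exact: bop_lincomb cX.1 cY.1.
move=> v v1; have [s [hs [w Hw]]] := cX.2 v v1.
have [t [ht [w' Hw']]] := cY.2 (v \o s) (fun n => v1 (s n)).
exists (s \o t); split; first exact: homo_comp.
by exists (a *: w + w'); apply: l2limD Hw'; apply: l2limZ; exact: (l2lim_sub ht Hw).
Qed.

Definition contraction (I J : choiceType) (L : l2 R I -> l2 R J) :=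
  bop L /\ forall v, nsq (L v) <= nsq v.

Lemma cop_comp (I J K H : choiceType) (Q : l2 R H -> l2 R I) (X : l2 R I -> l2 R J)
    (P : l2 R J -> l2 R K) : contraction Q -> cop X -> bop P -> cop (P \o X \o Q).
Proof.
move=> [bQ nQ] cX bP; split; first exact: bop_comp bQ (bop_comp cX.1 bP).
move=> v v1; have [s [hs [w Hw]]] := cX.2 (Q \o v) (fun n => le_trans (nQ _) (v1 n)).
by exists s; split=> //; exists (P w); exact: (bop_lim bP Hw).
Qed.

Lemma contraction_adj (I J : choiceType) (L : l2 R I -> l2 R J) :
  contraction L -> contraction (adjop L).
Proof.
move=> [bL nL]; split; first exact: bop_adj.
move=> w; have [->|n0] := eqVneq (nsq (adjop L w)) 0; first exact: nsq_ge0.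
have np : 0 < nsq (adjop L w) by rewrite lt_neqAle eq_sym n0 nsq_ge0.
rewrite -(ler_pM2l np) -expr2 -[leLHS]sqabs_real -ipvv -(adjP bL).
by apply: le_trans (cauchy_schwarz _ _) _; rewrite ler_wpM2r ?nsq_ge0.
Qed.

End CompactClosure.

Section MinMax.
Context (R : realType).

Lemma underdetermined (k : nat) (M : 'I_k.+1 -> 'I_k -> R[i]) :
  exists al : 'I_k.+1 -> R[i], (exists i, al i != 0) /\
    forall j, \sum_i al i * M i j = 0.
Proof.
pose A := \matrix_(i < k.+1, j < k) M i j.
have : kermx A != 0.
  rewrite -mxrank_eq0 mxrank_ker subn_eq0 -ltnNge.
  exact: leq_ltn_trans (rank_leq_col A) _.
case/matrix0Pn => i [j kij]; exists (fun l => kermx A i l); split; first by exists j.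
move=> l; transitivity ((kermx A *m A) i l); last by rewrite mulmx_ker mxE.
by rewrite [RHS]mxE; apply: eq_bigr => m _; rewrite [A m l]mxE.
Qed.

(** Some nonzero combination of e_0, ..., e_k is orthogonal to the k given vectors,
    and Y stretches it by at least t_k. *)
Lemma minmax (I J : choiceType) (Y : l2 R I -> l2 R J) e t k (g : nat -> l2 R I) (c : R) :
  bop Y -> svd Y e t -> 0 <= c ->
  (forall al : nat -> R[i], let w := \sum_(0 <= i < k.+1) al i *: e i in
     (forall j, (j < k)%N -> ip w (g j) = 0) -> nsq (Y w) <= c * nsq w) ->
  t k ^+ 2 <= c.
Proof.
move=> bY Yet c0 H.
have [t0|tn0] := eqVneq (t k) 0; first by rewrite t0 expr0n.
have tp : 0 < t k by rewrite lt_neqAle eq_sym tn0 (svd_ge0 Yet).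
have e1 i : (i <= k)%N -> nsq (e i) = 1.
  move=> ik; case: ((svd_osys Yet).2 i) => // /(svd_eq0' Yet) ti.
  by have := svd_decm Yet ik; rewrite ti leNgt tp.
have [al [[i0 ai0] Hal]] := underdetermined (fun (i : 'I_k.+1) (j : 'I_k) => ip (e i) (g j)).
pose al' n := al (inord n).
have {}H := H al'; set w := \sum_(_ <= _ < _) _ in H.
have wE : w = \sum_(i < k.+1) al i *: e i.
  by rewrite /w big_mkord; apply: eq_bigr => i _; rewrite /al' inord_val.
have nw : nsq w = \sum_(i < k.+1) sqabs (al i).
  rewrite /w (nsq_psum (svd_osys Yet)) ?iota_uniq // big_mkord.
  by apply: eq_bigr => i _; rewrite /al' inord_val e1 ?mulr1 // -ltnS.
have nY : nsq (Y w) = \sum_(i < k.+1) t i ^+ 2 * sqabs (al i).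
  apply: complexI; rewrite -ipvv (adjP bY) wE.
  have bA := bop_comp bY (bop_adj bY).
  rewrite -[adjop Y _]/((adjop Y \o Y) _) (bop_sum bA) ip_sumr rmorph_sum.
  apply: eq_bigr => i _; rewrite (bopZ bA) /= (svd_eig Yet) !ipZr conjc_real.
  have := @ip_psum_in R I nat e (svd_osys Yet) al' (index_iota 0 k.+1) i.
  rewrite iota_uniq mem_index_iota /= ltn_ord => /(_ isT isT).
  rewrite -/w wE => ->; rewrite /al' inord_val e1 1?mulr1; last by rewrite -ltnS.
  by rewrite mulrCA (mulrC _ (al i)) sqabs_conj -rmorphM.
have wp : 0 < nsq w.
  rewrite nw (bigD1 i0) //= ltr_wpDr ?sumr_ge0 // => [i _|].
    exact: sqabs_ge0.
  rewrite lt_neqAle eq_sym sqabs_ge0 andbT; apply: contraNneq ai0 => /sqabs_eq0 ->.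
  by [].
rewrite -(ler_pM2r wp); apply: le_trans (H _).
  rewrite nY nw mulr_sumr; apply: ler_sum => i _; rewrite ler_wpM2r ?sqabs_ge0 //.
  by rewrite ler_pXn2r ?nnegrE ?(svd_ge0 Yet) // (svd_decm Yet) // -ltnS.
move=> j jk; rewrite wE ip_suml -[RHS](Hal (Ordinal jk)); apply: eq_bigr => i _.
by rewrite ipZl.
Qed.

(** By minmax, for the vectors V'e_0, ..., V'e_(k-1): if w is orthogonal to these
    then Vw is orthogonal to the first k singular vectors of X. *)
Lemma svd_compare (I J I' J' : choiceType) (X : l2 R I -> l2 R J) (Y : l2 R I' -> l2 R J')
    e s e' t (V : l2 R I' -> l2 R I) : bop X -> bop Y -> svd X e s -> svd Y e' t ->
  contraction V -> (forall w, nsq (Y w) <= nsq (X (V w))) -> forall k, t k <= s k.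
Proof.
move=> bX bY Xes Yet [bV nV] H k.
suff : t k ^+ 2 <= s k ^+ 2.
  by rewrite ler_pXn2r ?nnegrE ?(svd_ge0 Xes) ?(svd_ge0 Yet).
apply: (minmax (g := fun j => adjop V (e j)) bY Yet); first exact: sqr_ge0.
move=> al w Hw; apply: le_trans (H w) _.
have o j : (j < k)%N -> ip (V w) (e j) = 0 by move=> jk; rewrite (adjP bV) Hw.
apply: le_trans (svd_max Xes o) _.
by rewrite ler_wpM2l ?sqr_ge0.
Qed.

End MinMax.

Section Reindex.
Context (R : realType) (I J : choiceType).

Definition pinj (rho : J -> option I) :=
  forall i j k, rho i = Some k -> rho j = Some k -> i = j.

Definition pullf (rho : J -> option I) (v : I -> R[i]) : J -> R[i] :=
  fun j => if rho j is Some k then v k else 0.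

Lemma pull_sum (rho : J -> option I) (v : l2 R I) s : pinj rho -> uniq s ->
  \sum_(j <- s) sqabs (pullf rho v j) <= nsq v.
Proof.
move=> pr us.
have -> : \sum_(j <- s) sqabs (pullf rho v j) = \sum_(k <- pmap rho s) sqabs (v k).
  elim: s {us} => [|j s IH] /=; first by rewrite !big_nil.
  rewrite big_cons IH /pullf; case: (rho j) => [k|] /=; first by rewrite big_cons.
  by rewrite sqabs0 add0r.
rewrite -lee_fin -sqnormE; apply: esum_seq_ge; last by move=> k; exact: sqabs_ge0.
elim: s us => [|j s IH] //= /andP[js us]; case E : (rho j) => [k|] /=; last exact: IH.
rewrite IH // andbT; apply/negP; rewrite mem_pmap => /mapP[j' j's] /esym Ej'.
by rewrite (pr _ _ _ E Ej') j's in js.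
Qed.

Definition pull (rho : J -> option I) (v : l2 R I) : l2 R J := insubd 0 (pullf rho v).

Lemma pullE rho v j : pinj rho -> pull rho v j = pullf rho v j.
Proof.
move=> pr; rewrite /pull -[LHS]/((val (insubd 0 _)) j) insubdK //.
apply/asboolP; rewrite /ell2 /=; apply: le_lt_trans (ltry (nsq v)).
by apply: esum_seq_le => [i|s us]; [exact: sqabs_ge0|rewrite lee_fin; exact: pull_sum].
Qed.

Lemma contraction_pull rho : pinj rho -> contraction (pull rho).
Proof.
move=> pr; have H v : nsq (pull rho v) <= nsq v.
  rewrite -lee_fin -sqnormE; apply: esum_seq_le => [i|s us]; first exact: sqabs_ge0.
  rewrite lee_fin (_ : \sum_(i <- s) _ = \sum_(j <- s) sqabs (pullf rho v j)); first exact: pull_sum.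
  by apply: eq_bigr => i _; rewrite -/(sqabs _) pullE.
split=> //; split; last by exists 1; split=> // v; rewrite mul1r.
move=> a v w; apply: l2P => j; rewrite l2_addE l2_scaleE !pullE // /pullf.
by case: (rho j) => [k|]; rewrite ?mulr0 ?addr0.
Qed.

(** A submatrix whose rows and columns are renamed, completed by zeros. Extension
    by zero, truncation and interleaving all have this form. *)
Definition reindex_op (rho gam : J -> option I) (x : opmx R I) : opmx R J :=
  fun i j => match rho i, gam j with Some k, Some l => x k l | _, _ => 0 end.

Lemma represents_reindex rho gam x X : pinj rho -> pinj gam -> represents x X ->
  represents (reindex_op rho gam x) (pull rho \o X \o adjop (pull gam)).
Proof.
move=> pr pg rx; have [br _] := contraction_pull pr; have [bg _] := contraction_pull pg.
have b : bop (pull rho \o X \o adjop (pull gam)).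
  by apply: bop_comp; [exact: bop_adj|exact: bop_comp rx.1 br].
rewrite (_ : reindex_op rho gam x = mxof (pull rho \o X \o adjop (pull gam))).
  exact: represents_mxof.
apply/funext => i; apply/funext => j; rewrite /mxof /= pullE // /pullf /reindex_op.
case: (rho i) => [k|] //.
have E l : adjop (pull gam) (delta j) l = if gam j == Some l then 1 else 0.
  rewrite adjopE // ipC ip_delta pullE // /pullf; case: (gam j) => [m|]; last by rewrite conjc0.
  by rewrite deltaE (inj_eq Some_inj); case: eqP => _; rewrite ?conjc1 ?conjc0.
case G : (gam j) => [l|].
  have -> : adjop (pull gam) (delta j) = delta l.
    by apply: l2P => m; rewrite E G deltaE (inj_eq Some_inj) eq_sym.
  by rewrite (represents_eq rx).
have -> : adjop (pull gam) (delta j) = 0 by apply: l2P => m; rewrite E G.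
by rewrite (bop0 rx.1).
Qed.

Lemma compact_reindex rho gam x : pinj rho -> pinj gam -> compact_op x ->
  compact_op (reindex_op rho gam x).
Proof.
move=> pr pg /compact_represents[X [rx cX]].
apply/(compact_opP (represents_reindex pr pg rx)).
apply: cop_comp => //; last exact: (contraction_pull pr).1.
exact/contraction_adj/contraction_pull.
Qed.

Lemma trpsi_reindex rho gam x psi a : pinj rho -> pinj gam -> compact_op x ->
  gauge psi -> 0 < a -> (trpsi psi (reindex_op rho gam x) a <= trpsi psi x a)%E.
Proof.
move=> pr pg cx gp a0; have [X [rx cX]] := compact_represents cx.
have rY := represents_reindex pr pg rx.
have cY : cop (pull rho \o X \o adjop (pull gam)) by apply/(compact_opP rY); exact: compact_reindex.
have [e [s Xes]] := ex_svd cX; have [e' [t Yet]] := ex_svd cY.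
rewrite (trpsiE rx Xes gp a0) (trpsiE rY Yet gp a0).
apply: le_esum => k _; rewrite lee_fin.
have [_ _ pm] := gp; apply: pm; first by rewrite divr_ge0 ?(svd_ge0 Yet) // ltW.
rewrite ler_wpM2r ?invr_ge0 ?(ltW a0) //.
apply: (svd_compare cX.1 cY.1 Xes Yet (contraction_adj (contraction_pull pg))) => w.
exact: (contraction_pull pr).2.
Qed.

End Reindex.

(** * Truncations and blocks *)

Section Truncation.
Context (R : realType) (I : choiceType) (Q : nat -> pred I).
Hypothesis Qex : forall i, exists N, forall n, (N <= n)%N -> Q n i.

Definition keep n : I -> option I := fun i => if Q n i then Some i else None.

Lemma pinj_keep n : pinj (keep n).
Proof. by move=> i j k; rewrite /keep; case: ifP => // _ [->]; case: ifP => // _ [->]. Qed.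

Lemma keepE n (v : l2 R I) i : pull (keep n) v i = if Q n i then v i else 0.
Proof. by rewrite pullE ?/pullf /keep; [case: ifP|exact: pinj_keep]. Qed.

Lemma keep_delta n i : pull (keep n) (delta i) = (if Q n i then delta i else 0 : l2 R I).
Proof.
apply: l2P => j; rewrite keepE deltaE; case: eqP => [->|ji].
  by case: ifP => //; rewrite deltaE eqxx.
by case: ifP; case: ifP; rewrite ?deltaE //; case: eqP.
Qed.

Lemma keep_adj n : adjop (pull (keep n)) = pull (keep n) :> (l2 R I -> l2 R I).
Proof.
have [b _] := contraction_pull R (@pinj_keep n).
apply/funext => v; apply: l2P => i; rewrite adjopE // keep_delta keepE.
by case: ifP; rewrite ?ip_delta ?ip0r.
Qed.

Lemma finite_bound (T : eqType) (s : seq T) (P : nat -> T -> Prop) :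
  (forall x, x \in s -> exists N, forall n, (N <= n)%N -> P n x) ->
  exists N, forall n, (N <= n)%N -> forall x, x \in s -> P n x.
Proof.
elim: s => [|x s IH] H; first by exists 0%N.
have [N HN] := H x (mem_head _ _).
have [M HM] := IH (fun y ys => H y (mem_behead (s := x :: s) ys)).
exists (maxn N M) => n; rewrite geq_max => /andP[Nn Mn] y.
by rewrite inE => /orP[/eqP ->|]; [exact: HN|exact: HM].
Qed.

Lemma keep_cvg (v : l2 R I) : l2lim (fun n => pull (keep n) v) v.
Proof.
move=> eps e0; have e4 : 0 < eps / 4 by rewrite divr_gt0.
have [s [us Hs]] := l2_approx v e4.
have [N HN] := finite_bound (s := s) (fun i _ => Qex i).
exists N => n /HN {}HN; have [b c] := contraction_pull R (@pinj_keep n).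
have E : pull (keep n) (trunc s v) = trunc s v.
  rewrite /trunc (bop_sum b); apply: eq_big_seq => i si.
  by rewrite (bopZ b) keep_delta HN.
have -> : pull (keep n) v - v
    = pull (keep n) (v - trunc s v) + (trunc s v - v).
  by rewrite (bopB b) E addrA subrK.
apply: le_trans (nsqD_le _ _) _; rewrite (nsqBC (trunc s v)).
have := c (v - trunc s v); lra.
Qed.

Definition pcontinuous (psi : R -> R) := forall t, 0 <= t -> forall d, 0 < d ->
  exists2 h, 0 < h & forall u, 0 <= u -> `|t - u| <= h -> `|psi t - psi u| <= d.

(** Each singular value of x is the limit of those of its truncations Y_n. These
    are at most s_k, as truncation is compression; conversely, apply minmax to the
    span of e_0, ..., e_k, on which Y_n tends to X uniformly. Fatou's lemma then
    gives the bound on the sum. *)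
Lemma trpsi_lsc (x : opmx R I) psi a (M : \bar R) : compact_op x -> gauge psi ->
  pcontinuous psi -> 0 < a ->
  (forall n, trpsi psi (reindex_op (keep n) (keep n) x) a <= M)%E ->
  (trpsi psi x a <= M)%E.
Proof.
move=> cx gp cp a0 HM; have [X [rx cX]] := compact_represents cx.
have bX := cX.1; have [C [C0 HC]] := bX.2.
have rY n := represents_reindex (@pinj_keep n) (@pinj_keep n) rx.
have cY n : cop (pull (keep n) \o X \o adjop (pull (keep n))).
  by apply/(compact_opP (rY n)); apply: compact_reindex => //; exact: pinj_keep.
pose Y n := pull (keep n) \o X \o adjop (pull (keep n)).
have [e [s Xes]] := ex_svd cX.
have /choice[et Het] : forall n, exists et, svd (Y n) et.1 et.2.
  by move=> n; have [e' [t Ht]] := ex_svd (cY n); exists (e', t).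
pose t n := (et n).2.
have ts n k : t n k <= s k.
  have cP := contraction_pull R (@pinj_keep n).
  apply: (svd_compare bX (cY n).1 Xes (Het n) (contraction_adj cP)) => w.
  exact: cP.2.
have YX v : l2lim (fun n => Y n v) (X v).
  have L1 : l2lim (fun n => pull (keep n) (X (pull (keep n) v - v))) 0.
    move=> eps e0; have C1 : 0 < C + 1 by rewrite ltr_wpDl.
    have [N HN] := keep_cvg v (divr_gt0 e0 C1).
    exists N => n /HN {}HN; rewrite subr0.
    apply: le_trans ((contraction_pull R (@pinj_keep n)).2 _) _.
    apply: le_trans (HC _) _; apply: (@le_trans _ _ ((C + 1) * (eps / (C + 1)))).
      by apply: ler_pM; rewrite ?nsq_ge0 //; rewrite lerDl.
    by rewrite mulrC divfK ?gt_eqF.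
  have := l2limD L1 (keep_cvg (X v)); rewrite add0r; apply: l2lim_eq => n.
  have [b _] := contraction_pull R (@pinj_keep n).
  by rewrite (bopB bX) (bopB b) subrK /Y /= keep_adj.
have st k (eps : R) : 0 < eps -> exists N, forall n, (N <= n)%N -> s k <= t n k + eps.
  move=> e0; pose d := eps / k.+1%:R.
  have d0 : 0 < d by rewrite divr_gt0 ?ltr0Sn.
  have [N HN] : exists N, forall n, (N <= n)%N -> forall i, i \in index_iota 0 k.+1 ->
      nm (X (e i) - Y n (e i)) <= d.
    apply: finite_bound => i _; have [N HN] := YX (e i) _ (exprn_gt0 2 d0).
    by exists N => n /HN; rewrite nm_le ?(ltW d0) // nsqBC.
  exists N => n /HN {}HN; have tk := svd_ge0 (Het n) k.
  suff : s k ^+ 2 <= (t n k + eps) ^+ 2.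
    by rewrite ler_pXn2r ?nnegrE ?(svd_ge0 Xes) ?addr_ge0 // ltW.
  apply: (minmax (g := (et n).1) bX Xes); first exact: sqr_ge0.
  move=> al w Hw.
  have nw : nsq w = \sum_(0 <= i < k.+1) sqabs (al i) * nsq (e i).
    by rewrite /w (nsq_psum (svd_osys Xes)) ?iota_uniq.
  have bY : bop (Y n) := (cY n).1.
  have H1 : nm (Y n w) <= t n k * nm w.
    rewrite nm_le ?mulr_ge0 ?nm_ge0 // exprMn nmK.
    have := @svd_max _ _ _ _ _ _ (Het n) k w Hw. exact.
  (* each of the k + 1 terms contributes at most d |w| *)
  have H2 : nm (X w - Y n w) <= eps * nm w.
    have -> : X w - Y n w = \sum_(0 <= i < k.+1) al i *: (X (e i) - Y n (e i)).
      rewrite /w (bop_sum bX) (bop_sum bY) -sumrB; apply: eq_bigr => i _.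
      by rewrite (bopZ bX) (bopZ bY) scalerBr.
    apply: (@le_trans _ _ (\sum_(0 <= i < k.+1) d * nm w)); last first.
      rewrite sumr_const_nat subn0 -[leLHS]mulr_natl mulrA.
      by rewrite (_ : _ * d = eps) // /d mulrC divfK // pnatr_eq0.
    have nsum (T : eqType) (r : seq T) (F : T -> l2 R I) (G : T -> R) :
      (forall i, i \in r -> nm (F i) <= G i) -> nm (\sum_(i <- r) F i) <= \sum_(i <- r) G i.
      elim: r => [|i r IH] H; first by rewrite !big_nil nm0.
      rewrite !big_cons; apply: le_trans (nmD _ _) _; apply: lerD.
        by apply: H; rewrite mem_head.
      by apply: IH => j jr; apply: H; rewrite inE jr orbT.
    apply: nsum => i ik; rewrite nmZ mulrC.
    have [ei|ei] := (svd_osys Xes).2 i; last first.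
      by rewrite ei (bop0 bX) (bop0 bY) subrr nm0 mul0r mulr_ge0 ?nm_ge0 ?ltW.
    apply: ler_pM; rewrite ?nm_ge0 ?sqrtr_ge0 ?HN //.
    apply: ler_wsqrtr; rewrite nw (bigD1_seq i) ?iota_uniq //= ei mulr1 lerDl.
    by apply: sumr_ge0 => j _; rewrite mulr_ge0 ?sqabs_ge0 ?nsq_ge0.
  rewrite -[nsq w]nmK -exprMn -nm_le; last by rewrite mulr_ge0 ?nm_ge0 ?addr_ge0 ?(ltW e0).
  rewrite -(subrK (Y n w) (X w)); apply: le_trans (nmD _ _) _.
  by rewrite mulrDl addrC lerD.
have pt k (d : R) : 0 < d -> exists N, forall n, (N <= n)%N ->
    psi (s k / a) <= psi (t n k / a) + d.
  move=> d0; have ska : 0 <= s k / a by rewrite divr_ge0 ?(svd_ge0 Xes) ?ltW.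
  have [h h0 Hh] := cp _ ska _ d0.
  have [N HN] := st k _ (mulr_gt0 h0 a0); exists N => n /HN {}HN.
  have tna : 0 <= t n k / a by rewrite divr_ge0 ?(svd_ge0 (Het n)) ?ltW.
  rewrite -lerBlDl; apply: le_trans (ler_norm _) (Hh _ tna _).
  rewrite -mulrBl normrM [`|a^-1|]ger0_norm ?invr_ge0 ?(ltW a0) // ler_pdivrMr //.
  by rewrite ger0_norm ?subr_ge0 ?ts // lerBlDl.
have [p0 p1 p2] := gp.
have HM' n : (\esum_(k in [set: nat]) (psi (t n k / a))%:E <= M)%E.
  by rewrite -(trpsiE (rY n) (Het n) gp a0).
rewrite (trpsiE rx Xes gp a0); apply: esum_seq_le => [k|ks uks].
  by apply: p1; rewrite divr_ge0 ?(svd_ge0 Xes) ?ltW.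
have tna n k : 0 <= psi (t n k / a) by apply: p1; rewrite divr_ge0 ?(svd_ge0 (Het n)) ?ltW.
case: M HM HM' => [M| |] HM HM'; last 2 first.
- by rewrite leey.
- have := HM' 0%N; rewrite leeNy_eq => /eqP H.
  suff : (0 <= -oo :> \bar R)%E by [].
  by rewrite -H; apply: esum_ge0 => k _; rewrite lee_fin.
rewrite lee_fin; apply/ler_addgt0Pr => eps e0.
pose d := eps / (size ks).+1%:R; have d0 : 0 < d by rewrite divr_gt0 ?ltr0Sn.
have [N HN] := finite_bound (s := ks) (fun k _ => pt k d d0).
apply: (@le_trans _ _ (\sum_(k <- ks) (psi (t N k / a) + d))).
  by rewrite big_seq [leRHS]big_seq; apply: ler_sum => k kk; exact: HN.
rewrite big_split /=; apply: lerD.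
  rewrite -lee_fin; apply: le_trans (HM' N); exact: esum_seq_ge.
rewrite big_const_seq count_predT iter_addr_0 -mulr_natr /d mulrAC ler_pdivrMr ?ltr0Sn //.
by rewrite ler_wpM2l ?(ltW e0) // ler_nat.
Qed.

End Truncation.

Section Toeplitz.
Context (R : realType) (I : choiceType) (pos : I -> int).

Lemma compact_lincomb a (x y : opmx R I) : compact_op x -> compact_op y ->
  compact_op (fun i j => a * x i j + y i j).
Proof.
move=> /compact_represents[X [rx cX]] /compact_represents[Y [ry cY]].
have r : represents (fun i j => a * x i j + y i j) (fun v => a *: X v + Y v).
  rewrite (_ : (fun i j => _) = mxof (fun v => a *: X v + Y v)).
    by apply: represents_mxof; exact: bop_lincomb rx.1 ry.1.
  apply/funext => i; apply/funext => j; rewrite /mxof l2_addE l2_scaleE.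
  by rewrite (represents_eq rx) (represents_eq ry).
by apply/(compact_opP r); exact: cop_lincomb.
Qed.

Lemma compact0 : compact_op (fun _ _ : I => 0 : R[i]).
Proof.
have b : bop (fun _ : l2 R I => 0 : l2 R I).
  split; first by move=> c v w; rewrite -[RHS]/(c *: (0 : l2 R I) + 0) scaler0 addr0.
  by exists 0; split => // v; rewrite nsq0 mul0r.
have r := represents_mxof b.
rewrite (_ : (fun _ _ => 0) = mxof (fun _ : l2 R I => 0 : l2 R I)) //.
apply/(compact_opP r); split=> // v _; exists id; split; first by [].
exists 0; exact: l2lim_cst.
Qed.

(** A finitely supported block matrix is the finite sum of its blocks. *)
Lemma compact_toeplitz phi (x : opmx R I) : finitely_supported pos x ->
  compact_op x -> compact_op (toeplitz_schur pos phi x).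
Proof.
move=> fx cx; pose F := finmap.enum_fset (fset_set [set rc : int * int | exists i j,
    [/\ pos i = rc.1, pos j = rc.2 & x i j != 0]]).
pose blk r : I -> option I := fun i => if pos i == r then Some i else None.
have pblk r : pinj (blk r).
  by move=> i j k; rewrite /blk; case: ifP => // _ [->]; case: ifP => // _ [->].
pose S (G : seq (int * int)) : opmx R I := fun i j =>
  \sum_(rc <- G) phi (rc.1 - rc.2) * reindex_op (blk rc.1) (blk rc.2) x i j.
have cS G : compact_op (S G).
  elim: G => [|rc G IH].
    rewrite (_ : S [::] = fun _ _ => 0); first exact: compact0.
    by apply/funext => i; apply/funext => j; rewrite /S big_nil.
  rewrite (_ : S (rc :: G) = fun i j =>
    phi (rc.1 - rc.2) * reindex_op (blk rc.1) (blk rc.2) x i j + S G i j).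
    by apply: compact_lincomb IH; exact: compact_reindex.
  by apply/funext => i; apply/funext => j; rewrite /S big_cons.
rewrite (_ : toeplitz_schur pos phi x = S F) //.
apply/funext => i; apply/funext => j; rewrite /toeplitz_schur /S.
have B rc : reindex_op (blk rc.1) (blk rc.2) x i j =
    if rc == (pos i, pos j) then x i j else 0.
  case: rc => r c; rewrite /reindex_op /blk /= xpair_eqE (eq_sym r) (eq_sym c).
  by case: eqP; case: eqP.
under eq_bigr do rewrite B.
have [x0|xn0] := eqVneq (x i j) 0.
  by rewrite x0 mulr0 big1 // => rc _; case: ifP; rewrite mulr0.
rewrite (bigD1_seq (pos i, pos j)) /= ?finmap.fset_uniq //; last first.
  by rewrite /F in_fset_set // inE /=; exists i, j.
rewrite eqxx big1 ?addr0 // => rc /negPf ->; by rewrite mulr0.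
Qed.

End Toeplitz.

(** * Transference from block matrices to scalar matrices *)

Section Norm.
Context (R : realType).

(** A common form for the two cases of the definition. *)
Lemma schatten_normE (psi : R -> R) : exists b : R -> \bar R,
  (forall a c : R, a <= c -> (b a <= b c)%E) /\
  forall (I : choiceType) (x : opmx R I), schatten_norm psi x =
    ereal_inf [set a%:E | a in [set a : R | 0 < a /\ (trpsi psi x a <= b a)%E]].
Proof.
case: (pselect (convex_function (`[0, +oo[%classic : set R) psi)) => H.
  by exists (fun=> 1%E); split=> [//|I x]; rewrite /schatten_norm asboolT.
exists EFin; split=> [a c|I x]; first by rewrite lee_fin.
by rewrite /schatten_norm asboolF.
Qed.

Lemma le_schatten_norm (I J : choiceType) psi (x : opmx R I) (y : opmx R J) :
  (forall a, 0 < a -> (trpsi psi y a <= trpsi psi x a)%E) ->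
  (schatten_norm psi y <= schatten_norm psi x)%E.
Proof.
move=> H; have [b [_ bE]] := schatten_normE psi; rewrite !bE.
apply: ereal_inf_le_tmp => _ [a [a0 Ha] <-].
by exists a => //; split=> //; apply: le_trans (H _ a0) Ha.
Qed.

Lemma schatten_norm_ge0 (I : choiceType) psi (x : opmx R I) :
  (0 <= schatten_norm psi x)%E.
Proof.
have [b [_ bE]] := schatten_normE psi; rewrite bE.
by apply: le_ereal_inf_tmp => _ [a [a0 _] <-]; rewrite lee_fin ltW.
Qed.

Lemma trpsi_anti (I : choiceType) psi (x : opmx R I) a b : compact_op x -> gauge psi ->
  0 < a -> a <= b -> (trpsi psi x b <= trpsi psi x a)%E.
Proof.
move=> cx gp a0 ab; have b0 := lt_le_trans a0 ab.
have [X [rx cX]] := compact_represents cx; have [e [s Xes]] := ex_svd cX.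
rewrite (trpsiE rx Xes gp a0) (trpsiE rx Xes gp b0); apply: le_esum => k _.
have [_ _ pm] := gp; rewrite lee_fin; apply: pm.
  by rewrite divr_ge0 ?(svd_ge0 Xes) ?ltW.
by rewrite ler_wpM2l ?(svd_ge0 Xes) // lef_pV2.
Qed.

Lemma schatten_reindex (I J : choiceType) psi (x : opmx R I) (rho gam : J -> option I) :
  pinj rho -> pinj gam -> gauge psi -> schatten psi x ->
  schatten psi (reindex_op rho gam x).
Proof.
move=> pr pg gp [cx [a a0 Ha]]; split; first exact: compact_reindex.
by exists a => //; apply: le_lt_trans Ha; exact: trpsi_reindex.
Qed.

Lemma norm_reindex (I J : choiceType) psi (x : opmx R I) (rho gam : J -> option I) :
  pinj rho -> pinj gam -> gauge psi -> compact_op x ->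
  (schatten_norm psi (reindex_op rho gam x) <= schatten_norm psi x)%E.
Proof. by move=> pr pg gp cx; apply: le_schatten_norm => a a0; exact: trpsi_reindex. Qed.

(** If a > M then every truncation of x has an admissible constant below a. The
    trace bound thus holds at a for all truncations, and it passes to x. *)
Lemma norm_lsc (I : choiceType) (Q : nat -> pred I) psi (x : opmx R I) (M : \bar R) :
  (forall i, exists N, forall n, (N <= n)%N -> Q n i) -> compact_op x -> gauge psi ->
  pcontinuous psi -> (0 <= M)%E ->
  (forall n, schatten_norm psi (reindex_op (keep Q n) (keep Q n) x) <= M)%E ->
  (schatten_norm psi x <= M)%E.
Proof.
move=> Qex cx gp cp M0 HM.
have cn n : compact_op (reindex_op (keep Q n) (keep Q n) x).
  by apply: compact_reindex => //; exact: pinj_keep.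
case: M M0 HM => [M| |] //; last by move=> *; rewrite leey.
rewrite lee_fin => M0 HM; apply/lee_addgt0Pr => eps e0.
rewrite -EFinD; set a := M + eps.
have a0 : 0 < a by rewrite /a ltr_wpDl.
have Ma : (M%:E < a%:E)%E by rewrite lte_fin /a ltrDl.
have [b [b_nd bE]] := schatten_normE psi.
rewrite bE; apply: ereal_inf_lbound; exists a; last exact: erefl.
split; first exact: a0.
apply: (trpsi_lsc Qex cx gp cp a0) => n.
move: (HM n); rewrite bE => /le_lt_trans /(_ Ma) /ereal_inf_lt[_ [c [c0 Hc] <-]].
rewrite lte_fin => /ltW ca; apply: le_trans (trpsi_anti (cn n) gp c0 ca) _.
exact: le_trans Hc (b_nd _ _ ca).
Qed.

Lemma toeplitz_reindex (I J : choiceType) (pI : I -> int) (pJ : J -> int) (phi : int -> R[i])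
    (rho gam : J -> option I) (x : opmx R I) :
  (forall i j k l, rho i = Some k -> gam j = Some l ->
     phi (pJ i - pJ j) = phi (pI k - pI l)) ->
  toeplitz_schur pJ phi (reindex_op rho gam x) = reindex_op rho gam (toeplitz_schur pI phi x).
Proof.
move=> H; apply/funext => i; apply/funext => j; rewrite /toeplitz_schur /reindex_op.
case Er : (rho i) => [k|]; last by rewrite mulr0.
by case Eg : (gam j) => [l|]; [rewrite (H _ _ _ _ Er Eg)|rewrite mulr0].
Qed.

Lemma gaugeP psi : (forall t : R, 0 <= t -> 0 <= psi t) ->
  (forall s t : R, 0 <= s -> s <= t -> psi s <= psi t) ->
  (forall t : R, 0 <= t -> (psi t = 0 <-> t = 0)) -> gauge psi.
Proof. by move=> p0 pm pz; split => //; apply/pz. Qed.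

Lemma pcontinuousP (psi : R -> R) : {within `[0, +oo[, continuous psi} -> pcontinuous psi.
Proof.
move=> /subspace_continuousP H t t0 d d0.
have tI : (`[0, +oo[%classic : set R) t by rewrite /= in_itv /= t0.
have /cvgrPdist_le/(_ d d0) := H t tI.
rewrite /within /= => /nbhs_ballP[h h0 Hh].
exists (h / 2); first exact: divr_gt0.
move=> u u0 tu; apply: Hh; last by rewrite in_itv /= u0.
by apply: le_lt_trans tu _; rewrite ltr_pdivrMr // ltr_pMr // ltr1n.
Qed.

Section Interleave.
Variable n : nat.
Local Notation d := ((2 * n.+1)%N%:Z).

(** Inside the r-th interval of length 2(n+1) of the integers, the columns
    (j, r) with j <= n come before the rows (i, r) with i <= n. *)
Definition row_enc (p : nat * int) : option int :=
  if (p.1 <= n)%N then Some (p.2 * d + n.+1%:Z + p.1%:Z) else None.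
Definition col_enc (p : nat * int) : option int :=
  if (p.1 <= n)%N then Some (p.2 * d + p.1%:Z) else None.
Definition row_dec (m : int) : option (nat * int) :=
  if n.+1%:Z <= (m %% d)%Z then Some (`|(m %% d)%Z - n.+1%:Z|%N, (m %/ d)%Z) else None.
Definition col_dec (m : int) : option (nat * int) :=
  if (m %% d)%Z < n.+1%:Z then Some (`|(m %% d)%Z|%N, (m %/ d)%Z) else None.

Lemma row_decP m p : row_dec m = Some p ->
  (p.1 <= n)%N /\ m = p.2 * d + n.+1%:Z + p.1%:Z.
Proof.
rewrite /row_dec; case: ifP => // h [<-] /=.
have h1 := divz_eq m d; have h2 : (m %% d)%Z < d by apply: ltz_pmod.
move: h h1 h2; move: (m %% d)%Z (m %/ d)%Z => u v; lia.
Qed.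

Lemma col_decP m p : col_dec m = Some p ->
  (p.1 <= n)%N /\ m = p.2 * d + p.1%:Z.
Proof.
rewrite /col_dec; case: ifP => // h [<-] /=.
have h1 := divz_eq m d; have h2 : 0 <= (m %% d)%Z by apply: modz_ge0.
move: h h1 h2; move: (m %% d)%Z (m %/ d)%Z => u v; lia.
Qed.

Lemma divmod_enc (r : int) (k : nat) : (k < 2 * n.+1)%N ->
  ((r * d + k%:Z) %% d)%Z = k%:Z /\ ((r * d + k%:Z) %/ d)%Z = r.
Proof.
move=> kd; rewrite modzMDl divzMDl // modz_small ?divz_small ?addr0 //; lia.
Qed.

Lemma row_encK p : (p.1 <= n)%N ->
  row_dec (p.2 * d + n.+1%:Z + p.1%:Z) = Some p.
Proof.
case: p => i r /= ni; rewrite /row_dec -addrA -PoszD.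
have [-> ->] := @divmod_enc r (n.+1 + i)%N ltac:(lia).
rewrite ifT; last by lia.
by congr (Some (_, _)); lia.
Qed.

Lemma col_encK p : (p.1 <= n)%N -> col_dec (p.2 * d + p.1%:Z) = Some p.
Proof.
case: p => i r /= ni; rewrite /col_dec.
have [-> ->] := @divmod_enc r i ltac:(lia).
rewrite ifT; last by lia.
by congr (Some (_, _)); lia.
Qed.

Lemma pinj_row_dec : pinj row_dec.
Proof. by move=> i j k /row_decP[_ ->] /row_decP[_ ->]. Qed.
Lemma pinj_col_dec : pinj col_dec.
Proof. by move=> i j k /col_decP[_ ->] /col_decP[_ ->]. Qed.

Lemma pinj_row_enc : pinj row_enc.
Proof.
move=> p q k; rewrite /row_enc; case: ifP => // hp [<-]; case: ifP => // hq [/esym E].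
by apply: Some_inj; rewrite -(row_encK hp) E row_encK.
Qed.
Lemma pinj_col_enc : pinj col_enc.
Proof.
move=> p q k; rewrite /col_enc; case: ifP => // hp [<-]; case: ifP => // hq [/esym E].
by apply: Some_inj; rewrite -(col_encK hp) E col_encK.
Qed.

(** The row i of the block row r comes after the column j of the block column c
    exactly when r >= c. *)
Lemma sign_interleave m1 m2 p q : row_dec m1 = Some p -> col_dec m2 = Some q ->
  (0 <= m1 - m2) = (0 <= p.2 - q.2).
Proof.
move=> /row_decP[h1 ->] /col_decP[h2 ->]; move: h1 h2.
case: p q => i r [j c] /= h1 h2; apply/idP/idP => h.
  suff : -1 < r - c by lia.
  rewrite ltNge; apply/negP => rc; nia.
nia.
Qed.

Lemma reindex_enc_dec (x : opmx R (nat * int)%type) :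
  reindex_op row_enc col_enc (reindex_op row_dec col_dec x) =
  reindex_op (keep (fun n p => (p.1 <= n)%N) n) (keep (fun n p => (p.1 <= n)%N) n) x.
Proof.
apply/funext => p; apply/funext => q; rewrite /reindex_op /row_enc /col_enc /keep.
case: ifP => // hp; case: ifP => // hq.
by rewrite row_encK // col_encK.
Qed.

Lemma finite_interleave (x : opmx R (nat * int)%type) :
  finitely_supported (fun p : nat * int => p.2) x ->
  finitely_supported (fun r : int => r) (reindex_op row_dec col_dec x).
Proof.
move=> fx; pose f (z : (int * int) * (nat * nat)) : int * int :=
  (z.1.1 * d + n.+1%:Z + z.2.1%:Z, z.1.2 * d + z.2.2%:Z).
rewrite /finitely_supported in fx *.
set F := (X in finite_set X) in fx.
apply: (@sub_finite_set _ _ (f @` (F `*` (`I_n.+1 `*` `I_n.+1)))).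
  move=> [r c] [i [j /= [<- <-]]]; rewrite /reindex_op.
  case Er : (row_dec i) => [p|]; last by rewrite eqxx.
  case Ec : (col_dec j) => [q|]; last by rewrite eqxx.
  move=> xpq; have [hp ->] := row_decP Er; have [hq ->] := col_decP Ec.
  exists ((p.2, q.2), (p.1, q.1)) => //=; do !split => //.
  by exists p, q.
apply: finite_image; apply: finite_setX => //; apply: finite_setX; exact: finite_II.
Qed.

End Interleave.

(** Scalar matrices are the block matrices supported on one basis vector of l^2,
    which gives one inequality. For the other one, the truncation of x to n + 1
    rows and columns in every block is interleaved into a scalar matrix; by
    sign_interleave the multiplier acts on it in the same way. *)
Lemma norm_SS_eq (psi : R -> R) (phi : int -> R[i]) : gauge psi -> pcontinuous psi ->
  (forall k l : int, (0 <= k) = (0 <= l) -> phi k = phi l) ->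
  norm_SS psi phi = norm_S psi phi.
Proof.
move=> gp cp hphi; rewrite /norm_SS /norm_S /schur_norm; congr ereal_inf.
apply/seteqP; split => C /= [C0 HC]; split=> // x fx sx.
  pose rho (p : nat * int) := if p.1 == 0%N then Some p.2 else None.
  pose sig (r : int) := Some (0%N, r).
  have prho : pinj rho.
    move=> [i r] [j c] k; rewrite /rho /=; case: eqP => // -> [->].
    by case: eqP => // -> [->].
  have psig : pinj sig by move=> i j k [<-] [].
  pose x' := reindex_op rho rho x.
  have fx' : finitely_supported (fun p : nat * int => p.2) x'.
    apply: sub_finite_set fx => rc [[i r] [[j c] /= [<- <-]]].
    rewrite /x' /reindex_op /rho /=; case: (i =P 0%N) => _; case: (j =P 0%N) => _; rewrite ?eqxx //.
    by move=> ?; exists r, c.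
  have sx' : schatten psi x' by exact: schatten_reindex.
  have Tx' := compact_toeplitz phi fx' sx'.1.
  have -> : toeplitz_schur (fun r : int => r) phi x =
      reindex_op sig sig (toeplitz_schur (fun p : nat * int => p.2) phi x') by [].
  apply: le_trans (norm_reindex psig psig gp Tx') _.
  apply: le_trans (HC x' fx' sx') _; apply: lee_wpmul2l => //.
  by apply: norm_reindex => //; case: sx.
have cTx := compact_toeplitz phi fx sx.1.
apply: (@norm_lsc _ (fun n p => (p.1 <= n)%N)) => //.
- by move=> p; exists p.1.
- by rewrite mule_ge0 ?schatten_norm_ge0.
move=> n.
have pr := @pinj_row_dec n; have pc := @pinj_col_dec n.
pose xn := reindex_op (row_dec n) (col_dec n) x.
have fxn : finitely_supported (fun r : int => r) xn by exact: finite_interleave.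
have sxn : schatten psi xn by exact: schatten_reindex.
have Txn := compact_toeplitz phi fxn sxn.1.
rewrite -reindex_enc_dec -(toeplitz_reindex (pJ := fun r : int => r)); last first.
  by move=> i j k l hk hl; apply: hphi; exact: sign_interleave hk hl.
apply: le_trans (norm_reindex (@pinj_row_enc n) (@pinj_col_enc n) gp Txn) _.
apply: le_trans (HC xn fxn sxn) _; apply: lee_wpmul2l => //.
by apply: norm_reindex => //; case: sx.
Qed.

End Norm.

(** * Schatten norms of finite matrices *)

Section SchattenPower.
Context (R : realType) (n : nat).
Local Notation C := R[i].
Local Notation M := 'M[C]_n.+1.
Implicit Types (A B X Y : M).

Definition hc A : M := (map_mx conjc A)^T.

Lemma hcE A i j : hc A i j = conjc (A j i). Proof. by rewrite !mxE. Qed.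

Lemma hcK A : hc (hc A) = A.
Proof. by apply/matrixP => i j; rewrite !hcE conjcK. Qed.

Lemma hcD A B : hc (A + B) = hc A + hc B.
Proof. by apply/matrixP => i j; rewrite hcE [RHS]mxE !hcE mxE raddfD. Qed.

Lemma hcZ a A : hc (a *: A) = conjc a *: hc A.
Proof. by apply/matrixP => i j; rewrite hcE [RHS]mxE !hcE mxE rmorphM. Qed.

Lemma hcN A : hc (- A) = - hc A.
Proof. by apply/matrixP => i j; rewrite hcE [RHS]mxE !hcE mxE raddfN. Qed.

Lemma hcB A B : hc (A - B) = hc A - hc B.
Proof. by rewrite hcD hcN. Qed.

Lemma hcM A B : hc (A * B) = hc B * hc A.
Proof. by rewrite /hc -[A * B]/(A *m B) map_mxM trmx_mul. Qed.

Lemma hc1 : hc 1 = 1.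
Proof. by apply/matrixP => i j; rewrite hcE !mxE eq_sym; case: eqP; rewrite ?conjc1 ?conjc0. Qed.

Lemma hcX A k : hc (A ^+ k) = hc A ^+ k.
Proof. by elim: k => [|k IH]; rewrite ?expr0 ?hc1 // exprS hcM IH -exprSr. Qed.

Lemma tr_hc A : \tr (hc A) = conjc (\tr A).
Proof. by rewrite /mxtrace rmorph_sum; apply: eq_bigr => i _; rewrite hcE. Qed.

Lemma trC A B : \tr (A * B) = \tr (B * A). Proof. exact: mxtrace_mulC. Qed.

Definition rtr A : R := complex.Re (\tr A).

Lemma rtrC A B : rtr (A * B) = rtr (B * A). Proof. by rewrite /rtr trC. Qed.
Lemma rtrD A B : rtr (A + B) = rtr A + rtr B. Proof. by rewrite /rtr mxtraceD raddfD. Qed.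
Lemma rtrN A : rtr (- A) = - rtr A. Proof. by rewrite /rtr raddfN raddfN. Qed.
Lemma rtrB A B : rtr (A - B) = rtr A - rtr B. Proof. by rewrite rtrD rtrN. Qed.
Lemma rtr_hc A : rtr (hc A) = rtr A.
Proof. by rewrite /rtr tr_hc; case: (\tr A). Qed.
Lemma rtrZ (a : R) A : rtr (a%:C%C *: A) = a * rtr A.
Proof. by rewrite /rtr mxtraceZ Re_mulc /= mul0r subr0. Qed.

(** The square of the Hilbert-Schmidt norm. *)
Definition hs A : R := rtr (hc A * A).

Lemma hsE A : hs A = \sum_i \sum_j sqabs (A i j).
Proof.
rewrite /hs /rtr /mxtrace raddf_sum exchange_big /=; apply: eq_bigr => i _.
rewrite mxE raddf_sum; apply: eq_bigr => j _.
by rewrite hcE mulrC sqabs_conj.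
Qed.

Lemma hs_ge0 A : 0 <= hs A.
Proof. by rewrite hsE sumr_ge0 // => i _; rewrite sumr_ge0 // => j _; exact: sqabs_ge0. Qed.

Lemma hsD A B : hs (A + B) = hs A + hs B + 2 * rtr (hc A * B).
Proof.
rewrite /hs hcD mulrDl !mulrDr !rtrD.
rewrite -(rtr_hc (hc B * A)) hcM hcK; ring.
Qed.

Lemma hsZ a A : hs (a *: A) = sqabs a * hs A.
Proof.
rewrite !hsE mulr_sumr; apply: eq_bigr => i _; rewrite mulr_sumr.
by apply: eq_bigr => j _; rewrite mxE sqabsM.
Qed.

Definition nc (z : C) : R := Num.sqrt (sqabs z).

Lemma nc_ge0 z : 0 <= nc z. Proof. exact: sqrtr_ge0. Qed.
Lemma ncK z : nc z ^+ 2 = sqabs z. Proof. by rewrite sqr_sqrtr ?sqabs_ge0. Qed.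
Lemma nc_real (a : R) : nc a%:C%C = `|a|. Proof. by rewrite /nc sqabs_real sqrtr_sqr. Qed.
Lemma Re_le_nc z : complex.Re z <= nc z.
Proof.
apply: le_trans (ler_norm _) _; rewrite -[leRHS]ger0_norm ?nc_ge0 // -ler_sqr ?nnegrE //.
by rewrite !real_normK ?num_real // ncK lerDl sqr_ge0.
Qed.
Lemma nc_le z c : 0 <= c -> (nc z <= c) = (sqabs z <= c ^+ 2).
Proof. by move=> c0; rewrite -ncK ler_pXn2r ?nnegrE ?nc_ge0. Qed.

(** [ns k] is the norm of S^p for p = 2^(k+1). *)
Fixpoint ns k A : R :=
  if k is k'.+1 then Num.sqrt (ns k' (hc A * A)) else Num.sqrt (hs A).

Lemma ns_ge0 k A : 0 <= ns k A.
Proof. by case: k => [|k]; exact: sqrtr_ge0. Qed.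

Lemma ns0K A : ns 0 A ^+ 2 = hs A. Proof. by rewrite /= sqr_sqrtr ?hs_ge0. Qed.

Lemma nsS k A : ns k.+1 A ^+ 2 = ns k (hc A * A).
Proof. by rewrite /= sqr_sqrtr ?ns_ge0. Qed.

Lemma ns_pow k A : ns k A ^+ (2 ^ k.+1) = rtr ((hc A * A) ^+ (2 ^ k)).
Proof.
elim: k A => [|k IH] A; first by rewrite expr1 expn1 ns0K.
rewrite expnS exprM nsS IH hcM hcK -expr2 -exprM expnS.
by [].
Qed.

Lemma expn2_gt0 k : (0 < 2 ^ k)%N. Proof. by rewrite expn_gt0. Qed.

Lemma ns_le_pow k A c : 0 <= c -> (ns k A <= c) = (ns k A ^+ (2 ^ k.+1) <= c ^+ (2 ^ k.+1)).
Proof. by move=> c0; rewrite ler_pXn2r ?nnegrE ?ns_ge0 ?expn2_gt0. Qed.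

Lemma tr_expC A B m : \tr ((A * B) ^+ m) = \tr ((B * A) ^+ m).
Proof.
case: m => [|m]; first by rewrite !expr0.
have E : A * (B * A) ^+ m = (A * B) ^+ m * A.
  elim: m => [|m IH]; first by rewrite !expr0 mulr1 mul1r.
  by rewrite exprS [A * _]mulrA [A * (B * A)]mulrA -mulrA IH mulrA -exprS.
by rewrite exprSr mulrA -E trC mulrA -exprS.
Qed.

End SchattenPower.

Section Hoelder.
Context (R : realType) (n : nat).
Local Notation C := R[i].
Local Notation M := 'M[C]_n.+1.
Implicit Types (A B X Y : M).

Lemma hs_eq0 A : hs A = 0 -> A = 0.
Proof.
rewrite hsE => h; apply/matrixP => i j; rewrite mxE; apply: sqabs_eq0.
have h0 a b : 0 <= sqabs (A a b) by exact: sqabs_ge0.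
move/eqP: h; rewrite psumr_eq0 => [/allP /(_ i)|a _]; last by rewrite sumr_ge0.
rewrite mem_index_enum => /(_ isT) /=; rewrite psumr_eq0 // => /allP /(_ j).
by rewrite mem_index_enum => /(_ isT) /= /eqP.
Qed.

Lemma hs_hc A : hs (hc A) = hs A.
Proof. by rewrite /hs hcK rtrC. Qed.

Lemma hs_cauchy_schwarz A B : sqabs (\tr (A * B)) <= hs A * hs B.
Proof.
have [h0|hn0] := eqVneq (hs B) 0.
  by rewrite (hs_eq0 h0) mulr0 mxtrace0 sqabs0 /hs mulr0 /rtr mxtrace0 mulr0.
have hp : 0 < hs B by rewrite lt_neqAle eq_sym hn0 hs_ge0.
set t := \tr (A * B).
have := hs_ge0 ((hs B)%:C%C *: hc A + (- conjc t) *: B).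
have E : hc ((hs B)%:C%C *: hc A) * ((- conjc t) *: B)
    = (hs B)%:C%C *: ((- conjc t) *: (A * B)).
  by rewrite hcZ hcK conjc_real -scalerAl -scalerAr.
have Et : rtr ((- conjc t) *: (A * B)) = - sqabs t.
  by rewrite /rtr mxtraceZ -/t mulNr mulrC sqabs_conj raddfN.
rewrite hsD !hsZ sqabs_real hs_hc E rtrZ Et => h.
have {}h : 0 <= hs B ^+ 2 * hs A + sqabs t * hs B + 2 * (hs B * - sqabs t).
  by move: h; rewrite {1}/sqabs !raddfN !sqrrN -/(sqabs (conjc t)) sqabsJ.
have {h}: 0 <= hs B * (hs A * hs B - sqabs t) by nra.
by rewrite pmulr_rge0 // subr_ge0.
Qed.

Lemma ns_hc k A : ns k (hc A) = ns k A.
Proof.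
apply/eqP; rewrite -(eqrXn2 (expn2_gt0 k.+1)) ?ns_ge0 // !ns_pow hcK.
by rewrite /rtr tr_expC.
Qed.

Lemma prod_pairs (T : nzRingType) (F : nat -> T) m :
  \prod_(0 <= i < (2 * m)%N) F i = \prod_(0 <= i < m) (F (2 * i)%N * F (2 * i).+1).
Proof.
elim: m => [|m IH]; first by rewrite muln0 !big_nil.
by rewrite mulnS add2n !big_nat_recr //= IH mulrA.
Qed.

(** This form of Hoelder's inequality passes from p = 2^(k+1) to 2p by grouping
    the factors in pairs. *)
Definition trace_hoelder k := forall F : nat -> M,
  nc (\tr (\prod_(0 <= i < (2 ^ k.+1)%N) F i)) <= \prod_(0 <= i < (2 ^ k.+1)%N) ns k (F i).

Lemma trace_hoelder0 : trace_hoelder 0.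
Proof.
have E (T : nzRingType) (G : nat -> T) : \prod_(0 <= i < 2) G i = G 0%N * G 1%N.
  by rewrite 2?big_nat_recr //= big_geq // mul1r.
move=> F; rewrite expn1 !E.
rewrite nc_le; last by apply: mulr_ge0; exact: ns_ge0.
by rewrite exprMn !ns0K hs_cauchy_schwarz.
Qed.

(** The p-th power of |AB|_p is the trace of the alternating product of A'A and
    BB', whose S^p norms are the squares of |A|_2p and |B|_2p. *)
Lemma hoelder_of_trace k A B : trace_hoelder k ->
  ns k (A * B) <= ns k.+1 A * ns k.+1 B.
Proof.
move=> H; rewrite ns_le_pow ?mulr_ge0 ?ns_ge0 // ns_pow.
pose P := hc A * A; pose Q := B * hc B.
pose F i := if odd i then Q else P.
have F0 i : F (2 * i)%N = P by rewrite /F mul2n odd_double.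
have F1 i : F (2 * i).+1 = Q by rewrite /F /= mul2n odd_double.
have -> : rtr ((hc (A * B) * (A * B)) ^+ (2 ^ k)) = rtr (\prod_(0 <= i < (2 ^ k.+1)%N) F i).
  rewrite expnS prod_pairs; under eq_bigr do rewrite F0 F1.
  have E1 : hc (A * B) * (A * B) = hc B * (P * B) by rewrite hcM /P !mulrA.
  have E2 : P * B * hc B = P * Q by rewrite /Q mulrA.
  by rewrite big_const_nat subn0 iter_mulr_1 /rtr E1 (tr_expC (hc B) (P * B)) E2.
apply: le_trans (Re_le_nc _) _; apply: le_trans (H F) _.
rewrite expnS prod_pairs; under eq_bigr do rewrite F0 F1.
rewrite big_const_nat subn0 iter_mulr_1 exprM [(_ * ns k.+1 B) ^+ 2]exprMn nsS -/P.
by rewrite -(ns_hc k.+1 B) nsS hcK.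
Qed.

Lemma trace_hoelderP k : trace_hoelder k.
Proof.
elim: k => [|k IH]; first exact: trace_hoelder0.
move=> F; rewrite expnS prod_pairs prod_pairs; apply: le_trans (IH _) _.
apply: ler_prod => i _; rewrite ns_ge0 /=; exact: hoelder_of_trace.
Qed.

Lemma ns_mul k A B : ns k (A * B) <= ns k.+1 A * ns k.+1 B.
Proof. exact/hoelder_of_trace/trace_hoelderP. Qed.

Lemma ns_duality k X Y :
  rtr (hc Y * X * (hc X * X) ^+ (2 ^ k).-1) <= ns k Y * ns k X ^+ (2 ^ k.+1).-1.
Proof.
pose F i := if i is 0%N then hc Y else if odd i then X else hc X.
have E m : hc Y * X * (hc X * X) ^+ m = \prod_(0 <= i < (2 * m.+1)%N) F i.
  have F0 i : F (2 * i.+1)%N = hc X by rewrite mulnS add2n /= mul2n odd_double.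
  have F1 i : F (2 * i.+1).+1 = X by rewrite mulnS add2n /= mul2n odd_double.
  rewrite prod_pairs big_nat_recl //; congr (_ * _).
  under eq_bigr do rewrite F0 F1.
  by rewrite big_const_nat subn0 iter_mulr_1.
have -> : (2 ^ k.+1)%N = (2 * (2 ^ k).-1.+1)%N by rewrite prednK ?expn2_gt0 // expnS.
rewrite E; apply: le_trans (Re_le_nc _) _.
have -> : (2 * (2 ^ k).-1.+1)%N = (2 ^ k.+1)%N by rewrite prednK ?expn2_gt0 // expnS.
apply: le_trans (trace_hoelderP k F) _.
rewrite -{1}(prednK (expn2_gt0 k.+1)) big_nat_recl // ns_hc ler_wpM2l ?ns_ge0 //.
rewrite (eq_bigr (fun=> ns k X)); last by move=> i _ /=; case: ifP; rewrite ?ns_hc.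
by rewrite big_const_nat subn0 iter_mulr_1.
Qed.

(** The trace that defines the p-th power of |X| is linear in its first factor
    X' = A' + B', and ns_duality bounds both parts. *)
Lemma ns_triangle k A B : ns k (A + B) <= ns k A + ns k B.
Proof.
set X := A + B; have [->|n0] := eqVneq (ns k X) 0.
  by rewrite addr_ge0 ?ns_ge0.
have np : 0 < ns k X by rewrite lt_neqAle eq_sym n0 ns_ge0.
rewrite -(@ler_pM2r _ (ns k X ^+ (2 ^ k.+1).-1)) ?exprn_gt0 //.
rewrite -exprS prednK ?expn2_gt0 // ns_pow -[X in _ ^+ X](prednK (expn2_gt0 k)) exprS.
set P := (hc X * X) ^+ _.
have -> : hc X * X * P = hc A * X * P + hc B * X * P by rewrite -!mulrDl -hcD.
by rewrite rtrD [leRHS]mulrDl; apply: lerD; [exact: (ns_duality k X A)|exact: (ns_duality k X B)].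
Qed.

Lemma nsZ k a A : ns k (a *: A) = nc a * ns k A.
Proof.
elim: k a A => [|k IH] a A /=; first by rewrite hsZ sqrtrM ?sqabs_ge0.
rewrite hcZ -scalerAl -scalerAr scalerA mulrC sqabs_conj IH nc_real.
rewrite ger0_norm ?sqabs_ge0 // sqrtrM ?sqabs_ge0 //.
Qed.

Lemma nsN k A : ns k (- A) = ns k A.
Proof. by rewrite -scaleN1r nsZ -(rmorphN1 (real_complex R)) nc_real normrN1 mul1r. Qed.

Lemma ns_triangleB k A B : ns k (A - B) <= ns k A + ns k B.
Proof. by rewrite -(nsN k B) ns_triangle. Qed.

Lemma ns_expr k j A : ns k (A ^+ (2 ^ j)) <= ns (k + j) A ^+ (2 ^ j).
Proof.
elim: j k => [|j IH] k; first by rewrite addn0 !expr1.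
rewrite expnS mulnC !exprM expr2; apply: le_trans (ns_mul _ _ _) _.
by rewrite addnS -addSn -expr2 ler_pXn2r ?nnegrE ?exprn_ge0 ?ns_ge0.
Qed.

End Hoelder.

(** * Upper bounds for triangular truncation *)

Section Triangular.
Context (R : realType) (n : nat).
Local Notation C := R[i].
Local Notation M := 'M[C]_n.+1.
Implicit Types (A B X Y Z P Q : M).

(** The diagonal goes with the lower part, as in the convention sgn 0 = 1. *)
Definition rproj X : M := \matrix_(i, j) if (j <= i)%N then X i j else 0.
Definition htrans X : M := \matrix_(i, j) if (j <= i)%N then X i j else - X i j.

Definition low A := forall i j : 'I_n.+1, (i < j)%N -> A i j = 0.
Definition slow A := forall i j : 'I_n.+1, (i <= j)%N -> A i j = 0.

Lemma low_rproj X : low (rproj X).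
Proof. by move=> i j ij; rewrite mxE leqNgt ij. Qed.

Lemma slow_rest X : slow (hc (X - rproj X)).
Proof.
move=> i j ij; rewrite hcE !mxE ij subrr conjc0 //.
Qed.

Lemma slowM A B : low A -> slow B -> slow (A * B).
Proof.
move=> lA sB i j ij; rewrite mxE big1 // => k _.
have [ki|ik] := leqP k i; first by rewrite sB ?mulr0 // (leq_trans ki).
by rewrite lA // mul0r.
Qed.

Lemma slow_low A : slow A -> low A.
Proof. by move=> sA i j /ltnW; exact: sA. Qed.

Lemma slow_tr A : slow A -> rtr A = 0.
Proof. by move=> sA; rewrite /rtr /mxtrace big1 // => i _; exact: sA. Qed.

Lemma htransE X : htrans X = rproj X - (X - rproj X).
Proof.
apply/matrixP => i j; rewrite !mxE; case: ifP => _; first by rewrite subrr subr0.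
by rewrite subr0 sub0r.
Qed.

Lemma htrans_slow Z : slow Z -> htrans (Z - hc Z) = Z + hc Z.
Proof.
move=> sZ; apply/matrixP => i j; rewrite mxE [(Z - _) i j]mxE [(- hc Z) i j]mxE.
rewrite [(Z + _) i j]mxE !hcE; case: ltngtP => ij.
- by rewrite (sZ j i) ?(ltnW ij) // conjc0 subr0 addr0.
- by rewrite (sZ i j) ?(ltnW ij) // sub0r opprK add0r.
- by rewrite (sZ i j) ?ij // (sZ j i) ?ij // conjc0 subr0 addr0.
Qed.

Lemma htransZ a X : htrans (a *: X) = a *: htrans X.
Proof. by apply/matrixP => i j; rewrite !mxE; case: ifP; rewrite ?mulrN. Qed.

(** Write X = a + b with a = rproj X, so that HX = a - b. Both (HX)(HX)' and XX'
    contain aa' + bb', and (HX)X' - X(HX)' = 2(ab' - ba'), whereas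
    XX' - (HX)(HX)' = 2(ab' + ba'). As ab' is strictly lower triangular, H maps
    ab' - ba' to ab' + ba'. *)
Lemma cotlar X : let H := htrans X in
  H * hc H = X * hc X - htrans (H * hc X - X * hc H).
Proof.
move=> H; pose a := rproj X; pose b := X - a; pose Z := a * hc b.
have Xab : X = a + b by rewrite /b addrC subrK.
have Hab : H = a - b by rewrite /H htransE.
have sZ : slow Z by apply: slowM; [exact: low_rproj|exact: slow_rest].
have hZ : hc Z = b * hc a by rewrite /Z hcM hcK.
clearbody b.
have E : H * hc X - X * hc H = (2%:R : C) *: (Z - hc Z).
  rewrite hZ Hab Xab (hcD a b) (hcB a b) !mulrDl !mulrDr !mulNr !mulrN /Z scaler_nat mulr2n.
  move: (a * hc a) (a * hc b) (b * hc a) (b * hc b) => p q r s.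
  by apply/matrixP => i j; rewrite !mxE; ring.
rewrite E htransZ htrans_slow // hZ Hab Xab (hcD a b) (hcB a b) !mulrDl !mulrDr !mulNr !mulrN.
rewrite /Z scaler_nat mulr2n.
move: (a * hc a) (a * hc b) (b * hc a) (b * hc b) => p q r s.
by apply/matrixP => i j; rewrite !mxE; ring.
Qed.

Lemma hs_htrans X : hs (htrans X) = hs X.
Proof.
rewrite !hsE; apply: eq_bigr => i _; apply: eq_bigr => j _; rewrite mxE.
by case: ifP => // _; rewrite /sqabs !raddfN !sqrrN.
Qed.

Lemma nsS_r k A : ns k.+1 A ^+ 2 = ns k (A * hc A).
Proof. by rewrite -(ns_hc k.+1) nsS hcK. Qed.

(** For h = |HX| and x = |X|, Cotlar's identity gives h^2 <= x^2 + 2 c h x, and c'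
    is the positive root of the corresponding quadratic equation. *)
Lemma htrans_double k (c c' : R) : 0 <= c -> 0 < c' -> c' ^+ 2 = 1 + 2 * c * c' ->
  (forall X, ns k (htrans X) <= c * ns k X) ->
  forall X, ns k.+1 (htrans X) <= c' * ns k.+1 X.
Proof.
move=> c0 c'0 cc H X; set h := ns k.+1 (htrans X); set x := ns k.+1 X.
have h0 : 0 <= h by exact: ns_ge0.
have x0 : 0 <= x by exact: ns_ge0.
have : h ^+ 2 <= x ^+ 2 + c * (h * x + x * h).
  rewrite /h nsS_r cotlar; apply: le_trans (ns_triangleB _ _ _) _.
  rewrite /x nsS_r lerD2l; apply: le_trans (H _) _; apply: ler_wpM2l => //.
  apply: le_trans (ns_triangleB _ _ _) _; apply: lerD.
    by have := ns_mul k (htrans X) (hc X); rewrite ns_hc.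
  by have := ns_mul k X (hc (htrans X)); rewrite ns_hc.
move=> h1; rewrite leNgt; apply/negP => h2.
have hp : 0 < h by apply: le_lt_trans h2; rewrite mulr_ge0 // ltW.
have : 0 < (h - c' * x) * (c' * h + x).
  by rewrite mulr_gt0 ?subr_gt0 // ltr_pwDl ?mulr_gt0.
have -> : (h - c' * x) * (c' * h + x) = c' * (h ^+ 2 - x ^+ 2) + h * x * (1 - c' ^+ 2).
  by ring.
have -> : c' * (h ^+ 2 - x ^+ 2) + h * x * (1 - c' ^+ 2)
    = c' * (h ^+ 2 - (x ^+ 2 + c * (h * x + x * h))) by rewrite cc; ring.
by rewrite pmulr_rgt0 // subr_gt0 ltNge h1.
Qed.

Lemma ns_four A : ns 1 A ^+ (2 ^ 2) = rtr (hc A * A * (hc A * A)).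
Proof. by rewrite (ns_pow 1 A). Qed.

Lemma hsB A B : hs (A - B) = hs A + hs B - 2 * rtr (hc A * B).
Proof.
by rewrite hsD mulrN rtrN mulrN -scaleN1r hsZ -(rmorphN1 (real_complex R))
  sqabs_real sqrrN expr1n mul1r.
Qed.

Lemma hs_herm_part P Q : hc Q = Q -> hs (P + hc P - Q) =
  2 * rtr (P * P) + 2 * hs P - 4 * rtr (P * Q) + rtr (Q * Q).
Proof.
move=> hQ; have E : hc (P + hc P) * Q = hc P * Q + P * Q by rewrite hcD hcK mulrDl.
rewrite hsB E hsD hs_hc rtrD.
have -> : rtr (hc P * hc P) = rtr (P * P) by rewrite -hcM rtr_hc.
have -> : rtr (hc P * Q) = rtr (P * Q) by rewrite -(rtr_hc (hc P * Q)) hcM hcK hQ rtrC.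
have -> : hs Q = rtr (Q * Q) by rewrite /hs hQ.
ring.
Qed.

Lemma hs_herm_comb A B : hc A = A -> hc B = B ->
  hs (2%:R *: A - B) = 4 * rtr (A * A) - 4 * rtr (A * B) + rtr (B * B).
Proof.
move=> hA hB; rewrite hsB (_ : (2%:R : C) = 2%:R%:C%C); last by rewrite rmorph_nat.
have E : hc (2%:R%:C%C *: A) * B = 2%:R%:C%C *: (A * B).
  by rewrite hcZ conjc_real hA scalerAl.
rewrite E rtrZ hsZ sqabs_real /hs hA hB; ring.
Qed.

Lemma rtr_sq_slow P Q : slow (P - Q) ->
  rtr (P * P) - 2 * rtr (P * Q) + rtr (Q * Q) = 0.
Proof.
move=> sZ; have := slow_tr (slowM (slow_low sZ) sZ).
have -> : (P - Q) * (P - Q) = P * P - P * Q - (Q * P - Q * Q).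
  by rewrite mulrBl !mulrBr.
rewrite !rtrB (rtrC Q P); lra.
Qed.

Lemma sos_real (u v w y z : R) : u - 2 * v + w = 0 ->
  0 <= 2 * u + 2 * z - 4 * v + w -> 0 <= 4 * y - 4 * z + w -> w <= 4 * y.
Proof. lra. Qed.

(** A sum of squares. Let a = rproj x and b = x - a, and write y' for the
    adjoint of y. The trace of (ab')(ab') vanishes since ab' is strictly lower
    triangular, and, in Hilbert-Schmidt norm,
    4 |xx'|^2 - |aa'|^2 + 4 Re tr (ab')(ab')
      = 2 |ax' + xa' - aa'|^2 + |2x'x - a'a|^2. *)
Lemma rproj_four X : ns 1 (rproj X) <= Num.sqrt 2 * ns 1 X.
Proof.
rewrite ns_le_pow ?mulr_ge0 ?sqrtr_ge0 ?ns_ge0 // exprMn.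
have -> : Num.sqrt 2 ^+ (2 ^ 2) = 4 :> R.
  by rewrite (_ : (2 ^ 2)%N = (2 * 2)%N) // exprM sqr_sqrtr // expr2; ring.
rewrite (ns_four (rproj X)) (ns_four X).
pose a := rproj X; pose P := a * hc X; pose Q := a * hc a.
pose A' := hc a * a; pose X' := hc X * X.
have hP : hc P = X * hc a by rewrite hcM hcK.
have hQ : hc Q = Q by rewrite hcM hcK.
have hA : hc A' = A' by rewrite hcM hcK.
have hX : hc X' = X' by rewrite hcM hcK.
have sZ : slow (P - Q).
  rewrite (_ : P - Q = a * hc (X - a)); last by rewrite hcB mulrBr.
  by apply: slowM; [exact: low_rproj|exact: slow_rest].
have PhP : hs P = rtr (X' * A').
  by rewrite (rtrC X' A') /hs hP /P /A' /X' -mulrA rtrC !mulrA.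
have EA : rtr (A' * A') = rtr (Q * Q).
  by rewrite /rtr -(expr2 A') -(expr2 Q) (tr_expC (hc a) a).
have h1 := rtr_sq_slow sZ; have h2 := hs_ge0 (P + hc P - Q).
have h3 := hs_ge0 (2%:R *: X' - A').
rewrite (hs_herm_part P hQ) PhP -EA in h2; rewrite (hs_herm_comb hX hA) in h3.
rewrite -EA in h1; exact: sos_real h1 h2 h3.
Qed.

End Triangular.

(** * Power series square roots and Toeplitz matrices *)

Section Convolution.
Context (R : realType).
Implicit Types a b c : nat -> R.

(** The Cauchy product of power series. *)
Definition cprod a b m : R := \sum_(0 <= i < m.+1) a i * b (m - i)%N.
Definition kron0 : nat -> R := fun m => (m == 0%N)%:R.

Lemma sum_cprod a b N : \sum_(0 <= m < N) cprod a b m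
  = \sum_(0 <= i < N) a i * \sum_(0 <= l < (N - i)%N) b l.
Proof.
elim: N => [|N IH]; first by rewrite !big_nil.
rewrite big_nat_recr //= IH /cprod.
have -> : \sum_(0 <= i < N) a i * \sum_(0 <= l < (N - i)%N) b l =
    \sum_(0 <= i < N.+1) a i * \sum_(0 <= l < (N - i)%N) b l.
  by rewrite [RHS]big_nat_recr //= subnn [in RHS]big_nil mulr0 addr0.
rewrite -big_split /= !big_nat; apply: eq_bigr => i /andP[_ iN].
by rewrite -mulrDr subSn // [in RHS]big_nat_recr.
Qed.

(** For such a power series a, the matrix 1 - a(S) is accretive (tz_accretive). *)
Definition submarkov a := [/\ a 0%N = 0, forall m, 0 <= a m &
  forall N, \sum_(0 <= m < N) a m <= 1].

Section SquareRoot.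
Variable a : nat -> R.
Hypothesis sa : submarkov a.

(** The first m coefficients of the power series b with 1 - a = (1 - b)^2, that is
    2 b = a + b^2. As b_0 = 0, each coefficient of b^2 involves earlier
    coefficients of b only. *)
Fixpoint sqrt_prefix m : seq R := if m is m'.+1 then
  let s := sqrt_prefix m' in
  rcons s ((a m' + \sum_(1 <= i < m') nth 0 s i * nth 0 s (m' - i)%N) / 2)
  else [::].

Definition sqrt_coef m := nth 0 (sqrt_prefix m.+1) m.

Lemma size_sqrt_prefix m : size (sqrt_prefix m) = m.
Proof. by elim: m => //= m IH; rewrite size_rcons IH. Qed.

Lemma nth_sqrt_prefix m i : (i < m)%N -> nth 0 (sqrt_prefix m) i = sqrt_coef i.
Proof.
elim: m => // m IH; rewrite ltnS leq_eqVlt => /orP[/eqP -> //|im].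
by rewrite /= nth_rcons size_sqrt_prefix im IH.
Qed.

Lemma sqrt_coefE m : sqrt_coef m =
  (a m + \sum_(1 <= i < m) sqrt_coef i * sqrt_coef (m - i)%N) / 2.
Proof.
rewrite {1}/sqrt_coef /= nth_rcons size_sqrt_prefix ltnn eqxx.
congr ((_ + _) / _); rewrite !big_nat; apply: eq_bigr => i /andP[i0 im].
by rewrite !nth_sqrt_prefix // ltn_subrL i0 (leq_trans _ im).
Qed.

Lemma sqrt_coef_ge0 m : 0 <= sqrt_coef m.
Proof.
have [_ a0 _] := sa.
elim/ltn_ind: m => m IH; rewrite sqrt_coefE divr_ge0 // addr_ge0 //.
rewrite big_nat sumr_ge0 // => i /andP[i0 im].
by rewrite mulr_ge0 ?IH // ltn_subrL i0 (leq_trans _ im).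
Qed.

Lemma sqrt_coef0 : sqrt_coef 0 = 0.
Proof. by have [a0 _ _] := sa; rewrite sqrt_coefE big_nil a0 addr0 mul0r. Qed.

Lemma cprod_sqrt_coef m :
  cprod sqrt_coef sqrt_coef m = \sum_(1 <= i < m) sqrt_coef i * sqrt_coef (m - i)%N.
Proof.
case: m => [|m]; first by rewrite /cprod big_nat1 sqrt_coef0 mul0r big_geq.
rewrite /cprod big_nat_recl // sqrt_coef0 mul0r add0r big_nat_recr //= subnn.
by rewrite sqrt_coef0 mulr0 addr0 [RHS]big_add1.
Qed.

Lemma sqrt_coef_eq m : 2 * sqrt_coef m = a m + cprod sqrt_coef sqrt_coef m.
Proof. by rewrite cprod_sqrt_coef {1}sqrt_coefE mulrC divfK // pnatr_eq0. Qed.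

(** Sum the coefficients of 2 b = a + b^2 up to N. As b_0 = 0, those of b^2 sum to
    at most the square of the sum of the first N coefficients of b, which is at
    most 1 by induction. *)
Lemma sqrt_submarkov : submarkov sqrt_coef.
Proof.
split; [exact: sqrt_coef0|exact: sqrt_coef_ge0|].
have s0 N : 0 <= \sum_(0 <= m < N) sqrt_coef m.
  by apply: sumr_ge0 => i _; exact: sqrt_coef_ge0.
elim=> [|N IH]; first by rewrite big_nil.
have IH' := IH; have : 2 * \sum_(0 <= m < N.+1) sqrt_coef m =
    \sum_(0 <= m < N.+1) a m + \sum_(0 <= m < N.+1) cprod sqrt_coef sqrt_coef m.
  by rewrite mulr_sumr -big_split; apply: eq_bigr => m _; exact: sqrt_coef_eq.
rewrite sum_cprod [X in _ = _ + X]big_nat_recr //= subSnn big_nat1 sqrt_coef0 mulr0 addr0.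
have [_ _ /(_ N.+1) a1] := sa.
suff H : \sum_(0 <= i < N) sqrt_coef i * \sum_(0 <= l < (N.+1 - i)%N) sqrt_coef l <= 1.
  by move=> E; lra.
apply: le_trans IH; rewrite !big_nat; apply: ler_sum => -[|i] /andP[_ iN].
  by rewrite sqrt_coef0 mul0r.
rewrite -[leRHS]mulr1 ler_wpM2l ?sqrt_coef_ge0 //.
apply: le_trans IH'; rewrite subSS (@big_cat_nat _ _ _ (N - i)%N 0 N) ?leq_subr //= lerDl.
by apply: sumr_ge0 => l _; exact: sqrt_coef_ge0.
Qed.

End SquareRoot.

(** The power series 1 - a. *)
Definition rest a : nat -> R := fun m => kron0 m - a m.

Lemma cprod_rest_sqrt a m : submarkov a ->
  cprod (rest (sqrt_coef a)) (rest (sqrt_coef a)) m = rest a m.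
Proof.
move=> sa; set s := sqrt_coef a.
have d0 (f : nat -> R) : \sum_(0 <= i < m.+1) kron0 i * f i = f 0%N.
  rewrite big_nat_recl // {1}/kron0 eqxx mul1r big1 ?addr0 // => i _.
  by rewrite /kron0 /= mul0r.
have dm : \sum_(0 <= i < m.+1) s i * kron0 (m - i)%N = s m.
  rewrite big_nat_recr //= subnn /kron0 eqxx mulr1 big_nat big1 ?add0r // => i /andP[_ im].
  by rewrite subn_eq0 leqNgt im mulr0.
have -> : cprod (rest s) (rest s) m =
   \sum_(0 <= i < m.+1) kron0 i * (kron0 (m - i)%N - s (m - i)%N)
   - \sum_(0 <= i < m.+1) s i * kron0 (m - i)%N + cprod s s m.
  rewrite /cprod -sumrB -big_split /=; apply: eq_bigr => i _; rewrite /rest; ring.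
rewrite d0 dm subn0 /rest; have := sqrt_coef_eq sa m; rewrite -/s; lra.
Qed.

(** Coefficients of 1 - (1 - z)^(1/2^k). *)
Fixpoint acoef k : nat -> R := if k is k'.+1 then sqrt_coef (acoef k')
  else fun m => (m == 1%N)%:R.

Lemma acoef_submarkov k : submarkov (acoef k).
Proof.
elim: k => [|k IH]; last exact: sqrt_submarkov.
split=> // N.
case: N => [|[|N]]; rewrite ?big_nil ?big_nat1 //.
rewrite big_nat_recl // big_nat_recl // big1 ?addr0 /= ?add0r //.
Qed.

End Convolution.

Section LowerToeplitz.
Context (R : realType) (n : nat).
Local Notation M := 'M[R[i]]_n.+1.
Implicit Types a b c : nat -> R.

(** The lower triangular Toeplitz matrix a(S), for the nilpotent shift S. *)
Definition tz a : M := \matrix_(i, j) if (j <= i)%N then (a (i - j)%N)%:C%C else 0.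

Lemma tzM a b : tz a * tz b = tz (cprod a b).
Proof.
apply/matrixP => i j; rewrite !mxE.
pose F (k : nat) : R[i] := (if (k <= i)%N then (a (i - k)%N)%:C%C else 0)
   * (if (j <= k)%N then (b (k - j)%N)%:C%C else 0).
rewrite (eq_bigr (fun k : 'I_n.+1 => F k)); last by move=> k _; rewrite !mxE.
rewrite -(big_mkord xpredT F).
have iN : (i.+1 <= n.+1)%N by exact: ltn_ord.
rewrite (big_cat_nat _ iN) //= [X in _ + X]big_nat [X in _ + X]big1 ?addr0; last first.
  by move=> k /andP[ik _]; rewrite /F leqNgt ik /= mul0r.
case: leqP => [ji|ij]; last first.
  rewrite big_nat big1 // => k /andP[_]; rewrite ltnS => ki.
  by rewrite /F [(j <= k)%N]leqNgt (leq_ltn_trans ki ij) mulr0.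
rewrite (big_cat_nat (n := j)) //=; last exact: leq_trans ji _.
rewrite [X in X + _]big_nat [X in X + _]big1 ?add0r; last first.
  by move=> k /andP[_ kj]; rewrite /F [(j <= k)%N]leqNgt kj mulr0.
rewrite /cprod rmorph_sum /=.
rewrite -{1}[nat_of_ord j]add0n big_addn subSn // big_nat_rev /= add0n.
rewrite !big_nat; apply: eq_bigr => k /andP[_]; rewrite ltnS => kij.
rewrite /F subSS rmorphM.
have h1 : (i - j - k + j <= i)%N by lia.
rewrite h1 leq_addl addnK; congr (_ * _); congr (a _)%:C%C; lia.
Qed.

Lemma tz1 : tz (@kron0 R) = 1.
Proof.
apply/matrixP => i j; rewrite !mxE; case: leqP => [ji|ij]; last first.
  by rewrite (_ : i == j = false) //; apply/negbTE; rewrite -(inj_eq val_inj) ltn_eqF.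
rewrite /kron0 subn_eq0; case: eqP => [->|ij]; first by rewrite leqnn.
rewrite leqNgt (_ : (j < i)%N) //= ltn_neqAle ji andbT.
by apply/eqP => /val_inj /esym.
Qed.

Lemma eq_tz a b : a =1 b -> tz a = tz b.
Proof. by move=> ab; apply/matrixP => i j; rewrite !mxE ab. Qed.

End LowerToeplitz.

(** * Hermitian forms *)

Section Forms.
Context (R : realType) (n : nat).
Local Notation C := R[i].
Local Notation M := 'M[C]_n.+1.
Local Notation V := 'cV[C]_n.+1.
Implicit Types (A B E U Y : M) (u v w : V).

Definition dt u w : C := \sum_i conjc (u i 0) * w i 0.

Lemma dtDl u v w : dt (u + v) w = dt u w + dt v w.
Proof. by rewrite /dt -big_split; apply: eq_bigr => i _; rewrite mxE rmorphD mulrDl. Qed.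
Lemma dtDr u v w : dt u (v + w) = dt u v + dt u w.
Proof. by rewrite /dt -big_split; apply: eq_bigr => i _; rewrite mxE mulrDr. Qed.
Lemma dtZl a u w : dt (a *: u) w = conjc a * dt u w.
Proof. by rewrite /dt mulr_sumr; apply: eq_bigr => i _; rewrite mxE rmorphM mulrA. Qed.
Lemma dtZr a u w : dt u (a *: w) = a * dt u w.
Proof. by rewrite /dt mulr_sumr; apply: eq_bigr => i _; rewrite mxE mulrCA. Qed.
Lemma dtNr u w : dt u (- w) = - dt u w.
Proof. by rewrite -scaleN1r dtZr mulN1r. Qed.
Lemma dtC u w : dt w u = conjc (dt u w).
Proof.
rewrite /dt rmorph_sum; apply: eq_bigr => i _.
by rewrite rmorphM /= conjcK mulrC.
Qed.
Lemma dtvv w : dt w w = (\sum_i sqabs (w i 0))%:C%C.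
Proof. by rewrite /dt rmorph_sum; apply: eq_bigr => i _; rewrite mulrC sqabs_conj. Qed.

Lemma dt_adj A u w : dt (A *m u) w = dt u (hc A *m w).
Proof.
rewrite /dt.
transitivity (\sum_i \sum_j conjc (A i j * u j 0) * w i 0).
  by apply: eq_bigr => i _; rewrite mxE rmorph_sum mulr_suml.
rewrite exchange_big; apply: eq_bigr => j _; rewrite mxE mulr_sumr.
by apply: eq_bigr => i _; rewrite hcE rmorphM [RHS]mulrCA mulrA.
Qed.

Definition unitv (i : 'I_n.+1) : V := delta_mx i 0.

Lemma dt_unitv A i : dt (unitv i) (A *m unitv i) = A i i.
Proof.
have E j : (unitv i) j 0 = (j == i)%:R by rewrite mxE eqxx andbT.
rewrite /dt (bigD1 i) //= big1 ?addr0 => [|j ji]; last by rewrite E (negPf ji) conjc0 mul0r.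
rewrite E eqxx conjc1 mul1r mxE (bigD1 i) //= big1 ?addr0 => [|j ji].
  by rewrite E eqxx mulr1.
by rewrite E (negPf ji) mulr0.
Qed.

Definition diagr (lam : 'I_n.+1 -> R) : M := \matrix_(i, j) if i == j then (lam i)%:C%C else 0.

Lemma diagrM lam mu : diagr lam * diagr mu = diagr (fun i => lam i * mu i).
Proof.
apply/matrixP => i j; rewrite !mxE (bigD1 i) //= big1 ?addr0 => [|k ki]; rewrite !mxE.
  by rewrite eqxx; case: eqP => _; rewrite ?mulr0 // rmorphM.
by rewrite eq_sym (negPf ki) mul0r.
Qed.

Lemma diagrX lam m : diagr lam ^+ m = diagr (fun i => lam i ^+ m).
Proof.
elim: m => [|m IH].
  by apply/matrixP => i j; rewrite !mxE; case: eqP => // _; rewrite expr0.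
by rewrite exprS IH diagrM; apply/matrixP => i j; rewrite !mxE exprS.
Qed.

Lemma rtr_diagr lam : rtr (diagr lam) = \sum_i lam i.
Proof. by rewrite /rtr /mxtrace raddf_sum; apply: eq_bigr => i _; rewrite mxE eqxx. Qed.

Lemma spectral_hermitian A : hc A = A -> exists U lam,
  [/\ hc U * U = 1, U * hc U = 1 & A = hc U * diagr lam * U].
Proof.
move=> hA; have tE (B : M) : hc B = map_mx Num.conj B^T.
  by apply/matrixP => i j; rewrite !mxE.
have nA : A \is normalmx by apply/normalmxP; rewrite -!tE hA.
have := orthomx_spectralP nA; set U := spectralmx A; set D := spectral_diag A => AE.
have UU : U * hc U = 1.
  by have /unitarymxP := spectral_unitarymx A; rewrite -tE.
have UU' : hc U * U = 1 by apply: mulmx1C.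
have iU : invmx U = hc U by rewrite invmx_unitary ?spectral_unitarymx // -tE.
have DE : diag_mx D = U * A * hc U.
  rewrite {1}AE iU -[hc U *m _ *m U]/(hc U * diag_mx D * U).
  by rewrite !mulrA UU mul1r -mulrA UU mulr1.
have hD : hc (diag_mx D) = diag_mx D by rewrite DE !hcM hcK hA mulrA.
exists U, (fun i => complex.Re (D 0 i)); split; [exact: UU'|exact: UU|].
rewrite {1}AE iU; congr (_ * _ * _); apply/matrixP => i j.
rewrite !mxE; case: (i =P j) => _; rewrite ?mulr1n ?mulr0n //.
have := congr1 (fun B : M => B i i) hD; rewrite hcE !mxE eqxx mulr1n.
by case: (D 0 i) => a b [] b0; apply: complexP => //=; lra.
Qed.

Lemma negative_eigenvector A v : hc A = A -> complex.Re (dt v (A *m v)) < 0 ->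
  exists w (lam : R), [/\ lam < 0, A *m w = lam%:C%C *: w & dt w w = 1].
Proof.
move=> hA neg; have [U [lam [UU UU' AE]]] := spectral_hermitian hA.
have [[i li]|H] := pselect (exists i, lam i < 0); last first.
  move: neg; rewrite ltNge => /negP[].
  have -> : dt v (A *m v) = dt (U *m v) (diagr lam *m (U *m v)).
    by rewrite dt_adj AE !mulmxA.
  move: (U *m v) => z; rewrite /dt raddf_sum; apply: sumr_ge0 => i _.
  rewrite mxE (bigD1 i) //= big1 ?addr0 => [|j ji]; rewrite mxE; last first.
    by rewrite eq_sym (negPf ji) mul0r.
  rewrite eqxx mulrCA (mulrC (conjc _)) sqabs_conj -rmorphM /=.
  by rewrite mulr_ge0 ?sqabs_ge0 // leNgt; apply/negP => li; apply: H; exists i.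
exists (hc U *m unitv i), (lam i); split; first exact: li.
  rewrite AE -[hc U * _ * U]/(hc U *m diagr lam *m U) -!mulmxA (mulmxA U).
  rewrite -[U *m hc U]/(U * hc U) UU' mul1mx scalemxAr; congr (_ *m _).
  apply/matrixP => j k; rewrite !mxE (bigD1 j) //= big1 ?addr0 => [|l lj]; rewrite !mxE.
    by rewrite eqxx; case: eqP => [->|] //=; rewrite ?mulr0.
  by rewrite eq_sym (negPf lj) mul0r.
rewrite dt_adj hcK mulmxA -[U *m hc U]/(U * hc U) UU' dt_unitv mxE eqxx //.
Qed.

(** If E is accretive and w^2 E^2 has nonnegative imaginary part, then w E is
    accretive: on an eigenvector of Re (wE) for a negative eigenvalue, the first
    condition forces Im (wE) <= 0 and this contradicts Re E >= 0. *)
Lemma lyapunov E (co si : R) (om := Complex co si : C) : 0 < co -> 0 <= si ->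
  (forall w, 0 <= complex.Re (dt w (E *m w))) ->
  (forall w, 0 <= complex.Im (om ^+ 2 * dt w ((E * E) *m w))) ->
  forall w, 0 <= complex.Re (om * dt w (E *m w)).
Proof.
move=> co0 si0 H1 H2 v; rewrite leNgt; apply/negP => neg.
pose D := om *: E.
have hD : hc (D + hc D) = D + hc D by rewrite hcD hcK addrC.
have negv : complex.Re (dt v ((D + hc D) *m v)) < 0.
  rewrite mulmxDl dtDr -dt_adj (dtC v) -scalemxAl dtZr raddfD /=.
  by move: neg; case: (om * _) => a b /=; lra.
have [w [lam [l0 Dw w1]]] := negative_eigenvector hD negv.
pose y := dt w (E *m w).
have z1 : dt w (D *m w) = om * y by rewrite /D -scalemxAl dtZr.
have hw : hc D *m w = lam%:C%C *: w - D *m w by rewrite -Dw mulmxDl addrC addKr.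
have re2 : 2 * complex.Re (om * y) = lam.
  have : dt w ((D + hc D) *m w) = lam%:C%C by rewrite Dw dtZr w1 mulr1.
  rewrite mulmxDl dtDr -dt_adj (dtC w) z1 => /(congr1 (@complex.Re R)) /= <-.
  by case: (om * y) => a b /=; ring.
have im2 : complex.Im (om ^+ 2 * dt w ((E * E) *m w)) = lam * complex.Im (om * y).
  have -> : om ^+ 2 * dt w ((E * E) *m w) = dt w (D *m (D *m w)).
    rewrite /D -!scalemxAl -scalemxAr scalerA dtZr -expr2 mulmxA.
    by [].
  rewrite -[D in D *m (_)]hcK -dt_adj hw dtDl dtZl conjc_real z1.
  rewrite -scaleN1r dtZl dtvv -(rmorphN1 (real_complex R)) conjc_real.
  by move: (\sum_i _) => S; case: (om * y) => a b /=; ring.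
have := H2 w; rewrite im2 => h2; have h1 := H1 w; rewrite -/y in h1.
move: re2 h2 h1; rewrite /om; case: y {z1 im2} => a b /= re2 h2 h1.
have {}h2 : co * b + si * a <= 0 by rewrite -(nmulr_rge0 _ l0).
have h3 : co * (co * a - si * b) < 0 by rewrite pmulr_rlt0 //; lra.
have h4 : si * (co * b + si * a) <= 0 by rewrite mulr_ge0_le0.
have h5 : 0 <= (co ^+ 2 + si ^+ 2) * a by rewrite mulr_ge0 ?addr_ge0 ?sqr_ge0.
have : (co ^+ 2 + si ^+ 2) * a = co * (co * a - si * b) + si * (co * b + si * a) by ring.
lra.
Qed.

(** The diagonal of Y^2 dominates the squares of the diagonal of Y. *)
Lemma diag_pow Y i j : hc Y = Y ->
  complex.Re (Y i i) ^+ (2 ^ j) <= complex.Re ((Y ^+ (2 ^ j)) i i).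
Proof.
elim: j Y => [|j IH] Y hY; first by rewrite !expr1.
rewrite expnS !exprM; apply: le_trans (IH (Y ^+ 2) _); last by rewrite hcX hY.
have H : complex.Re (Y i i) ^+ 2 <= complex.Re ((Y ^+ 2) i i).
  rewrite expr2 [(Y * Y) i i]mxE raddf_sum (bigD1 i) //= .
  have E k : complex.Re (Y i k * Y k i) = sqabs (Y i k).
    by rewrite -{2}hY hcE sqabs_conj.
  rewrite E; apply: (@le_trans _ _ (sqabs (Y i i))); first by rewrite /sqabs lerDl sqr_ge0.
  by rewrite lerDl sumr_ge0 // => k _; rewrite E sqabs_ge0.
by rewrite ler_pXn2r ?nnegrE ?sqr_ge0 ?expn2_gt0 // (le_trans _ H) ?sqr_ge0.
Qed.

Lemma conj_pow U A m : hc U * U = 1 -> U * hc U = 1 ->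
  (hc U * A * U) ^+ m = hc U * A ^+ m * U.
Proof.
move=> UU UU'; elim: m => [|m IH]; first by rewrite !expr0 mulr1 UU.
by rewrite exprS IH !mulrA -(mulrA _ U) UU' mulr1 -(mulrA (hc U)) -exprS.
Qed.

(** The exponent 2^(k+1) is even. *)
Lemma ns_herm_pow k A : hc A = A -> ns k A ^+ (2 ^ k.+1) = rtr (A ^+ (2 ^ k.+1)).
Proof. by move=> hA; rewrite ns_pow hA -expr2 -exprM -expnS. Qed.

(** Comparison of quadratic forms gives comparison of norms: compare on an
    eigenbasis of the smaller operator. *)
Lemma ns_mono k A B (t : R) : hc A = A -> hc B = B -> 0 <= t ->
  (forall w, `|complex.Re (dt w (A *m w))| <= t * complex.Re (dt w (B *m w))) ->
  ns k A <= t * ns k B.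
Proof.
move=> hA hB t0 H; rewrite ns_le_pow ?mulr_ge0 ?ns_ge0 // exprMn !ns_herm_pow //.
have [U [lam [UU UU' AE]]] := spectral_hermitian hA.
pose Y := U * B * hc U.
have hY : hc Y = Y by rewrite /Y !hcM hcK hB mulrA.
have lY i : `|lam i| <= t * complex.Re (Y i i).
  have dY (X : M) : dt (hc U *m unitv i) (X *m (hc U *m unitv i)) = (U * X * hc U) i i.
    by rewrite dt_adj hcK !mulmxA -[U *m X *m hc U]/(U * X * hc U) dt_unitv.
  have := H (hc U *m unitv i); rewrite !dY -/Y AE !mulrA UU' mul1r -mulrA UU' mulr1.
  by rewrite mxE eqxx.
have -> : rtr (A ^+ (2 ^ k.+1)) = \sum_i lam i ^+ (2 ^ k.+1).
  by rewrite AE conj_pow // -mulrA rtrC -mulrA UU' mulr1 diagrX rtr_diagr.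
have -> : rtr (B ^+ (2 ^ k.+1)) = rtr (Y ^+ (2 ^ k.+1)).
  have E := @conj_pow (hc U) B (2 ^ k.+1); rewrite hcK in E.
  by rewrite /Y E // -mulrA rtrC -mulrA UU mulr1.
rewrite /rtr /mxtrace raddf_sum mulr_sumr; apply: ler_sum => i _.
apply: le_trans (ler_wpM2l (exprn_ge0 _ t0) (diag_pow i k.+1 hY)).
rewrite -exprMn expnS !exprM -[lam i ^+ 2]real_normK ?num_real // -!exprM -expnS.
by rewrite ler_pXn2r ?nnegrE ?expn2_gt0 // (le_trans _ (lY i)).
Qed.

End Forms.

(** * Sectorial roots of the shift *)

Section SquareSums.
Context (R : realType).

(** If b were square summable then b * b would tend to 0. *)
Lemma sq_unbounded (b : nat -> R) : (forall m, cprod b b m = 1) ->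
  forall K, exists N, K < \sum_(0 <= m < N) b m ^+ 2.
Proof.
move=> bb K; apply: contrapT => H.
pose S N := \sum_(0 <= m < N) b m ^+ 2.
have SK N : S N <= K by rewrite leNgt; apply/negP => h; apply: H; exists N.
have ndS : {homo S : m n / (m <= n)%N >-> m <= n}.
  move=> m n mn; rewrite /S (big_cat_nat _ mn) //= lerDl sumr_ge0 // => i _.
  exact: sqr_ge0.
have cS : cvg (S @ \oo).
  by apply: nondecreasing_is_cvgn => //; exists K => _ [n _ <-]; exact: SK.
have K0 : 0 <= K by apply: le_trans (SK 0%N); rewrite /S big_nil.
pose d := (4 * (K + 1))^-1; have d0 : 0 < d by rewrite invr_gt0 mulr_gt0 // ltr_wpDl.
have dK : d * K <= 1 / 4.
  by rewrite /d mulrC ler_pdivrMr ?mulr_gt0 ?ltr_wpDl //; lra.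
clearbody d; have d8 : 0 < d / 8 by rewrite divr_gt0.
have /cvgrPdist_le /(_ (d / 8) d8) [N _ HN] := cS.
have tail : S (N + N).+1 - S N <= d / 4.
  have := HN N (leqnn _); have := HN (N + N).+1 _ => /(_ (leqW (leq_addr _ _))).
  by rewrite !ler_norml => /andP[h1 h2] /andP[h3 h4]; lra.
(* each half of the sum for (b * b)(2N) pairs coefficients of b with its tail
from N on, and is at most 1/4 by the weighted mean inequality *)
have := bb (N + N)%N; rewrite /cprod.
have N1 : (N <= (N + N).+1)%N by exact: leqW (leq_addr _ _).
rewrite (big_cat_nat _ N1) //=.
have amgm (x y : R) : x * y <= (d * x ^+ 2 + d^-1 * y ^+ 2) / 2.
  have : 0 <= d^-1 * (d * x - y) ^+ 2 by rewrite mulr_ge0 ?sqr_ge0 ?invr_ge0 ?ltW.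
  have -> : d^-1 * (d * x - y) ^+ 2 = d * x ^+ 2 - 2 * (x * y) + d^-1 * y ^+ 2.
    by field; rewrite gt_eqF.
  by move: (d * _) (d^-1 * _) (x * y) => p q r; lra.
have tl : \sum_(N <= i < (N + N).+1) b i ^+ 2 <= d / 4.
  have -> : \sum_(N <= i < (N + N).+1) b i ^+ 2 = S (N + N).+1 - S N.
    by rewrite /S [X in _ = X - _](big_cat_nat _ N1) //= addrAC subrr add0r.
  exact: tail.
have rev1 : \sum_(0 <= i < N) b (N + N - i)%N ^+ 2 = \sum_(N.+1 <= i < (N + N).+1) b i ^+ 2.
  rewrite -[N.+1]add0n big_addn subSS addnK [LHS]big_nat_rev /= !big_nat.
  by apply: eq_bigr => i /andP[_ iN]; congr (b _ ^+ 2); lia.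
have rev2 : \sum_(N <= i < (N + N).+1) b (N + N - i)%N ^+ 2 = S N.+1.
  rewrite /S -{1}[N]add0n big_addn subSn ?leq_addr // addnK [RHS]big_nat_rev /= !big_nat.
  by apply: eq_bigr => i /andP[_ iN]; congr (b _ ^+ 2); lia.
have P1 : \sum_(0 <= i < N) b i * b (N + N - i)%N <= (d * K + d^-1 * (d / 4)) / 2.
  apply: (@le_trans _ _ (\sum_(0 <= i < N) (d * b i ^+ 2 + d^-1 * b (N + N - i)%N ^+ 2) / 2)).
    by apply: ler_sum => i _; exact: amgm.
  rewrite -mulr_suml ler_wpM2r // big_split -!mulr_sumr /=; apply: lerD.
    by rewrite ler_wpM2l ?(ltW d0) //; exact: SK.
  rewrite ler_wpM2l ?invr_ge0 ?(ltW d0) // rev1; apply: le_trans tl.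
  rewrite [leRHS](big_cat_nat (n := N.+1)) ?big_nat1 //= ?ltnS ?leq_addr //.
  by rewrite lerDr sqr_ge0.
have P2 : \sum_(N <= i < (N + N).+1) b i * b (N + N - i)%N <= (d * K + d^-1 * (d / 4)) / 2.
  apply: (@le_trans _ _ (\sum_(N <= i < (N + N).+1)
      (d * b (N + N - i)%N ^+ 2 + d^-1 * b i ^+ 2) / 2)).
    by apply: ler_sum => i _; rewrite mulrC; exact: amgm.
  rewrite -mulr_suml ler_wpM2r // big_split -!mulr_sumr /=; apply: lerD.
    by rewrite ler_wpM2l ?(ltW d0) // rev2; exact: SK.
  by rewrite ler_wpM2l ?invr_ge0 ?(ltW d0).
have dd : d^-1 * (d / 4) = 1 / 4 by field; rewrite gt_eqF.
by move=> E; move: P1 P2; rewrite dd; lra.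
Qed.

Definition convpow (a : nat -> R) m := iter m (cprod a) (@kron0 R).

Lemma cprod0 (a b : nat -> R) : cprod a b 0%N = a 0%N * b 0%N.
Proof. by rewrite /cprod big_nat1 subnn. Qed.

Lemma convpow0 (a : nat -> R) m : a 0%N = 1 -> convpow a m 0%N = 1.
Proof. by move=> a0; elim: m => [|m IH]; rewrite /convpow /= ?cprod0 ?a0 ?mul1r. Qed.

Lemma tz_convpow n (a : nat -> R) m : tz n (convpow a m) = tz n a ^+ m.
Proof. by elim: m => [|m IH]; rewrite ?tz1 // exprS -IH tzM. Qed.

End SquareSums.

Section Roots.
Context (R : realType).

(** The matrix (1 - S)^(1/2^k). *)
Definition shroot n k := tz n (rest (@acoef R k)).

Lemma shroot_sqr n k : shroot n k.+1 * shroot n k.+1 = shroot n k.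
Proof.
rewrite /shroot tzM; apply: eq_tz => m.
exact: cprod_rest_sqrt (acoef_submarkov R k).
Qed.

Lemma shroot_pow n k : shroot n k ^+ (2 ^ k) = shroot n 0.
Proof.
elim: k => [|k IH]; first by rewrite expr1.
by rewrite expnS exprM expr2 shroot_sqr.
Qed.

(** Schur's test: all row and column sums of a(S) are at most 1. *)
Lemma tz_accretive n (a : nat -> R) : submarkov a ->
  forall w : 'cV[R[i]]_n.+1, 0 <= complex.Re (dt w (tz n (rest a) *m w)).
Proof.
move=> [a00 a0 a1] w.
pose t (i j : nat) := if (j <= i)%N then a (i - j)%N else 0.
have t0 i j : 0 <= t i j by rewrite /t; case: ifP.
have -> : tz n (rest a) = 1 - tz n a.
  apply/matrixP => i j; rewrite -tz1 !mxE; case: ifP => _; last by rewrite subr0.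
  by rewrite /rest rmorphB.
have row (i : 'I_n.+1) : \sum_(j < n.+1) t i j <= 1.
  have iN : (i.+1 <= n.+1)%N := ltn_ord i.
  rewrite -(big_mkord xpredT (t i)) (big_cat_nat _ iN) //=.
  rewrite [X in _ + X]big_nat [X in _ + X]big1 ?addr0; last first.
    by move=> j /andP[ij _]; rewrite /t leqNgt ij.
  rewrite (_ : \sum_(0 <= j < i.+1) t i j = \sum_(0 <= l < i.+1) a l) //.
  rewrite [RHS]big_nat_rev /= !big_nat; apply: eq_bigr => j /andP[_]; rewrite ltnS => ji.
  by rewrite /t ji add0n subSS.
have col (j : 'I_n.+1) : \sum_(i < n.+1) t i j <= 1.
  have jN : (j <= n.+1)%N := ltnW (ltn_ord j).
  rewrite -(big_mkord xpredT (fun i => t i j)) (big_cat_nat _ jN) //=.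
  rewrite [X in X + _]big_nat [X in X + _]big1 ?add0r; last first.
    by move=> i /andP[_ ij]; rewrite /t leqNgt ij.
  rewrite -{1}[nat_of_ord j]add0n big_addn.
  rewrite (_ : \sum_(0 <= i < n.+1 - j) _ = \sum_(0 <= l < (n.+1 - j)%N) a l) //.
  by apply: eq_bigr => i _; rewrite /t leq_addl addnK.
have wS : complex.Re (dt w w) = \sum_i sqabs (w i 0) by rewrite dtvv.
rewrite mulmxBl mul1mx dtDr dtNr raddfB /= subr_ge0 wS.
have -> : complex.Re (dt w (tz n a *m w))
    = \sum_(i < n.+1) \sum_(j < n.+1) t i j * complex.Re (conjc (w i 0) * w j 0).
  rewrite /dt raddf_sum; apply: eq_bigr => i _; rewrite mxE mulr_sumr raddf_sum.
  apply: eq_bigr => j _; rewrite mxE /t; case: ifP => _.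
    by rewrite mulrCA; move: (conjc _ * _) => -[x y] /=; ring.
  by rewrite mul0r mul0r mulr0 raddf0.
apply: (@le_trans _ _ (\sum_(i < n.+1) \sum_(j < n.+1)
    (t i j * sqabs (w i 0) + t i j * sqabs (w j 0)) / 2)).
  apply: ler_sum => i _; apply: ler_sum => j _.
  rewrite -mulrDr -mulrA ler_wpM2l //.
  case: (w i 0) (w j 0) => x y [x' y'] /=; rewrite /sqabs /=.
  have := sqr_ge0 (x - x'); have := sqr_ge0 (y - y'); nra.
rewrite (eq_bigr (fun i : 'I_n.+1 =>
  (\sum_(j < n.+1) t i j * sqabs (w i 0) + \sum_(j < n.+1) t i j * sqabs (w j 0)) / 2)); last first.
  by move=> i _; rewrite -mulr_suml big_split.
rewrite -mulr_suml big_split /= ler_pdivrMr // mulr_natr mulr2n; apply: lerD.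
  apply: ler_sum => i _; rewrite -mulr_suml -[leRHS]mul1r.
  by rewrite ler_wpM2r ?sqabs_ge0.
rewrite exchange_big; apply: ler_sum => j _; rewrite -mulr_suml -[leRHS]mul1r.
by rewrite ler_wpM2r ?sqabs_ge0.
Qed.

Definition ang k : R := pi / 2 ^+ k.+1.

Lemma ang_gt0 k : 0 < ang k. Proof. by rewrite divr_gt0 ?pi_gt0 ?exprn_gt0. Qed.

Lemma ang_double k : ang k = ang k.+1 *+ 2.
Proof. by rewrite /ang mulr2n [in RHS]exprS; field; rewrite expf_neq0. Qed.

Lemma ang_le k : ang k <= pi / 2.
Proof.
elim: k => [|k IH]; first by rewrite /ang expr1.
apply: le_trans IH; rewrite [leRHS]ang_double mulr2n lerDl ltW //; exact: ang_gt0.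
Qed.

Lemma sin_ang_gt0 k : 0 < sin (ang k).
Proof.
apply: sin_gt0_pi; rewrite ang_gt0 /=; apply: le_lt_trans (ang_le k) _.
by rewrite ltr_pdivrMr // ltr_pMr ?pi_gt0 // ltr1n.
Qed.

Lemma cos_ang_ge0 k : 0 <= cos (ang k).
Proof.
apply: cos_ge0_pihalf; rewrite ang_le andbT; apply: le_trans (ltW (ang_gt0 k)).
by rewrite oppr_le0 divr_ge0 ?pi_ge0.
Qed.

Lemma cos_ang_gt0 k : 0 < cos (ang k.+1).
Proof.
apply: cos_gt0_pihalf; apply/andP; split.
  by apply: lt_trans (ang_gt0 k.+1); rewrite oppr_lt0 divr_gt0 ?pi_gt0.
have := ang_le k; rewrite ang_double mulr2n; have := ang_gt0 k.+1; lra.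
Qed.

(** The factor has argument pi/2 - ang k. As its square for k + 1 is i times its
    value for k, the induction hypothesis is the condition of lyapunov on
    imaginary parts. *)
Lemma shroot_sector n k (w : 'cV[R[i]]_n.+1) :
  0 <= complex.Re (Complex (sin (ang k)) (cos (ang k)) * dt w (shroot n k *m w)).
Proof.
elim: k w => [|k IH] w.
  rewrite /ang expr1 sin_pihalf cos_pihalf.
  have := tz_accretive (acoef_submarkov R 0) w; rewrite -/(shroot n 0).
  by case: (dt _ _) => a b /=; lra.
apply: lyapunov => [||v|v].
- exact: sin_ang_gt0.
- exact: cos_ang_ge0.
- exact: tz_accretive (acoef_submarkov R k.+1) v.
have := IH v; rewrite shroot_sqr ang_double sin_mulr2n cos_mulr2n.
have := cos2Dsin2 (ang k.+1).
case: (dt _ _) => a b /=; move: (sin _) (cos _) => s c cs.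
have := congr1 (fun x => x * b) cs; lra.
Qed.

(** The coefficients of the root are real. *)
Lemma shroot_sector_conj n k (w : 'cV[R[i]]_n.+1) :
  0 <= complex.Re (Complex (sin (ang k)) (- cos (ang k)) * dt w (shroot n k *m w)).
Proof.
have := shroot_sector k (map_mx conjc w).
have -> : dt (map_mx conjc w) (shroot n k *m map_mx conjc w) = conjc (dt w (shroot n k *m w)).
  rewrite /dt rmorph_sum; apply: eq_bigr => i _; rewrite mxE rmorphM; congr (_ * _).
  rewrite !mxE rmorph_sum; apply: eq_bigr => j _; rewrite !mxE rmorphM; congr (_ * _).
  by case: ifP => _; apply: complexP; rewrite /= ?oppr0.
by case: (dt _ _) => a b /=; lra.
Qed.

Lemma shroot_cone n k (w : 'cV[R[i]]_n.+1) :
  `|complex.Im (dt w (shroot n k.+1 *m w))|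
    <= tan (ang k.+1) * complex.Re (dt w (shroot n k.+1 *m w)).
Proof.
have := shroot_sector k.+1 w; have := shroot_sector_conj k.+1 w.
rewrite /tan mulrAC; case: (dt _ _) => a b /= h1 h2.
rewrite ler_pdivlMr ?cos_ang_gt0 // -[X in _ * X]ger0_norm ?cos_ang_ge0 //.
by rewrite -normrM ler_norml; apply/andP; split; lra.
Qed.

End Roots.

(** * Lower bound for the Hilbert transform *)

Section LowerFamily.
Context (R : realType).

Definition ones : nat -> R := fun=> 1.

Lemma shroot0_inv n : shroot R n 0 * tz n ones = 1.
Proof.
rewrite /shroot tzM -tz1; apply: eq_tz => -[|m].
  by rewrite cprod0 /rest /kron0 /= subr0 mulr1.
rewrite /cprod big_nat_recl // big_nat_recl // big1 ?addr0 => [|i _].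
  by rewrite /rest /kron0 /=; ring.
by rewrite /rest /kron0 /= subrr mul0r.
Qed.

Section Inverse.
Variable k : nat.

(** Coefficients of (1 - z)^(-1/2^(k+1)). *)
Definition icoef : nat -> R := cprod (convpow (rest (@acoef R k.+1)) (2 ^ k.+1).-1) ones.
Definition iroot n := tz n icoef.

Lemma icoef0 : icoef 0%N = 1.
Proof.
have [a0 _ _] := acoef_submarkov R k.+1.
by rewrite /icoef cprod0 convpow0 ?mul1r // /rest /kron0 a0 subr0.
Qed.

Lemma shroot_iroot n : shroot R n k.+1 * iroot n = 1.
Proof.
rewrite /iroot /icoef -tzM tz_convpow mulrA -exprS prednK ?expn2_gt0 //.
by rewrite shroot_pow shroot0_inv.
Qed.

Lemma iroot_shroot n : iroot n * shroot R n k.+1 = 1.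
Proof. exact: mulmx1C (shroot_iroot n). Qed.

Lemma iroot_pow n : iroot n ^+ (2 ^ k.+1) = tz n ones.
Proof.
have cm : GRing.comm (iroot n) (shroot R n k.+1).
  by rewrite /GRing.comm shroot_iroot iroot_shroot.
have E : iroot n ^+ (2 ^ k.+1) * shroot R n 0 = 1.
  by rewrite -(shroot_pow R n k.+1) -exprMn_comm // iroot_shroot expr1n.
by rewrite -[LHS]mulr1 -(shroot0_inv n) mulrA E mul1r.
Qed.

Definition hcoef := convpow icoef (2 ^ k).

Lemma hcoef_sqr m : cprod hcoef hcoef m = 1.
Proof.
have : tz m (cprod hcoef hcoef) = tz m ones.
  by rewrite -tzM tz_convpow -exprD addnn -mul2n -expnS -iroot_pow.
move/matrixP => /(_ ord_max ord0); rewrite !mxE /= subn0.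
by move=> [].
Qed.

Lemma hs_hcoef N : N%:R * \sum_(0 <= m < N) hcoef m ^+ 2 <= hs (tz (N + N).-1 hcoef).
Proof.
case: N => [|N]; first by rewrite mul0r hs_ge0.
rewrite hsE addnS /=; set n := (N.+1 + N)%N.
pose S j := \sum_(0 <= m < j) hcoef m ^+ 2.
have E (i : 'I_n.+1) : \sum_j sqabs (tz n hcoef i j) = S i.+1.
  pose F (j : nat) : R := if (j <= i)%N then hcoef (i - j)%N ^+ 2 else 0.
  rewrite (eq_bigr (fun j : 'I_n.+1 => F j)); last first.
    by move=> j _; rewrite mxE /F; case: ifP => ji; rewrite /sqabs /= ?expr0n /= ?addr0.
  have iN : (i.+1 <= n.+1)%N := ltn_ord i.
  rewrite -(big_mkord xpredT F) (big_cat_nat _ iN) //=.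
  rewrite [X in _ + X]big_nat [X in _ + X]big1 ?addr0; last first.
    by move=> j /andP[ij _]; rewrite /F leqNgt ij.
  rewrite /S [RHS]big_nat_rev /= !big_nat; apply: eq_bigr => j /andP[_]; rewrite ltnS => ji.
  by rewrite /F ji add0n subSS.
rewrite (eq_bigr _ (fun i _ => E i)) -(big_mkord xpredT (fun i => S i.+1)).
have Nn : (N <= n.+1)%N by rewrite /n; lia.
rewrite (big_cat_nat _ Nn) //= -[leLHS]add0r; apply: lerD.
  by apply: sumr_ge0 => i _; apply: sumr_ge0 => m _; exact: sqr_ge0.
have nN : (n.+1 - N = N.+2)%N by rewrite /n; lia.
have SN i : (N <= i)%N -> S N.+1 <= S i.+1.
  move=> Ni; have Ni1 : (N.+1 <= i.+1)%N by [].
  rewrite /S (big_cat_nat _ Ni1) //= lerDl sumr_ge0 // => m _; exact: sqr_ge0.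
apply: (@le_trans _ _ (\sum_(N <= i < n.+1) S N.+1)); last first.
  by apply: ler_sum_nat => i /andP[Ni _]; exact: SN.
rewrite sumr_const_nat nN -[leRHS]mulr_natl ler_wpM2r ?ler_nat //.
by apply: sumr_ge0 => m _; exact: sqr_ge0.
Qed.

(** The matrix A = (1 - S)^(-1/2^(k+1)) inherits the sector of its inverse E,
    since <w, Aw> is the conjugate of <v, Ev> for v = Aw. Its norm dominates the
    Hilbert-Schmidt norm of A^(2^k) = (1 - S)^(-1/2). *)
Lemma lower_family (K : R) : exists n (A : 'M[R[i]]_n.+1),
  [/\ low A, forall i, A i i = 1,
    forall w, `|complex.Im (dt w (A *m w))| <= tan (ang R k.+1) * complex.Re (dt w (A *m w)),
    K * n.+1%:R <= ns k A ^+ (2 ^ k.+1) &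
    rtr (A ^+ (2 ^ k.+1)) = n.+1%:R].
Proof.
have [N HN] := sq_unbounded hcoef_sqr (2 * `|K|).
(* the last N of the 2N rows all contain the first N coefficients *)
pose n := (N + N).-1; exists n, (iroot n); split.
- by move=> i j ij; rewrite mxE leqNgt ij.
- by move=> i; rewrite mxE leqnn subnn icoef0.
- move=> w; have := @shroot_cone R n k (iroot n *m w).
  have E : shroot R n k.+1 *m (iroot n *m w) = w.
    by rewrite mulmxA -[shroot R n k.+1 *m iroot n]/(shroot R n k.+1 * iroot n) shroot_iroot mul1mx.
  by rewrite E (dtC w); case: (dt w _) => a b /=; rewrite normrN.
- have N0 : (0 < N)%N by case: (N) HN => //; rewrite big_nil => h; have := normr_ge0 K; lra.
  have nE : n.+1 = (N + N)%N by rewrite /n prednK // addn_gt0 N0.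
  rewrite nE.
  have h1 := ns_expr 0 k (iroot n); rewrite add0n in h1.
  have h2 : hs (iroot n ^+ (2 ^ k)) <= ns k (iroot n) ^+ (2 ^ k.+1).
    rewrite -ns0K expnS mulnC exprM ler_pXn2r ?nnegrE ?exprn_ge0 ?ns_ge0 //.
  apply: le_trans h2; rewrite -tz_convpow -/hcoef; apply: le_trans (hs_hcoef N).
  have -> : K * (N + N)%:R = N%:R * (2 * K) by rewrite natrD; ring.
  rewrite ler_wpM2l //.
  apply: le_trans (ltW HN); rewrite ler_wpM2l //; exact: ler_norm.
- rewrite iroot_pow /rtr /mxtrace raddf_sum (eq_bigr (fun=> 1)); last by move=> i _; rewrite mxE leqnn.
  by rewrite sumr_const card_ord.
Qed.

End Inverse.

Section Cartesian.
Variables (n : nat) (A : 'M[R[i]]_n.+1).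

Definition hre : 'M[R[i]]_n.+1 := 2^-1%:C%C *: (A + hc A).
Definition him : 'M[R[i]]_n.+1 := (- 'i%C * 2^-1%:C%C) *: (A - hc A).

Lemma cartesian : A = hre + 'i%C *: him.
Proof.
apply/matrixP => i j; rewrite !mxE; case: (A i j) => a b; case: (A j i) => a' b'.
by apply: complexP => /=; field.
Qed.

Lemma hc_hre : hc hre = hre.
Proof. by rewrite /hre hcZ conjc_real hcD hcK addrC. Qed.

Lemma hc_him : hc him = him.
Proof.
rewrite /him hcZ hcB hcK -[hc A - A]opprB scalerN -scaleNr; congr (_ *: _).
by apply: complexP => /=; ring.
Qed.

Lemma dt_hre w : complex.Re (dt w (hre *m w)) = complex.Re (dt w (A *m w)).
Proof.
rewrite /hre -scalemxAl dtZr mulmxDl dtDr -dt_adj (dtC w).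
by case: (dt _ _) => a b /=; field.
Qed.

Lemma dt_him w : complex.Re (dt w (him *m w)) = complex.Im (dt w (A *m w)).
Proof.
rewrite /him -scalemxAl dtZr mulmxBl dtDr dtNr -dt_adj (dtC w).
by case: (dt _ _) => a b /=; field.
Qed.

Lemma ns_cone k t : 0 <= t ->
  (forall w, `|complex.Im (dt w (A *m w))| <= t * complex.Re (dt w (A *m w))) ->
  ns k him <= t * ns k hre.
Proof.
move=> t0 H; apply: ns_mono => //; [exact: hc_him|exact: hc_hre|].
by move=> w; move: (H w); rewrite -dt_hre -dt_him.
Qed.

Lemma nci : nc ('i%C : R[i]) = 1.
Proof. by rewrite /nc /sqabs /= expr0n expr1n add0r sqrtr1. Qed.

(** As A - A' = 2iv, where A is lower triangular with unit diagonal. *)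
Lemma htrans_him : low A -> (forall i, A i i = 1) ->
  htrans ('i%C *: him) = hre - 1.
Proof.
move=> lA dA; have -> : 'i%C *: him = 2^-1%:C%C *: (A - hc A).
  by rewrite /him scalerA mulrA mulrN -expr2 sqr_i opprK mul1r.
apply/matrixP => i j; rewrite !mxE; case: ltngtP => ij.
- rewrite (lA j i) // conjc0 oppr0 !addr0 (_ : i == j = false) ?subr0 //.
  by apply/negbTE; rewrite -(inj_eq val_inj) gtn_eqF.
- rewrite (lA i j) // sub0r add0r mulrN opprK (_ : i == j = false) ?subr0 //.
  by apply/negbTE; rewrite -(inj_eq val_inj) ltn_eqF.
- move/val_inj: ij => ->; rewrite eqxx dA conjc1 subrr mulr0.
  by apply: complexP => /=; field.
Qed.

End Cartesian.

Lemma ns1_pow k n : ns k (1 : 'M[R[i]]_n.+1) ^+ (2 ^ k.+1) = n.+1%:R.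
Proof.
rewrite ns_pow hc1 mulr1 expr1n /rtr /mxtrace raddf_sum (eq_bigr (fun=> 1)).
  by rewrite sumr_const card_ord.
by move=> i _; rewrite mxE eqxx.
Qed.

Lemma tan_ang_gt0 k : 0 < tan (ang R k.+1).
Proof. by rewrite /tan divr_gt0 ?sin_ang_gt0 ?cos_ang_gt0. Qed.

(** Were the bound c smaller, |u - 1| = |H(iv)| <= c |v| <= c t |u| with c t < 1
    would bound |u|, and hence |A|, by a multiple of |1|. *)
Lemma htrans_lower k (c : R) :
  (forall n (X : 'M[R[i]]_n.+1), ns k (htrans X) <= c * ns k X) ->
  (tan (ang R k.+1))^-1 <= c.
Proof.
move=> H; set t := tan _; have t0 : 0 < t by exact: tan_ang_gt0.
rewrite leNgt; apply/negP => ct.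
pose c' := Num.max c 0; have c'0 : 0 <= c' by rewrite le_max lexx orbT.
have cc' : c <= c' by rewrite le_max lexx.
have c't : c' * t < 1.
  by rewrite -ltr_pdivlMr // div1r gt_max ct invr_gt0.
have d0 : 0 < 1 - c' * t by rewrite subr_gt0.
pose q := (1 + t) / (1 - c' * t); have q0 : 0 < q by rewrite divr_gt0 // addr_gt0.
have [n [A [lA dA sA KA _]]] := lower_family k (q ^+ (2 ^ k.+1) + 1).
pose u := hre A; pose v := him A; pose y := 'i%C *: v.
have nv : ns k v <= t * ns k u by apply: ns_cone => //; exact: ltW.
have ny : ns k y = ns k v by rewrite /y nsZ nci mul1r.
have nA : ns k A <= (1 + t) * ns k u.
  rewrite {1}[A]cartesian; apply: le_trans (ns_triangle _ _ _) _.
  by rewrite -/u -/v -/y ny mulrDl mul1r lerD2l.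
have n1 : (1 - c' * t) * ns k u <= ns k (1 : 'M[R[i]]_n.+1).
  have : ns k u <= ns k (u - 1) + ns k (1 : 'M[R[i]]_n.+1).
    by rewrite -{1}(subrK 1 u) ns_triangle.
  rewrite -(htrans_him lA dA) -/v -/y => h.
  have h1 : ns k (htrans y) <= c' * (t * ns k u).
    apply: le_trans (H _ _) _; apply: le_trans (ler_wpM2r (ns_ge0 _ _) cc') _.
    by rewrite ny; apply: ler_wpM2l.
  by rewrite mulrBl mul1r -mulrA lerBlDr; apply: le_trans h _; rewrite addrC lerD2l.
have nA2 : ns k A <= q * ns k (1 : 'M[R[i]]_n.+1).
  apply: le_trans nA _; rewrite /q mulrAC ler_pdivlMr // -mulrA; apply: ler_wpM2l.
    by rewrite addr_ge0 // ltW.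
  by rewrite mulrC; exact: n1.
have : ns k A ^+ (2 ^ k.+1) <= q ^+ (2 ^ k.+1) * n.+1%:R.
  by rewrite -(ns1_pow k n) -exprMn -ns_le_pow // mulr_ge0 ?ns_ge0 ?ltW.
by move=> /(le_trans KA); rewrite (ler_pM2r (ltr0Sn _ _)) gerDl ler10.
Qed.

End LowerFamily.

(** * Lower bound for the Riesz projection on S^4 *)

Section RieszLower.
Context (R : realType).
Local Notation C := R[i].

Section Pair.
Variables (n : nat).
Local Notation M := 'M[C]_n.+1.
Variables (u v : M).
Hypotheses (hu : hc u = u) (hv : hc v = v).

Lemma mul_cartesian (P Q P' Q' : M) :
  (P + 'i%C *: Q) * (P' + 'i%C *: Q') = P * P' - Q * Q' + 'i%C *: (P * Q' + Q * P').
Proof.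
rewrite mulrDl !mulrDr -!scalerAl -!scalerAr scalerA -(expr2 'i%C) sqr_i scaleN1r.
by rewrite scalerDr [_ *: (Q * P') - _]addrC addrACA.
Qed.

Lemma rtr_i (P Q : M) : hc P = P -> hc Q = Q -> rtr ('i%C *: (P * Q + Q * P)) = 0 :> R.
Proof.
move=> hP hQ; set Z := P * Q + Q * P.
have hZ : hc Z = Z by rewrite hcD !hcM hP hQ addrC.
have : rtr (hc ('i%C *: Z)) = - rtr ('i%C *: Z).
  rewrite hcZ hZ -rtrN -scaleNr; congr (rtr (_ *: _)).
  by apply: complexP => /=; rewrite ?oppr0.
rewrite rtr_hc; lra.
Qed.

Lemma rtr_complex_sqr (P Q : M) : hc P = P -> hc Q = Q ->
  rtr ((P + 'i%C *: Q) * (P + 'i%C *: Q)) = rtr (P * P) - rtr (Q * Q).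
Proof.
move=> hP hQ.
rewrite mul_cartesian.
by rewrite rtrD rtr_i // addr0 rtrB.
Qed.

Lemma rtr_sqD (P Q : M) :
  rtr ((P + Q) * (P + Q)) = rtr (P * P) + 2 * rtr (P * Q) + rtr (Q * Q).
Proof.
rewrite mulrDl !mulrDr !rtrD (rtrC Q P).
by move: (rtr _) (rtr _) (rtr _) => a b c; ring.
Qed.

Lemma rtr_sqB (P Q : M) :
  rtr ((P - Q) * (P - Q)) = rtr (P * P) - 2 * rtr (P * Q) + rtr (Q * Q).
Proof. by rewrite rtr_sqD mulrN rtrN mulrNN mulrN. Qed.

Lemma rtr_uvvu : rtr (u * v * (v * u)) = rtr (u * u * (v * v)).
Proof. by rewrite rtrC -mulrA rtrC !mulrA. Qed.

Lemma rtr_vuvu : rtr (v * u * (v * u)) = rtr (u * v * (u * v)).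
Proof. by rewrite -mulrA rtrC !mulrA. Qed.

Lemma rtr_four : rtr ((u + 'i%C *: v) ^+ 4) =
  rtr (u * u * (u * u)) + rtr (v * v * (v * v))
  - 4 * rtr (u * u * (v * v)) - 2 * rtr (u * v * (u * v)).
Proof.
pose P := u * u - v * v; pose Q := u * v + v * u.
have hP : hc P = P by rewrite hcB !hcM hu hv.
have hQ : hc Q = Q by rewrite hcD !hcM hu hv addrC.
have -> : (u + 'i%C *: v) ^+ 4 = (P + 'i%C *: Q) * (P + 'i%C *: Q).
  by rewrite (_ : 4%N = (2 * 2)%N) // exprM expr2 !expr2 mul_cartesian.
rewrite (rtr_complex_sqr hP hQ) (rtr_sqB (u * u)) (rtr_sqD (u * v)) rtr_uvvu rtr_vuvu.
by move: (rtr _) (rtr _) (rtr _) (rtr _) => a b c d; ring.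
Qed.

Lemma hs_commutator : hs (u * v - v * u) =
  2 * rtr (u * u * (v * v)) - 2 * rtr (u * v * (u * v)).
Proof.
rewrite /hs.
have -> : hc (u * v - v * u) = - (u * v - v * u) by rewrite hcB !hcM hu hv opprB.
rewrite mulNr rtrN rtr_sqB rtr_uvvu rtr_vuvu.
by move: (rtr _) (rtr _) => a b; ring.
Qed.

Lemma hs_sqr_diff (c : R) : hs (v * v - c%:C%C *: (u * u)) =
  rtr (v * v * (v * v)) - 2 * c * rtr (u * u * (v * v)) + c ^+ 2 * rtr (u * u * (u * u)).
Proof.
rewrite /hs.
have -> : hc (v * v - c%:C%C *: (u * u)) = v * v - c%:C%C *: (u * u).
  by rewrite hcB hcZ conjc_real !hcM hu hv.
have eZ (P Q : M) : rtr (P * (c%:C%C *: Q)) = c * rtr (P * Q) by rewrite -scalerAr rtrZ.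
rewrite rtr_sqB !eZ (rtrC (_ *: _)) eZ (rtrC (v * v) (u * u)).
by move: (rtr _) (rtr _) (rtr _) => a b d; ring.
Qed.

(** Let U, V and N be the traces of u^4, v^4 and (u + iv)^4, D = |v^2 - tau u^2|^2
    and K = |uv - vu|^2, in Hilbert-Schmidt norm. Then
    D + tau K/3 = tau N/3 + V (1 - tau/3) + U (tau^2 - tau/3). The last two terms
    are at most U (tau/3)(6 tau - tau^2 - 1) = 0, by V <= tau^2 U. *)
Lemma cone_real (U V m w tau N D K : R) : 0 < tau -> tau < 1 -> tau ^+ 2 - 6 * tau + 1 = 0 ->
  0 <= U -> V <= tau ^+ 2 * U -> N = U + V - 4 * m - 2 * w -> 0 <= N ->
  D = V - 2 * tau * m + tau ^+ 2 * U -> K = 2 * m - 2 * w -> 0 <= K -> D <= N.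
Proof.
move=> t0 t1 te U0 hV eN N0 eD eK K0.
have h1 : V * (1 - tau / 3) <= tau ^+ 2 * U * (1 - tau / 3) by apply: ler_wpM2r => //; lra.
have h2 : tau ^+ 2 * U * (1 - tau / 3) + U * (tau ^+ 2 - tau / 3)
    = - (tau / 3) * U * (tau ^+ 2 - 6 * tau + 1).
  by field.
rewrite te mulr0 in h2.
have h3 : D + tau * K / 3 - tau * N / 3 = V * (1 - tau / 3) + U * (tau ^+ 2 - tau / 3).
  by rewrite eD eK eN; field.
have h4 : 0 <= tau * K by rewrite mulr_ge0 // ltW.
have h5 : tau * N <= 1 * N by rewrite ler_wpM2r // ltW.
move: h1 h2 h3 h4 h5; move: (V * _) (U * _) (tau ^+ 2 * U * _) (tau * K) (tau * N) => a b d e f; lra.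
Qed.

Lemma tan_eighth (t : R) : 0 < t -> t ^+ 2 = 1 - 2 * t ->
  t ^+ 2 < 1 /\ (t ^+ 2) ^+ 2 - 6 * t ^+ 2 + 1 = 0.
Proof.
move=> t0 te; split; first lra.
by rewrite te sqrrB expr1n mul1r exprMn te; ring.
Qed.

(** All quantities are combinations of the traces of u^4, v^4, u^2 v^2 and uvuv;
    cone_real compares them. *)
Lemma near_extremal (t : R) : 0 < t -> t ^+ 2 = 1 - 2 * t -> ns 1 v <= t * ns 1 u ->
  0 <= rtr ((u + 'i%C *: v) ^+ 4) ->
  hs (v * v - (t ^+ 2)%:C%C *: (u * u)) <= rtr ((u + 'i%C *: v) ^+ 4).
Proof.
move=> t0 te uv N0.
have t2 : 0 < t ^+ 2 by rewrite exprn_gt0.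
have U4 : rtr (u * u * (u * u)) = ns 1 u ^+ 4 by rewrite -[4%N]/(2 ^ 2)%N ns_four hu.
have V4 : rtr (v * v * (v * v)) = ns 1 v ^+ 4 by rewrite -[4%N]/(2 ^ 2)%N ns_four hv.
have hV : rtr (v * v * (v * v)) <= (t ^+ 2) ^+ 2 * rtr (u * u * (u * u)).
  rewrite U4 V4 -exprM -exprMn ler_pXn2r ?nnegrE ?ns_ge0 //.
  by rewrite mulr_ge0 ?ns_ge0 // ltW.
have U0 : 0 <= rtr (u * u * (u * u)) by rewrite U4 exprn_ge0 // ns_ge0.
have [t1 tt] := tan_eighth t0 te.
exact: (cone_real t2 t1 tt U0 hV rtr_four N0 (hs_sqr_diff _) hs_commutator (hs_ge0 _)).
Qed.

Lemma test_coef (t r : R) : t ^+ 2 = 1 - 2 * t -> r = (1 + t) / 2 ->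
  [/\ (1 - r) ^+ 2 = 2^-1 - (2 + t) * t ^+ 2, (1 + r) ^+ 2 = 2^-1 + (2 + t) &
    (1 - r) * (1 + r) = 2^-1].
Proof. by move=> te ->; split; field: te. Qed.

(** The value r = 1/sqrt 2 is the one for which the commutator of u and v has the
    same coefficient in xx' as in AA'/2. As t^2 = 1 - 2 t, it equals (1 + t)/2. *)
Lemma test_modulus (t r : R) : t ^+ 2 = 1 - 2 * t -> r = (1 + t) / 2 ->
  let A := u + 'i%C *: v in let x := A - r%:C%C *: hc A in
  x * hc x = 2^-1%:C%C *: (A * hc A) + (2 + t)%:C%C *: (v * v - (t ^+ 2)%:C%C *: (u * u)).
Proof.
move=> te er A x.
have hi : conjc ('i%C : C) = - 'i%C by apply: complexP => /=; rewrite ?oppr0.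
have hA : hc A = u + 'i%C *: (- v) by rewrite hcD hcZ hu hv hi scaleNr scalerN.
have hx : x = (1 - r)%:C%C *: u + 'i%C *: ((1 + r)%:C%C *: v).
  rewrite /x hA /A; apply/matrixP => i j; rewrite !mxE.
  by case: (u i j) => a b; case: (v i j) => c d; apply: complexP => /=; ring.
have hx' : hc x = (1 - r)%:C%C *: u + 'i%C *: ((1 + r)%:C%C *: - v).
  rewrite hx hcD !hcZ hi !conjc_real hu hv; congr (_ + _).
  by rewrite scaleNr scalerN scalerN.
rewrite hx' hx hA /A !mul_cartesian !mulrN -!(scalerAl, scalerAr) !mulrN.
move: (u * u) (u * v) (v * u) (v * v) => uu u_v v_u vv.
apply/matrixP => i j; rewrite !mxE.
case: (uu i j) => a1 b1; case: (u_v i j) => a2 b2; case: (v_u i j) => a3 b3; case: (vv i j) => a4 b4.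
have [E1 E2 E3] := test_coef te er; clear -E1 E2 E3.
apply: complexP => /=.
  transitivity ((1 - r) ^+ 2 * a1 + (1 + r) ^+ 2 * a4 + (1 - r) * (1 + r) * (b2 - b3)).
    by ring.
  by rewrite E1 E2 E3; field.
transitivity ((1 - r) ^+ 2 * b1 + (1 + r) ^+ 2 * b4 - (1 - r) * (1 + r) * (a2 - a3)).
  by ring.
by rewrite E1 E2 E3; field.
Qed.

Lemma test_norm (t r : R) A : 0 < t -> t ^+ 2 = 1 - 2 * t -> r = (1 + t) / 2 ->
  A = u + 'i%C *: v ->
  ns 1 (A - r%:C%C *: hc A) ^+ 2 <=
    2^-1 * ns 1 A ^+ 2 + (2 + t) * ns 0 (v * v - (t ^+ 2)%:C%C *: (u * u)).
Proof.
move=> t0 te er eA; rewrite nsS_r eA (test_modulus te er) -eA (nsS_r 0 A).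
apply: le_trans (ns_triangle _ _ _) _; rewrite !nsZ !nc_real.
rewrite (ger0_norm (_ : 0 <= 2^-1)) ?invr_ge0 ?ler0n //.
by rewrite (ger0_norm (_ : 0 <= 2 + t)) ?addr_ge0 ?ler0n // ltW.
Qed.

End Pair.
End RieszLower.

Section RieszLower.
Context (R : realType).
Local Notation C := R[i].

Lemma sin_cos_ang1 : sin (ang R 1) = cos (ang R 1).
Proof.
have : cos (ang R 0) = 0 by rewrite /ang expr1 cos_pihalf.
rewrite ang_double cos_mulr2n => h1.
have := sin_ang_gt0 R 1; have := cos_ang_gt0 R 0; have := cos2Dsin2 (ang R 1).
move: h1; move: (sin _) (cos _) => s c; rewrite !expr2 => h1 h2 h3 h4; nra.
Qed.

(** This t is tan(pi/8), and tan(pi/4) = 1. *)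
Lemma tan_ang2 : let t := tan (ang R 2) in 0 < t /\ t ^+ 2 = 1 - 2 * t.
Proof.
move=> t; split; first exact: tan_ang_gt0.
have s1 := sin_cos_ang1.
move: s1; rewrite ang_double cos_mulr2n sin_mulr2n /t /tan.
have := cos_ang_gt0 R 1; have := cos2Dsin2 (ang R 2); move: (sin _) (cos _) => s c e1 c0' e2.
have cn : c != 0 by rewrite gt_eqF.
have es : s ^+ 2 = c ^+ 2 - 2 * (s * c).
  by move: e1 e2; rewrite !expr2 !mulr2n; lra.
by rewrite expr_div_n es; field.
Qed.

(** Here a, s and y stand for the norms of A, 1 and x. With eta = 1 - c^2/2, the
    last two hypotheses give eta a^2 <= 2 a s + 5 s^2, which is at most 7 a s,
    whereas eta a >= 8 s. *)
Lemma lower_real (a s y c : R) : 0 <= c -> c ^+ 2 < 2 -> 0 < s ->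
  8 / (1 - c ^+ 2 / 2) * s <= a -> a - s <= c * y ->
  y ^+ 2 <= 2^-1 * a ^+ 2 + 3 * s ^+ 2 -> False.
Proof.
move=> c0 c2 s0; set eta := 1 - _ => aK acy yb.
have eta0 : 0 < eta by rewrite /eta; move: (c ^+ 2) c2 => d; lra.
have eta1 : eta <= 1 by rewrite /eta; have := sqr_ge0 c; move: (c ^+ 2) => d; lra.
have h1 : 8 * s <= eta * a by rewrite (mulrC eta); move: aK; rewrite mulrAC ler_pdivrMr.
have a0 : 0 <= a by apply: le_trans aK; rewrite mulr_ge0 ?divr_ge0 ?ltW.
have as0 : s <= a.
  have : eta * a <= 1 * a by rewrite ler_wpM2r.
  by move: (eta * a) h1 => d; lra.
have h2 : (a - s) ^+ 2 <= c ^+ 2 * y ^+ 2.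
  by rewrite -exprMn !expr2 ler_pM // subr_ge0.
have h3 : c ^+ 2 * y ^+ 2 <= c ^+ 2 * (2^-1 * a ^+ 2 + 3 * s ^+ 2) by rewrite ler_wpM2l // sqr_ge0.
have h4 : c ^+ 2 * (2^-1 * a ^+ 2 + 3 * s ^+ 2) = (1 - eta) * a ^+ 2 + 3 * (c ^+ 2 * s ^+ 2).
  by rewrite /eta; field.
have h5 : c ^+ 2 * s ^+ 2 <= 2 * s ^+ 2 by rewrite ler_wpM2r ?sqr_ge0 // ltW.
have h6 : a * (8 * s) <= a * (eta * a) by rewrite ler_wpM2l.
have h7 : s * s <= s * a by rewrite ler_wpM2l // ltW.
have h8 : 0 < s * s by rewrite mulr_gt0.
have : (a - s) ^+ 2 <= (1 - eta) * a ^+ 2 + 3 * (2 * s ^+ 2).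
  by apply: le_trans h2 _; apply: le_trans h3 _; rewrite h4 lerD2l ler_wpM2l.
clear -h6 h7 h8; rewrite !expr2 => h.
have e1 : (a - s) * (a - s) = a * a - 2 * (s * a) + s * s by ring.
have e2 : (1 - eta) * (a * a) = a * a - a * (eta * a) by ring.
have e3 : a * (8 * s) = 8 * (s * a) by ring.
move: h h6 h7 h8; rewrite e1 e2 e3; move: (a * a) (s * a) (s * s) (a * (eta * a)) => b d e f; lra.
Qed.

Lemma pow4_le (x y : R) : 0 <= x -> 0 <= y -> x ^+ 4 <= y ^+ 4 -> x <= y.
Proof. by move=> x0 y0; rewrite ler_pXn2r. Qed.

Lemma rproj_test n (A : 'M[C]_n.+1) (r : R) : low A -> (forall i, A i i = 1) ->
  rproj (A - r%:C%C *: hc A) = A - r%:C%C *: 1.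
Proof.
move=> lA dA; apply/matrixP => i j; rewrite !mxE -val_eqE /=; case: ltngtP => ij.
- by rewrite (lA j i) // conjc0 mulr0n.
- by rewrite lA // mulr0n mulr0 subr0.
- by move/val_inj: ij => ->; rewrite dA conjc1.
Qed.

Lemma rproj_test_norm n (A : 'M[C]_n.+1) (r : R) : low A -> (forall i, A i i = 1) ->
  0 <= r -> r <= 1 ->
  ns 1 A - ns 1 (1 : 'M[C]_n.+1) <= ns 1 (rproj (A - r%:C%C *: hc A)).
Proof.
move=> lA dA r0 r1; rewrite (rproj_test r lA dA); set B := r%:C%C *: 1.
have hB : ns 1 B <= ns 1 (1 : 'M[C]_n.+1).
  by rewrite nsZ nc_real ger0_norm // -[leRHS]mul1r; apply: ler_wpM2r; first exact: ns_ge0.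
have hA := ns_triangle 1 (A - B) B; rewrite subrK in hA.
by rewrite lerBlDr; apply: le_trans hA _; rewrite lerD2l.
Qed.

Lemma test_ratio (t : R) : 0 < t -> t ^+ 2 = 1 - 2 * t ->
  [/\ 0 <= (1 + t) / 2, (1 + t) / 2 <= 1, 0 <= 2 + t & 2 + t <= 3].
Proof. by move=> t0; rewrite expr2 => te; split; nra. Qed.

Lemma sqr_le (x y : R) : 0 <= x -> 0 <= y -> x ^+ 2 <= y ^+ 2 -> x <= y.
Proof. by move=> x0 y0; rewrite ler_pXn2r. Qed.

(** The Riesz projection of x = A - r A' is A - r, whose norm is at least
    |A| - |1|; the square of the norm of x is at most |A|^2/2 + 3 |1|^2. *)
Lemma rproj_lower (c : R) :
  (forall n (X : 'M[C]_n.+1), ns 1 (rproj X) <= c * ns 1 X) -> Num.sqrt 2 <= c.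
Proof.
move=> H; rewrite leNgt; apply/negP => cs.
pose c' := Num.max c 0; have c'0 : 0 <= c' by rewrite le_max lexx orbT.
have cc' : c <= c' by rewrite le_max lexx.
have c'2 : c' ^+ 2 < 2.
  have s2 : c' < Num.sqrt 2 by rewrite gt_max cs sqrtr_gt0 ltr0n.
  have : c' ^+ 2 < Num.sqrt 2 ^+ 2 by rewrite ltr_pXn2r ?nnegrE ?sqrtr_ge0.
  by rewrite sqr_sqrtr.
have K0 : 0 <= 8 / (1 - c' ^+ 2 / 2).
  by rewrite divr_ge0 // subr_ge0 ler_pdivrMr // mul1r ltW.
have [n [A [lA dA sA KA tA]]] := lower_family 1 ((8 / (1 - c' ^+ 2 / 2)) ^+ 4).
have [t0 te] := tan_ang2; set t := tan _ in t0 te sA.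
pose u := hre A; pose v := him A; pose r := (1 + t) / 2.
have hu : hc u = u := hc_hre A; have hv : hc v = v := hc_him A.
have eA : u + 'i%C *: v = A by rewrite -cartesian.
have nv : ns 1 v <= t * ns 1 u by apply: ns_cone; [exact: ltW|exact: sA].
pose s := ns 1 (1 : 'M[C]_n.+1).
have s4 : s ^+ 4 = n.+1%:R := ns1_pow R 1 n.
have sge0 : 0 <= s by exact: ns_ge0.
have s0 : 0 < s.
  rewrite lt_def sge0 andbT; apply/eqP => e; move: s4.
  by rewrite e expr0n => /eqP; rewrite eq_sym pnatr_eq0.
have [r0 r1 t2 t3] := test_ratio t0 te.
pose x := A - r%:C%C *: hc A.
apply: (@lower_real (ns 1 A) s (ns 1 x) c' c'0 c'2 s0).
- apply: pow4_le; [exact: mulr_ge0|exact: ns_ge0|].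
  by move: KA; rewrite -s4 -exprMn.
- apply: le_trans (rproj_test_norm lA dA r0 r1) _; apply: le_trans (H n x) _.
  by apply: ler_wpM2r cc'; exact: ns_ge0.
- apply: le_trans (test_norm hu hv t0 te erefl (esym eA)) _.
  rewrite lerD2l; apply: ler_pM; [exact: t2|exact: ns_ge0|exact: t3|].
  apply: sqr_le; [exact: ns_ge0|exact: sqr_ge0|].
  have tA' : rtr (A ^+ 4) = s ^+ 4 by rewrite s4; exact: tA.
  rewrite ns0K -exprM -tA' -eA; apply: (near_extremal hu hv t0 te nv).
  by rewrite eA tA'; exact: exprn_ge0.
Qed.

End RieszLower.

(** * Finite matrices as operators *)

Section RankOne.
Context (R : realType).

Lemma bounded_subseq (z : nat -> R) : (forall n, `|z n| <= 1) ->
  exists s : nat -> nat, {homo s : m n / (m < n)%N} /\ exists l : R,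
    forall eps, 0 < eps -> exists N, forall n, (N <= n)%N -> `|z (s n) - l| <= eps.
Proof.
move=> z1; have bz : bounded_fun z.
  exists 1; split; first exact: num_real.
  by move=> x x1 n _ /=; apply: le_trans (z1 n) (ltW x1).
have [s /increasing_seqP hs /cvg_ex[/= l Hl]] := bolzano_weierstrass bz.
exists s; split; first exact: (homo_ltn ltn_trans hs).
exists l => eps e0; move/cvgrPdist_le: Hl => /(_ eps e0)[N _ HN].
by exists N => n /HN; rewrite distrC.
Qed.

Lemma bounded_subseqC (z : nat -> R[i]) : (forall n, sqabs (z n) <= 1) ->
  exists s : nat -> nat, {homo s : m n / (m < n)%N} /\ exists l : R[i],
    forall eps, 0 < eps -> exists N, forall n, (N <= n)%N -> sqabs (z (s n) - l) <= eps.
Proof.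
move=> z1.
have re1 n : `|complex.Re (z n)| <= 1.
  by apply: Re_le_sqabs; rewrite ?expr1n.
have im1 n : `|complex.Im (z n)| <= 1.
  rewrite -(@ler_pXn2r _ 2) ?nnegrE // real_normK ?num_real // expr1n.
  by apply: le_trans (z1 n); rewrite lerDr sqr_ge0.
have [s [hs [a Ha]]] := bounded_subseq re1.
have [t [ht [b Hb]]] := bounded_subseq (fun n => im1 (s n)).
exists (s \o t); split; first exact: homo_comp.
exists (Complex a b) => eps e0.
have d0 : 0 < Num.min (eps / 2) 1 by rewrite lt_min ltr01 divr_gt0.
have [N HN] := Ha _ d0; have [M HM] := Hb _ d0.
have tn n : (n <= t n)%N by elim: n => // n IH; apply: leq_ltn_trans IH (ht _ _ _).
have small (x : R) : `|x| <= Num.min (eps / 2) 1 -> x ^+ 2 <= eps / 2.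
  rewrite le_min => /andP[h1 h2]; rewrite -(real_normK (num_real x)) expr2.
  by rewrite -[leRHS]mulr1 ler_pM.
exists (maxn N M) => n; rewrite geq_max => /andP[Nn Mn].
have h1 := small _ (HN _ (leq_trans Nn (tn n))); have h2 := small _ (HM n Mn).
by rewrite /sqabs !raddfB /= (splitr eps) lerD.
Qed.

(** Bolzano-Weierstrass for the coordinate v i. *)
Lemma cop_rank_one (I J : choiceType) (i : I) (u : l2 R J) : cop (fun v : l2 R I => v i *: u).
Proof.
split.
  split=> [c v w|]; first by rewrite l2_addE l2_scaleE scalerDl scalerA.
  exists (nsq u); split=> [|v]; first exact: nsq_ge0.
  by rewrite nsqZ mulrC ler_wpM2l ?nsq_ge0 ?sqabs_le_nsq.
move=> v v1.
have [s [hs [l Hl]]] := bounded_subseqC (fun n => le_trans (sqabs_le_nsq (v n) i) (v1 n)).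
exists s; split=> //; exists (l *: u) => eps e0.
have c0 : 0 < nsq u + 1 by rewrite ltr_wpDl ?nsq_ge0.
have [N HN] := Hl (eps / (nsq u + 1)) (divr_gt0 e0 c0).
exists N => n /HN h; rewrite /= -scalerBl nsqZ.
apply: le_trans (ler_wpM2r (nsq_ge0 _) h) _; rewrite mulrAC ler_pdivrMr //.
by rewrite ler_wpM2l ?(ltW e0) // lerDl.
Qed.

Lemma cop_sum (I J : choiceType) (T : Type) (r : seq T) (L : T -> l2 R I -> l2 R J) :
  (forall k, cop (L k)) -> cop (fun v => \sum_(k <- r) L k v).
Proof.
move=> cL; elim: r => [|k r IH].
  rewrite (_ : (fun v => _) = fun=> 0); last by apply/funext => v; rewrite big_nil.
  split=> [|v _]; last by exists id; split=> //; exists 0; exact: l2lim_cst.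
  split; first by move=> c v w; rewrite scaler0 addr0.
  by exists 0; split=> // v; rewrite nsq0 mul0r.
have -> : (fun v => \sum_(j <- k :: r) L j v) = (fun v => 1 *: L k v + \sum_(j <- r) L j v).
  by apply/funext => v; rewrite big_cons scale1r.
exact: cop_lincomb.
Qed.
End RankOne.

Section Embedding.
Context (R : realType) (I : choiceType) (n : nat) (e : 'I_n.+1 -> I).
Hypothesis inj_e : injective e.
Local Notation M := 'M[R[i]]_n.+1.

(** The operator of the matrix X on the coordinates e k. *)
Definition embop (X : M) (v : l2 R I) : l2 R I :=
  \sum_k \sum_l v (e l) *: (X k l *: (delta (e k) : l2 R I)).

Lemma cop_emb X : cop (embop X).
Proof. by apply: cop_sum => k; apply: cop_sum => l; exact: cop_rank_one. Qed.

Lemma embopE X v k : embop X v (e k) = \sum_l X k l * v (e l).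
Proof.
rewrite /embop l2_sumE (bigD1 k) //= [Y in _ + Y]big1 ?addr0 => [|k' k'k].
  by rewrite l2_sumE; apply: eq_bigr => l _; rewrite !l2_scaleE deltaE eqxx mulr1 mulrC.
rewrite l2_sumE big1 // => l _; rewrite !l2_scaleE deltaE (inj_eq inj_e).
by rewrite eq_sym (negPf k'k) !mulr0.
Qed.

Lemma embop_out X v i : (forall k, i != e k) -> embop X v i = 0.
Proof.
move=> ie; rewrite /embop l2_sumE big1 // => k _; rewrite l2_sumE big1 // => l _.
by rewrite !l2_scaleE deltaE (negPf (ie k)) !mulr0.
Qed.

Lemma embopP (X : M) (L v : l2 R I) : (forall k, L (e k) = \sum_l X k l * v (e l)) ->
  (forall i, (forall k, i != e k) -> L i = 0) -> embop X v = L.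
Proof.
move=> Lin Lout; apply: l2P => i.
have [[k ->]|H] := pselect (exists k, i = e k); first by rewrite embopE Lin.
have ie k : i != e k by apply/eqP => ik; apply: H; exists k.
by rewrite embop_out // Lout.
Qed.

Lemma embopM X Y v : embop (X * Y) v = embop X (embop Y v).
Proof.
apply: embopP => [k|i ie]; last exact: embop_out.
rewrite embopE; under eq_bigr do rewrite embopE mulr_sumr.
rewrite exchange_big /=; apply: eq_bigr => l _; rewrite mxE mulr_suml.
by apply: eq_bigr => j _; rewrite mulrA.
Qed.

Lemma embopZ a X v : embop (a *: X) v = a *: embop X v.
Proof.
apply: embopP => [k|i ie]; rewrite l2_scaleE; last by rewrite embop_out ?mulr0.
by rewrite embopE mulr_sumr; apply: eq_bigr => l _; rewrite mxE mulrA.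
Qed.

Definition emb X : opmx R I := mxof (embop X).

Lemma embE X k l : emb X (e k) (e l) = X k l.
Proof.
rewrite /emb /mxof embopE (bigD1 l) // deltaE eqxx mulr1 /= [Y in _ + Y]big1 ?addr0 // => j jl.
by rewrite /deltaf (inj_eq inj_e) (negPf jl) mulr0.
Qed.

Lemma emb_out X i j : (forall k, i != e k) \/ (forall l, j != e l) -> emb X i j = 0.
Proof.
case=> H; first exact: embop_out.
rewrite /emb /mxof; have [[k ->]|ni] := pselect (exists k, i = e k).
  by rewrite embopE big1 // => l _; rewrite deltaE eq_sym (negPf (H l)) mulr0.
by apply: embop_out => k; apply/eqP => ik; apply: ni; exists k.
Qed.

Lemma embP (x : opmx R I) (X : M) : (forall k l, x (e k) (e l) = X k l) ->
  (forall i j, (forall k, i != e k) \/ (forall l, j != e l) -> x i j = 0) -> x = emb X.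
Proof.
move=> Hin Hout; apply/funext => i; apply/funext => j.
have nex (m : I) : (exists k, m = e k) \/ (forall k, m != e k).
  have [[k mk]|H] := pselect (exists k, m = e k); first by left; exists k.
  by right=> k; apply/eqP => mk; apply: H; exists k.
have [[k ->]|ie] := nex i; last by rewrite (Hout i j (or_introl ie)) emb_out //; left.
have [[l ->]|je] := nex j; last by rewrite (Hout _ j (or_intror je)) emb_out //; right.
by rewrite Hin embE.
Qed.

Lemma represents_emb X : represents (emb X) (embop X).
Proof. exact: represents_mxof (cop_emb X).1. Qed.

Lemma compact_emb X : compact_op (emb X).
Proof. exact/(compact_opP (represents_emb X))/cop_emb. Qed.

Lemma adj_emb X : adjop (embop X) = embop (hc X).
Proof.
apply: represents_uniq (represents_adj (represents_emb X)) _.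
rewrite (_ : Defs.adj (emb X) = emb (hc X)); first exact: represents_emb.
apply: embP => [k l|i j H]; first by rewrite /Defs.adj embE hcE.
by rewrite /Defs.adj emb_out ?conjc0 //; case: H; [right|left].
Qed.

Lemma trace_emb (X : M) : (forall k, 0 <= complex.Re (X k k)) -> trace (emb X) = (rtr X)%:E.
Proof.
move=> X0; pose f i := emb X i i; pose s := [seq e k | k : 'I_n.+1].
have us : uniq s by rewrite map_inj_uniq ?enum_uniq.
have fs : {in predC (mem s), f =1 fun=> 0}.
  move=> i; rewrite inE => /= H; apply: emb_out; left=> k.
  by apply: contra H => /eqP ->; apply: map_f; rewrite mem_enum.
have [sf _] := csummable_seq fs.
have f0 i : 0 <= complex.Re (f i).
  have [|/fs ->//] := boolP (i \in s).
  by move=> /mapP[k _ ->]; rewrite /f embE.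
rewrite /trace -(fineK (absummable_fin sf f0)) -(rsum_ge0E sf f0); congr (_%:E).
have := csum_seq us fs => /(congr1 (@complex.Re R)) /= ->.
rewrite big_map big_enum /= /rtr /mxtrace; congr complex.Re.
by apply: eq_bigr => k _; rewrite /f embE.
Qed.

Lemma gram_diag (X : M) k : 0 <= complex.Re ((hc X * X) k k).
Proof.
rewrite mxE raddf_sum sumr_ge0 // => j _; rewrite hcE mulrC sqabs_conj.
exact: sqabs_ge0.
Qed.

Lemma gram_pow (X : M) q : exists W, (hc X * X) ^+ (2 ^ q) = hc W * W.
Proof.
case: q => [|q]; first by exists X; rewrite expr1.
exists ((hc X * X) ^+ (2 ^ q)); rewrite hcX hcM hcK -exprD.
by rewrite expnS mul2n addnn.
Qed.

Lemma gauge_pow p : (0 < p)%N -> gauge (fun t : R => t ^+ p).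
Proof.
move=> p0; split=> [|t t0|t u t0 tu]; first by rewrite expr0n gtn_eqF.
  exact: exprn_ge0.
by rewrite lerXn2r ?nnegrE // (le_trans t0).
Qed.

Lemma embop_eig (X : M) (c : R) v q : embop X v = c%:C%C *: v ->
  embop (X ^+ q.+1) v = (c ^+ q.+1)%:C%C *: v.
Proof.
move=> Xv; elim: q => [|q IH]; first by rewrite !expr1.
rewrite exprSr embopM Xv (bopZ (cop_emb _).1) IH scalerA -rmorphM; congr (_%:C%C *: _).
Qed.

(** The operator (X'X)^(p/2)/a^p acts by l^p on the eigenvectors of |X|/a for the
    eigenvalue l. *)
Lemma trpsi_emb (X : M) k (a : R) : 0 < a ->
  trpsi (fun t : R => t ^+ (2 ^ k.+1)) (emb X) a = ((ns k X / a) ^+ (2 ^ k.+1))%:E.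
Proof.
move=> a0; have [u [s Xus]] := ex_svd (cop_emb X).
pose Z := ((a ^+ (2 ^ k.+1))^-1)%:C%C *: (hc X * X) ^+ (2 ^ k).
have p0 : (0 < 2 ^ k.+1)%N by exact: expn2_gt0.
rewrite (trpsi_trace (represents_emb X) Xus (gauge_pow p0) a0 (z := emb Z)).
- rewrite trace_emb => [|j].
    by rewrite /Z rtrZ -ns_pow expr_div_n mulrC.
  rewrite /Z mxE; have [W ->] := gram_pow X k.
  case: ((hc W * W) j j) (gram_diag W j) => x y /= x0.
  by rewrite mul0r subr0 mulr_ge0 // invr_ge0 exprn_ge0 // ltW.
- exact: represents_bounded (represents_emb Z).
move=> l v l0 Hl; rewrite (represents_emb Z).2; apply/funext => i.
have Hv : embop (hc X * X) v = ((l * a) ^+ 2)%:C%C *: v.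
  rewrite embopM -adj_emb -[LHS]/((adjop (embop X) \o embop X) v).
  rewrite -(modulus_sqr (cop_emb X).1 Xus) /= Hl.
  by rewrite (bopZ (bop_modulus Xus)) Hl scalerA -rmorphM expr2.
have := embop_eig (2 ^ k).-1 Hv; rewrite prednK ?expn2_gt0 // => E.
rewrite /Z embopZ E scalerA l2_scaleE -rmorphM; congr (_%:C%C * _).
rewrite -exprM -expnS exprMn mulrC mulfK //.
by rewrite expf_neq0 // gt_eqF.
Qed.

End Embedding.

Section PowerNorm.
Context (R : realType).

(** Repeated squaring, which is convex and nondecreasing on the half-line. *)
Lemma convex_pow k : convex_function (`[0, +oo[%classic : set R) (fun t : R => t ^+ (2 ^ k)).
Proof.
move=> t x y; rewrite !inE /= !in_itv /= !andbT => x0 y0.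
have w0 : 0 <= t%:num :> R by []. have w1 : t%:num <= 1 :> R by [].
have E (u v : R^o) : conv t u v = t%:num * u + (1 - t%:num) * v by exact: convRE.
have E1 : conv t x y = t%:num * (x : R) + (1 - t%:num) * (y : R) :> R by [].
rewrite E E1; move: (x : R) (y : R) x0 y0 => {E E1} {}x {}y x0 y0; move: (t%:num : R) w0 w1 => w w0 w1.
have w1' : 0 <= 1 - w by rewrite subr_ge0.
have H (a b : R) : (w * a + (1 - w) * b) ^+ 2 <= w * a ^+ 2 + (1 - w) * b ^+ 2.
  rewrite -subr_ge0 (_ : _ - _ = w * (1 - w) * (a - b) ^+ 2); last by ring.
  exact: mulr_ge0 (mulr_ge0 w0 w1') (sqr_ge0 _).
elim: k => [|k IH]; first by rewrite expn0 !expr1.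
rewrite expnSr !exprM; apply: le_trans (H _ _).
have p0 : 0 <= (w * x + (1 - w) * y) ^+ (2 ^ k).
  exact: exprn_ge0 (addr_ge0 (mulr_ge0 w0 x0) (mulr_ge0 w1' y0)).
by apply: lerXn2r (IH); rewrite nnegrE ?p0 // (le_trans p0 IH).
Qed.

Section Emb.
Variables (I : choiceType) (n : nat) (e : 'I_n.+1 -> I).
Hypothesis inj_e : injective e.

Lemma schatten_norm_emb k (X : 'M[R[i]]_n.+1) :
  schatten_norm (fun t : R => t ^+ (2 ^ k.+1)) (emb e X) = (ns k X)%:E.
Proof.
rewrite /schatten_norm asboolT; last exact: convex_pow.
have E (a : R) : 0 < a ->
    (trpsi (fun t : R => (t ^+ (2 ^ k.+1))%R) (emb e X) a <= 1)%E = (ns k X <= a).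
  move=> a0; rewrite trpsi_emb // lee_fin -{1}[1](expr1n _ (2 ^ k.+1)).
  rewrite ler_pXn2r ?nnegrE ?divr_ge0 ?ns_ge0 ?(ltW a0) ?expn2_gt0 //.
  by rewrite ler_pdivrMr // mul1r.
apply/eqP; rewrite eq_le; apply/andP; split.
  apply/lee_addgt0Pr => eps e0; apply: ereal_inf_lbound.
  exists (ns k X + eps) => //; have a0 : 0 < ns k X + eps by rewrite ltr_wpDl ?ns_ge0.
  by split=> //; rewrite E // lerDl ltW.
apply: le_ereal_inf_tmp => _ [a [a0 ha] <-].
by rewrite lee_fin -E.
Qed.

Lemma schatten_emb k (X : 'M[R[i]]_n.+1) :
  schatten (fun t : R => t ^+ (2 ^ k.+1)) (emb e X).
Proof.
split; first exact: compact_emb.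
by exists 1 => //; rewrite trpsi_emb // ltry.
Qed.

End Emb.

Section Window.
Variables (n N : nat).

Definition window (k : 'I_n.+1) : int := k%:Z - N%:Z.

Lemma inj_window : injective window.
Proof. by move=> k l /addIr [/val_inj]. Qed.

Lemma finite_emb (X : 'M[R[i]]_n.+1) : finitely_supported (fun r : int => r) (emb window X).
Proof.
apply: (@sub_finite_set _ _ ((fun p => (window p.1, window p.2)) @` [set: 'I_n.+1 * 'I_n.+1])).
  move=> [r c] /= [i [j [<- <-]]] xn; move: xn.
  have [[k ->]|ni] := pselect (exists k, i = window k); last first.
    rewrite emb_out ?eqxx //; first exact: inj_window.
    by left=> k; apply/eqP => ik; apply: ni; exists k.
  have [[l ->]|nj] := pselect (exists l, j = window l); last first.
    rewrite emb_out ?eqxx //; first exact: inj_window.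
    by right=> l; apply/eqP => jl; apply: nj; exists l.
  by move=> _; exists (k, l).
exact/finite_image/finite_finset.
Qed.

Lemma toeplitz_emb phi (T : 'M[R[i]]_n.+1) (X : 'M[R[i]]_n.+1) :
  (forall k l, T k l = phi (k%:Z - l%:Z) * X k l) ->
  toeplitz_schur (fun r : int => r) phi (emb window X) = emb window T.
Proof.
move=> TX; apply: embP => [|k l|i j H]; first exact: inj_window.
  rewrite /toeplitz_schur embE; last exact: inj_window.
  by rewrite TX; congr (phi _ * _); rewrite /window; lia.
by rewrite /toeplitz_schur emb_out ?mulr0 //; exact: inj_window.
Qed.

End Window.

Lemma finite_window (x : opmx R int) : finitely_supported (fun r : int => r) x ->
  exists n N (X : 'M[R[i]]_n.+1), x = emb (@window n N) X.
Proof.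
move=> fx.
have [N HN] : exists N : nat, forall i j, x i j != 0 -> (`|i| <= N)%N /\ (`|j| <= N)%N.
  pose F := finmap.enum_fset (fset_set [set rc : int * int | exists i j,
    [/\ i = rc.1, j = rc.2 & x i j != 0]]).
  exists (\max_(p <- F) maxn `|p.1| `|p.2|)%N => i j xij.
  have pF : (i, j) \in F by rewrite /F in_fset_set // inE /=; exists i, j.
  have := @leq_bigmax_seq _ F xpredT (fun p : int * int => maxn `|p.1| `|p.2|) _ pF isT.
  by rewrite /= geq_max => /andP[].
exists (2 * N)%N, N, (\matrix_(k, l) x (window N k) (window N l)).
have out (i : int) : (forall k : 'I_(2 * N).+1, i != window N k) -> ~ (`|i| <= N)%N.
  move=> H iN; have lt : (`|(i + N%:Z)%R| < (2 * N).+1)%N by lia.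
  by have := H (Ordinal lt); rewrite /window /=; lia.
apply: embP => [|k l|i j H]; first exact: inj_window.
  by rewrite mxE.
apply: contrapT => /eqP /HN[h1 h2]; case: H => /out; exact.
Qed.

(** A finitely supported matrix on Z x Z is a finite matrix on an interval of
    integers, the position of which does not matter to a Toeplitz multiplier. *)
Lemma norm_S_matrix k (phi : int -> R[i]) (T : forall n, 'M[R[i]]_n.+1 -> 'M[R[i]]_n.+1) c :
  (forall n (X : 'M[R[i]]_n.+1) k l, T n X k l = phi (k%:Z - l%:Z) * X k l) ->
  (forall n (X : 'M[R[i]]_n.+1), ns k (T n X) <= c * ns k X) -> 0 <= c ->
  (forall c', (forall n (X : 'M[R[i]]_n.+1), ns k (T n X) <= c' * ns k X) -> c <= c') ->
  norm_S (fun t : R => t ^+ (2 ^ k.+1)) phi = c%:E.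
Proof.
move=> hT up c0 low; apply/eqP; rewrite eq_le; apply/andP; split.
  apply: ereal_inf_lbound; split=> [|x fx _]; first by rewrite lee_fin.
  have [n [N [X ->]]] := finite_window fx.
  rewrite (toeplitz_emb N (hT n X)) !schatten_norm_emb; try exact: inj_window.
  by rewrite -EFinM lee_fin.
apply: le_ereal_inf_tmp => -[C||] [C0 HC]; [|by rewrite leey|by []].
rewrite lee_fin; apply: low => n X.
have iw := @inj_window n 0.
have := HC (emb (@window n 0) X) (finite_emb _ _) (schatten_emb iw k X).
by rewrite (toeplitz_emb 0 (hT n X)) !schatten_norm_emb // -EFinM lee_fin.
Qed.

End PowerNorm.

(** * The constants *)

Section Constants.
Context (R : realType).

(** The cotangent of x/2 is the positive root of c^2 = 1 + 2 c cot x. *)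
Lemma inv_tan_double k :
  let c j := (tan (ang R j.+1))^-1 in c k.+1 ^+ 2 = 1 + 2 * c k * c k.+1.
Proof.
move=> c; rewrite /c /tan (ang_double R k.+1) sin_mulr2n cos_mulr2n.
have := cos2Dsin2 (ang R k.+2); have := sin_ang_gt0 R k.+2; have := cos_ang_gt0 R k.+1.
move: (cos _) (sin _) => x s x0 s0 e; rewrite !invf_div.
have xn : x != 0 by rewrite gt_eqF.
have sn : s != 0 by rewrite gt_eqF.
have -> : x ^+ 2 *+ 2 - 1 = x ^+ 2 - s ^+ 2 by rewrite -[in LHS]e mulr2n; ring.
by field; rewrite xn sn.
Qed.

Lemma inv_tan1 : (tan (ang R 1))^-1 = 1.
Proof.
rewrite /tan sin_cos_ang1 divff ?invr1 // gt_eqF //; exact: cos_ang_gt0.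
Qed.

Lemma htrans_upper k n (X : 'M[R[i]]_n.+1) :
  ns k (htrans X) <= (tan (ang R k.+1))^-1 * ns k X.
Proof.
elim: k n X => [|k IH] n X; first by rewrite inv_tan1 mul1r /= hs_htrans.
apply: (htrans_double (c := (tan (ang R k.+1))^-1)) (IH n) X.
- by rewrite invr_ge0 ltW // tan_ang_gt0.
- by rewrite invr_gt0 tan_ang_gt0.
- exact: inv_tan_double.
Qed.

Lemma hilbert_entry n (X : 'M[R[i]]_n.+1) k l :
  htrans X k l = hilbert R (k%:Z - l%:Z) * X k l.
Proof.
rewrite mxE /hilbert subr_ge0 lez_nat; case: ifP => _; first by rewrite mul1r.
by rewrite mulN1r.
Qed.

Lemma riesz_entry n (X : 'M[R[i]]_n.+1) k l :
  rproj X k l = riesz R (k%:Z - l%:Z) * X k l.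
Proof.
rewrite mxE /riesz subr_ge0 lez_nat; case: ifP => _; first by rewrite mul1r.
by rewrite mul0r.
Qed.

Lemma norm_hilbert k : norm_S (fun t : R => t ^+ (2 ^ k.+1)) (@hilbert R) =
  (cot (pi / (2 * (2 ^ k.+1)%:R)))%:E.
Proof.
have -> : cot (pi / (2 * (2 ^ k.+1)%:R)) = (tan (ang R k.+1))^-1.
  by rewrite /ang exprS -natrX /cot /tan invf_div.
apply: (norm_S_matrix (T := fun n => @htrans R n)).
- exact: hilbert_entry.
- exact: htrans_upper.
- by rewrite invr_ge0 ltW // tan_ang_gt0.
- exact: htrans_lower.
Qed.

Lemma norm_riesz : norm_S (fun t : R => t ^+ 4) (@riesz R) = (Num.sqrt 2)%:E.
Proof.
apply: (norm_S_matrix (k := 1) (T := fun n => @rproj R n)).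
- exact: riesz_entry.
- by move=> n X; exact: rproj_four.
- exact: sqrtr_ge0.
- exact: rproj_lower.
Qed.

End Constants.

Theorem theorem1p4 (R : realType) :
  [/\ (forall psi : R -> R,
        (forall t : R, 0 <= t -> 0 <= psi t) ->
        {within `[0, +oo[, continuous psi} ->
        (forall s t : R, 0 <= s -> s <= t -> psi s <= psi t) ->
        (forall t : R, 0 <= t -> (psi t = 0 <-> t = 0)) ->
        norm_SS psi (@riesz R) = norm_S psi (@riesz R) /\
        norm_SS psi (@hilbert R) = norm_S psi (@hilbert R)),
      (forall k p : nat, (1 <= k)%N -> p = (2 ^ k)%N ->
        norm_S (fun t : R => t ^+ p) (@hilbert R)
          = (cot (pi / (2 * p%:R)))%:E)
    & norm_S (fun t : R => t ^+ 4) (@riesz R) = (Num.sqrt 2)%:E].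
Proof.
split=> [psi p0 pc pm pz|[//|k] p _ ->|]; last 2 first.
- exact: norm_hilbert.
- exact: norm_riesz.
have gp : gauge psi by exact: gaugeP.
have cp := pcontinuousP pc.
by split; apply: norm_SS_eq => // k l kl; rewrite /riesz /hilbert kl.
Qed.
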